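(* Let $\mathcal{S}$ be the set of integers $\geq 2$ that are not perfect powers, i.e. $\mathcal{S}=\{2,3,5,6,7,10,11,\ldots\}$. Let $M$ be a function from $\mathcal{S}$ to sets of positive integers such that, for each $s\in\mathcal{S}$, (i) if $m\in M(s)$ then each (positive) divisor of $m$ is in $M(s)$, and (ii) if $M(s)$ is infinite then $M(s)$ is equal to the set of all positive integers. (The set $M(s)$ may be empty.) Then there is a real number $x$ such that, for every $s\in\mathcal{S}$ and every positive integer $m$, $x$ is simply normal to base $s^m$ if and only if $m\in M(s)$. Moreover, the set of real numbers $x$ that satisfy this condition has full Hausdorff dimension (that is, Hausdorff dimension $1$).
   Context: A base is an integer $s\geq 2$. A real number $x$ whose expansion in base $s$ is $x=\lfloor x\rfloor+\sum_{j\geq 1}a_j s^{-j}$, with $a_j\in\{0,1,\ldots,s-1\}$, is simply normal to base $s$ if for every digit $d\in\{0,\ldots,s-1\}$, $\lim_{n\to\infty}\frac{\#\{j:1\leq j\leq n,\ a_j=d\}}{n}=\frac1s$. A perfect power is an integer of the form $a^k$ with $a\geq 1$ and $k\geq 2$ integers. *)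

(* Defs.v *)
From mathcomp Require Import all_boot all_order all_algebra.
From mathcomp Require Import all_classical all_reals all_analysis.
Import Order.TTheory GRing.Theory Num.Theory.
Import numFieldNormedType.Exports.

Set Implicit Arguments.
Unset Strict Implicit.
Unset Printing Implicit Defensive.

Local Open Scope classical_set_scope.
Local Open Scope ring_scope.

Definition perfect_power (n : nat) : Prop :=
  exists a k : nat, [/\ (1 <= a)%N, (2 <= k)%N & n = (a ^ k)%N].

Definition non_perfect_powers : set nat :=
  [set s | (2 <= s)%N /\ ~ perfect_power s].

Section SimpleNormality.
Variable R : realType.
Implicit Types (x : R) (s d : nat) (a : nat -> nat).

(* The digits are a 1, a 2, ...; the value a 0 plays no role. *)
Definition is_expansion s x a : Prop :=
  (forall j, (1 <= j)%N -> (a j < s)%N) /\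
  ((Num.floor x)%:~R + \sum_(1 <= j < n.+1) (a j)%:R / s%:R ^+ j)
    @[n --> \oo] --> x.

Definition digit_count a d (n : nat) : nat :=
  (\sum_(1 <= j < n.+1) (a j == d))%N.

(* For s >= 2 every x has an expansion.  It is unique unless x is a fraction
   whose denominator is a power of s; such an x may have two expansions, one
   ending in zeros and one ending in digits s - 1, and neither of them has
   digit frequencies 1/s, so the existential is insensitive to the choice. *)
Definition simply_normal s x : Prop :=
  exists a, is_expansion s x a /\
    forall d, (d < s)%N ->
      ((digit_count a d n)%:R / n%:R : R) @[n --> \oo] --> (s%:R^-1 : R).

End SimpleNormality.

Section HausdorffDimension.
Variable R : realType.
Implicit Types (t delta : R) (A U : set R).
Local Open Scope ereal_scope.

(* Adding 0 gives the empty set diameter 0 instead of -oo. *)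
Definition diameter U : \bar R :=
  ereal_sup ([set 0] `|` [set `|x - y|%:E | x in U & y in U]).

(* The empty set has weight 0 also for t = 0, whereas 0 `^ 0 = 1, so that the
   0-dimensional measure is the counting measure. *)
Definition hausdorff_weight t U : \bar R :=
  if U == set0 then 0 else diameter U `^ t.

Definition hausdorff_premeasure t delta A : \bar R :=
  ereal_inf [set \sum_(0 <= i <oo) hausdorff_weight t (U i) |
    U in [set U : (set R)^nat |
           A `<=` \bigcup_i U i /\ forall i, diameter (U i) <= delta%:E]].

Definition hausdorff_measure t A : \bar R :=
  ereal_sup [set hausdorff_premeasure t delta A |
    delta in [set delta | (0 < delta)%R]].

Definition hausdorff_dim A : \bar R :=
  ereal_inf [set t%:E | t in [set t | (0 <= t)%R /\ hausdorff_measure t A = 0]].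

End HausdorffDimension.

(* Main.v *)
(* A point of the set is built along a tree of intervals whose lengths 1/q_j shrink in stages, each
   of which serves one pair (s, m0).  A step of the stage appends a long word of independent digits
   in base b = s^L, drawn from a law that weights the i-th base-s subdigit of a base-b digit by
   cos(2 pi i/m0).  Such a law leaves the aligned blocks of m base-s digits uniform unless m0
   divides m, but it favours some digit in base s^m0.  If m0 is not in M(s), then by (i) it divides
   no element of M(s), and by (ii) M(s) is finite, so that L can be a common multiple of m0 and of
   the elements of M(s); if m0 is in M(s), the uniform law is used.

   A base r that is not a power of s is handled by the second moment of the Weyl sums of r^k x.  The
   characteristic function of a random word is a product of factors phi(y/b^j), each bounded away
   from 1 unless the corresponding base-b digit of y is 0 or b-1.  Since log r/log b is irrational,
   the leading digits of y r^k follow Benford's law as k varies, so the products are small on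
   average.  Fejer's kernel turns small Weyl sums into digit frequencies.

   Words that meet all requirements have probability at least 1/2, hence, the law being nearly
   uniform, there are at least (q_(j+1)/q_j)^t of them, where t < 1 is given.  Parametrizing the tree
   by [0, 1[ and using the subadditivity of Lebesgue measure on the parameters then shows that the
   set has positive measure in every dimension below t. *)
Require Import Defs.
From mathcomp Require Import all_boot all_order all_algebra.
From mathcomp Require Import all_classical all_reals all_analysis.
From mathcomp Require Import ring lra zify.
Import Order.TTheory GRing.Theory Num.Theory.
Import numFieldNormedType.Exports.

Set Implicit Arguments.
Unset Strict Implicit.
Unset Printing Implicit Defensive.

Local Open Scope classical_set_scope.
Local Open Scope ring_scope.

(** How long a word must be for a requirement to become probable depends on the base and on the
    tolerance, so no finite word serves all bases. Stage [i] therefore looks only at bases up to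
    [i], with tolerance [1 / (i + 1)], and every pair [(s, m0)] comes back in infinitely many
    stages. The excess [c0] and the favoured digit [d0] of a pair must not depend on the stage: then
    one fixed digit of base [s ^ m0] is too frequent at infinitely many times, which refutes simple
    normality whatever the other stages do. For [m] in [M s], upper bounds in all late stages are
    enough, since the frequencies of the digits sum to 1.

    The bias costs dimension: the likeliest digit of base [b] has probability at most [(1 + a) / b],
    so enough words survive as soon as [1 + a < 2 ^ (1 - t)], a condition free of [b]. In bases
    independent of [s] the bias is harmless, because the decay of the characteristic function rests
    only on the digits 0 and 1 having positive probability. *)

(** * Perfect powers *)

(** Divided by their gcd, the exponents become coprime [h'] and [m']. A Bezout relation
    [a * h' = b * m' + 1] then gives [s = (s ^ a / r ^ b) ^ h'], which forces [h' = 1]. *)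
Lemma non_perfect_power_root (s r h m : nat) :
  non_perfect_powers s -> (0 < h)%N -> (r ^ h = s ^ m)%N ->
  exists k, (r = s ^ k)%N.
Proof.
move=> [s2 nps] h0 E.
have s0 : (0 < s)%N by lia.
have [m0|m0] := posnP m.
  exists 0%N; move: E; rewrite m0 !expn0 => E.
  case: r E => [|[|r]] E //; first by rewrite exp0n in E.
  by have := @ltn_exp2l r.+2 0 h isT; rewrite h0 expn0 E ltnn.
pose g := gcdn h m.
have g0 : (0 < g)%N by rewrite gcdn_gt0 h0.
pose h' := (h %/ g)%N; pose m' := (m %/ g)%N.
have hE : h = (h' * g)%N by rewrite divnK ?dvdn_gcdl.
have mE : m = (m' * g)%N by rewrite divnK ?dvdn_gcdr.
have h'0 : (0 < h')%N by move: h0; rewrite hE muln_gt0 => /andP[].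
have cop : coprime h' m'.
  have : (g * gcdn h' m' == g * 1)%N.
    by rewrite muln_gcdr muln1 mulnC -hE mulnC -mE.
  by rewrite eqn_pmul2l.
have E' : (r ^ h' = s ^ m')%N.
  have /eqP := E; rewrite hE mE !expnM eqn_exp2r // => /eqP //.
have r0 : (0 < r)%N.
  rewrite lt0n; apply/negP => /eqP r0; move: E'; rewrite r0 exp0n //.
  by move/esym/eqP; rewrite expn_eq0; lia.
case: (egcdnP m' h'0) => a b ab _.
rewrite (eqP cop) in ab.
have dv : ((r ^ b) ^ h' %| (s ^ a) ^ h')%N.
  rewrite -!expnM ab expnD mulnC expnM -expnM mulnC (mulnC b) expnM E' -expnM.
  by rewrite mulnC dvdn_mulr // mulnC.
have h1 : h' = 1%N.
  apply/eqP; rewrite eqn_leq h'0 andbT leqNgt; apply/negP => h2.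
  apply: nps; exists ((s ^ a) %/ (r ^ b))%N, h'; split=> //.
    by rewrite divn_gt0 ?expn_gt0 ?r0 // -(@leq_exp2r _ _ h') // dvdn_leq // !expn_gt0 s0.
  apply/eqP; rewrite -(@eqn_pmul2r ((r ^ b) ^ h')) ?expn_gt0 ?r0 //.
  rewrite -expnMn divnK; last by rewrite -(@dvdn_pexp2r _ _ h').
  by rewrite -!expnM ab expnD (mulnC b) expnM E' -expnM expn1 mulnC (mulnC m').
exists m'; by rewrite -E' h1 expn1.
Qed.

Lemma non_perfect_power_inj (s s' k m : nat) :
  non_perfect_powers s -> non_perfect_powers s' -> (0 < k)%N ->
  (s ^ k = s' ^ m)%N -> s = s'.
Proof.
move=> ns ns' k0 E; have [j sj] := non_perfect_power_root ns' k0 E.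
case: j sj => [|[|j]] sj; first by case: ns; rewrite sj.
  by rewrite sj expn1.
case: ns => _ []; exists s', j.+2; split => //; case: ns'; lia.
Qed.

(** * Trigonometry and Fejer kernels *)

(* [lia] is slow when real-valued hypotheses are in the context. *)
Ltac nlia :=
  repeat match goal with
  | H := _ |- _ => clearbody H
  end;
  repeat match goal with
  | H : is_true (@Order.le _ _ _ _) |- _ => clear H
  | H : is_true (@Order.lt _ _ _ _) |- _ => clear H
  | H : forall _, _ |- _ => clear H
  end; lia.

Section Trig.
Variable R : realType.
Implicit Types x y t a : R.

Lemma le_of_eq x y : x = y -> x <= y.
Proof. by move=> ->. Qed.

Definition cs x : R := cos (2 * pi * x).
Definition sn x : R := sin (2 * pi * x).

Lemma csD x y : cs (x + y) = cs x * cs y - sn x * sn y.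
Proof. by rewrite /cs mulrDr cosD. Qed.

Lemma snD x y : sn (x + y) = sn x * cs y + cs x * sn y.
Proof. by rewrite /sn mulrDr sinD. Qed.

Lemma csN x : cs (- x) = cs x.
Proof. by rewrite /cs mulrN cosN. Qed.

Lemma snN x : sn (- x) = - sn x.
Proof. by rewrite /sn mulrN sinN. Qed.

Lemma csB x y : cs (x - y) = cs x * cs y + sn x * sn y.
Proof. by rewrite csD csN snN mulrN opprK. Qed.

Lemma snB x y : sn (x - y) = sn x * cs y - cs x * sn y.
Proof. by rewrite snD csN snN mulrN. Qed.

Lemma cs0 : cs 0 = 1. Proof. by rewrite /cs mulr0 cos0. Qed.

Lemma sn0 : sn 0 = 0. Proof. by rewrite /sn mulr0 sin0. Qed.

Lemma cs2Dsn2 x : cs x ^+ 2 + sn x ^+ 2 = 1.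
Proof. exact: cos2Dsin2. Qed.

Lemma cs_max x : `|cs x| <= 1. Proof. exact: cos_max. Qed.

Lemma sn_max x : `|sn x| <= 1. Proof. exact: sin_max. Qed.

Lemma cs_nat (n : nat) : cs n%:R = 1.
Proof.
rewrite /cs (_ : 2 * pi * n%:R = 0 + (pi *+ 2) *+ n) ?(periodicn (@cosD2pi R)) ?cos0 //.
by rewrite add0r -[RHS]mulr_natr -(mulr_natl pi 2).
Qed.

Lemma sn_nat (n : nat) : sn n%:R = 0.
Proof.
rewrite /sn (_ : 2 * pi * n%:R = 0 + (pi *+ 2) *+ n) ?(periodicn (@sinD2pi R)) ?sin0 //.
by rewrite add0r -[RHS]mulr_natr -(mulr_natl pi 2).
Qed.

Lemma cs_int (z : int) : cs z%:~R = 1.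
Proof.
case: (intP z) => [|n|n]; first by rewrite cs0.
  by rewrite -pmulrn cs_nat.
by rewrite mulrNz csN -pmulrn cs_nat.
Qed.

Lemma sn_int (z : int) : sn z%:~R = 0.
Proof.
case: (intP z) => [|n|n]; first by rewrite sn0.
  by rewrite -pmulrn sn_nat.
by rewrite mulrNz snN -pmulrn sn_nat oppr0.
Qed.

Lemma csBint x (z : int) : cs (x - z%:~R) = cs x.
Proof. by rewrite csB cs_int sn_int mulr1 mulr0 addr0. Qed.

Lemma snBint x (z : int) : sn (x - z%:~R) = sn x.
Proof. by rewrite snB cs_int sn_int mulr1 mulr0 subr0. Qed.

Lemma cs_le_lip x y : `|cs x - cs y| <= 2 * pi * `|x - y|.
Proof.
wlog xy : x y / x <= y.
  move=> H; case/orP: (le_total x y) => [|] /H //.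
  by rewrite distrC [X in _ <= _ * X]distrC.
have pi0 : 0 < (pi : R) := pi_gt0 R.
have xy' : 2 * pi * x <= 2 * pi * y by rewrite ler_wpM2l //; lra.
have [c _ E] := @MVT_segment R (@cos R) (fun t => - sin t) _ _ xy'
  (fun z _ => is_derive_cos z) (continuous_subspaceT (@continuous_cos R)).
rewrite distrC /cs E normrM normrN -mulrBr normrM distrC.
rewrite [X in _ * (X * _)]ger0_norm; last by lra.
by rewrite ler_piMl ?sin_max // mulr_ge0 //; lra.
Qed.

Lemma sn_le_lip x y : `|sn x - sn y| <= 2 * pi * `|x - y|.
Proof.
wlog xy : x y / x <= y.
  move=> H; case/orP: (le_total x y) => [|] /H //.
  by rewrite distrC [X in _ <= _ * X]distrC.
have pi0 : 0 < (pi : R) := pi_gt0 R.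
have xy' : 2 * pi * x <= 2 * pi * y by rewrite ler_wpM2l //; lra.
have [c _ E] := @MVT_segment R (@sin R) (@cos R) _ _ xy'
  (fun z _ => is_derive_sin z) (continuous_subspaceT (@continuous_sin R)).
rewrite distrC /sn E normrM -mulrBr normrM distrC.
rewrite [X in _ * (X * _)]ger0_norm; last by lra.
by rewrite ler_piMl ?cos_max // mulr_ge0 //; lra.
Qed.

Lemma cs_lt1 t : 0 < t <= 2^-1 -> cs t < 1.
Proof.
move=> /andP[t0 t1]; have pi0 : 0 < (pi : R) := pi_gt0 R.
have p : pi * t <= pi * 2^-1 by rewrite ler_pM2l.
have p0 : 0 < pi * t by rewrite mulr_gt0.
rewrite -cos0 /cs ltr_cos ?in_itv /=; [lra | |]; apply/andP; split; lra.
Qed.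

Lemma cs_le_far r t : 0 <= r -> r <= t -> t <= 1 - r -> cs t <= cs r.
Proof.
wlog t2 : t / t <= 2^-1.
  move=> H r0 rt tr; have [/H|t2] := lerP t 2^-1; first exact.
  rewrite -(csBint t 1%:Z) -csN opprB; apply: H => //=; lra.
move=> r0 rt _; have pi0 : 0 < (pi : R) := pi_gt0 R.
have p1 : pi * r <= pi * t by rewrite ler_pM2l.
have p2 : pi * t <= pi * 2^-1 by rewrite ler_pM2l.
have p3 : 0 <= pi * r by rewrite mulr_ge0 // ltW.
rewrite /cs leNgt ltr_cos ?in_itv /=; [lra | |]; apply/andP; split; lra.
Qed.

Lemma sn_half2 a : 2 * sn (a / 2) ^+ 2 = 1 - cs a.
Proof.
rewrite [in RHS](splitr a) csD -!expr2.
by have := cs2Dsn2 (a / 2); lra.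
Qed.

Lemma sn_half_neq0 a : (forall z : int, a != z%:~R) -> sn (a / 2) != 0.
Proof.
move=> az; apply/eqP => s0; have := sn_half2 a.
rewrite s0 expr0n mulr0 -(csBint a (Num.floor a)) => /esym.
have /andP[f0 f1] := floor_itv a; set t := a - _.
have t1 : t < 1 by rewrite /t; move: f1; rewrite intrD; lra.
have t0 : 0 < t by rewrite lt_neqAle /t subr_ge0 f0 andbT eq_sym subr_eq0.
have [t2|t2] := lerP t 2^-1; first by have := @cs_lt1 t; rewrite t0 t2 => /(_ isT); lra.
rewrite -(csBint t 1%:Z) -csN opprB /=.
have := @cs_lt1 (1 - t); have -> : 0 < 1 - t <= 2^-1 by apply/andP; split; lra.
by move=> /(_ isT); lra.
Qed.

Lemma sum_cs_progression N a t :
  2 * sn (a / 2) * (\sum_(0 <= k < N) cs (k%:R * a + t)) =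
  sn (N%:R * a + t - a / 2) - sn (t - a / 2).
Proof.
elim: N => [|N IH]; first by rewrite big_geq // mulr0 mul0r add0r subrr.
rewrite big_nat_recr //= mulrDr IH.
have -> : N.+1%:R * a + t - a / 2 = N%:R * a + t + a / 2 by rewrite -addn1 natrD; field.
by rewrite (snB (N%:R * a + t)) (snD (N%:R * a + t)); ring.
Qed.

Lemma sum_sn_progression N a t :
  2 * sn (a / 2) * (\sum_(0 <= k < N) sn (k%:R * a + t)) =
  cs (t - a / 2) - cs (N%:R * a + t - a / 2).
Proof.
elim: N => [|N IH]; first by rewrite big_geq // mulr0 mul0r add0r subrr.
rewrite big_nat_recr //= mulrDr IH.
have -> : N.+1%:R * a + t - a / 2 = N%:R * a + t + a / 2 by rewrite -addn1 natrD; field.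
by rewrite (csB (N%:R * a + t)) (csD (N%:R * a + t)); ring.
Qed.

Lemma sum_cs_progression_le N a t : sn (a / 2) != 0 ->
  `|\sum_(0 <= k < N) cs (k%:R * a + t)| <= `|sn (a / 2)|^-1.
Proof.
move=> s0; rewrite -div1r ler_pdivlMr ?normr_gt0 // -normrM.
rewrite -(@ler_pM2l _ 2) // -[X in X * `|_|](ger0_norm (ler0n R 2)) -normrM.
set S := \sum_(_ <= _ < _) _.
have -> : 2 * (S * sn (a / 2)) = 2 * sn (a / 2) * S by ring.
rewrite sum_cs_progression mulr1.
apply: le_trans (ler_normB _ _) _.
by have := sn_max (N%:R * a + t - a / 2); have := sn_max (t - a / 2); lra.
Qed.

Lemma sum_sn_progression_le N a t : sn (a / 2) != 0 ->
  `|\sum_(0 <= k < N) sn (k%:R * a + t)| <= `|sn (a / 2)|^-1.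
Proof.
move=> s0; rewrite -div1r ler_pdivlMr ?normr_gt0 // -normrM.
rewrite -(@ler_pM2l _ 2) // -[X in X * `|_|](ger0_norm (ler0n R 2)) -normrM.
set S := \sum_(_ <= _ < _) _.
have -> : 2 * (S * sn (a / 2)) = 2 * sn (a / 2) * S by ring.
rewrite sum_sn_progression mulr1.
apply: le_trans (ler_normB _ _) _.
by have := cs_max (N%:R * a + t - a / 2); have := cs_max (t - a / 2); lra.
Qed.

Lemma sqmod_sum (s : seq nat) (f : nat -> R) :
  (\sum_(k <- s) cs (f k)) ^+ 2 + (\sum_(k <- s) sn (f k)) ^+ 2 =
  \sum_(k <- s) \sum_(l <- s) cs (f k - f l).
Proof.
rewrite !expr2 !big_distrlr /= -big_split /=; apply: eq_bigr => k _.
by rewrite -big_split /=; apply: eq_bigr => l _; rewrite csB.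
Qed.

(* The squared modulus of [sum_(h < n) e^(2 pi i h x)], normalized by [fejer n 0 = 1]. *)
Definition fejer (n : nat) x : R :=
  ((\sum_(h <- iota 0 n) cs (h%:R * x)) ^+ 2 +
   (\sum_(h <- iota 0 n) sn (h%:R * x)) ^+ 2) / n%:R ^+ 2.

Lemma fejerE n x :
  fejer n x = (\sum_(h <- iota 0 n) \sum_(l <- iota 0 n) cs ((h%:R - l%:R) * x))
              / n%:R ^+ 2.
Proof.
rewrite /fejer sqmod_sum; congr (_ / _).
by apply: eq_bigr => h _; apply: eq_bigr => l _; rewrite mulrBl.
Qed.

Lemma fejer_ge0 n x : 0 <= fejer n x.
Proof. by rewrite /fejer divr_ge0 ?exprn_ge0 // addr_ge0 // sqr_ge0. Qed.

Lemma fejerBint n x (z : int) : fejer n (x - z%:~R) = fejer n x.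
Proof.
rewrite /fejer; congr ((_ ^+ 2 + _ ^+ 2) / _); apply: eq_bigr => h _;
 by rewrite mulrBr -[h%:R * z%:~R]/((h%:Z)%:~R * _) -intrM (csBint, snBint).
Qed.

Lemma sum_cs_roots n (d : int) y : (0 < `|d|)%N -> (`|d| < n)%N ->
  \sum_(0 <= m < n) cs (d%:~R * (y - m%:R / n%:R)) = 0.
Proof.
move=> d0 dn; have n0 : (n%:R : R) != 0 by rewrite pnatr_eq0; lia.
pose a : R := - d%:~R / n%:R.
have : sn (a / 2) != 0.
  apply: sn_half_neq0 => z; apply/negP => /eqP.
  move/(congr1 (fun x => - (x * n%:R))); rewrite /a -mulrA mulVf // mulr1 opprK.
  rewrite -[n%:R]/((n%:Z)%:~R) -intrM -mulrNz => /intr_inj E.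
  move: d0 dn; rewrite E abszN abszM absz_nat => d0 dn.
  have : (1 <= `|z|)%N by case: (`|z|%N) d0; rewrite ?mul0n //.
  by move=> z1; have := leq_mul z1 (leqnn n); lia.
move=> s0; apply: (mulfI (x := 2 * sn (a / 2))); first by rewrite mulf_neq0 // pnatr_eq0.
rewrite mulr0 (eq_bigr (fun m => cs (m%:R * a + d%:~R * y))); last first.
  by move=> m _; congr cs; rewrite /a; field.
rewrite sum_cs_progression; apply/eqP; rewrite subr_eq0; apply/eqP.
have -> : n%:R * a + d%:~R * y - a / 2 = d%:~R * y - a / 2 - d%:~R by rewrite /a; field.
exact: snBint.
Qed.

(** In the double sum over [h] and [l], the terms with [h <> l] cancel over the [n] equally spaced
    shifts. The translates thus form a partition of unity, from which [fejer_count] builds a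
    majorant of an interval. *)
Lemma sum_fejer n y : (0 < n)%N ->
  \sum_(0 <= m < n) fejer n (y - m%:R / n%:R) = 1.
Proof.
move=> n_gt0; have n0 : (n%:R : R) != 0 by rewrite pnatr_eq0; lia.
under eq_bigr do rewrite fejerE.
rewrite -mulr_suml; apply: (mulIf (x := n%:R ^+ 2)); first by rewrite expf_neq0.
rewrite divfK ?expf_neq0 // mul1r exchange_big /=.
rewrite (eq_big_seq (fun _ => n%:R)).
  by rewrite big_const_seq iter_addr addr0 count_predT size_iota expr2 mulr_natr.
move=> h; rewrite mem_iota /= add0n => hn.
rewrite exchange_big /= (bigD1_seq h) ?iota_uniq ?mem_iota //=.
rewrite [X in _ + X]big1_seq ?addr0.
  under eq_bigr do rewrite subrr mul0r cs0.
  by rewrite big_const_nat iter_addr addr0 subn0.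
move=> l; rewrite mem_iota /= add0n => /andP[lh ln].
have -> : (h%:R - l%:R : R) = (h%:Z - l%:Z)%:~R by rewrite intrB.
by apply: sum_cs_roots; lia.
Qed.

Lemma fejer_far n x r : 0 < r -> r <= 2^-1 -> r <= x -> x <= 1 - r ->
  fejer n x <= 4 / (1 - cs r) / n%:R ^+ 2.
Proof.
move=> r0 r2 rx xr; have c1 : cs r < 1 by apply: cs_lt1; rewrite r0.
have cx := @cs_le_far r x (ltW r0) rx xr.
rewrite /fejer ler_wpM2r ?invr_ge0 ?exprn_ge0 //.
have E := sn_half2 x.
have s0 : sn (x / 2) != 0.
  by apply/eqP => s0; move: E; rewrite s0 expr0n mulr0; lra.
have sq (u : R) : `|u| <= `|sn (x / 2)|^-1 -> u ^+ 2 <= (sn (x / 2) ^+ 2)^-1.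
  by move=> H; rewrite -real_normK ?num_real // -(real_normK (num_real (sn _))) -exprVn lerXn2r ?nnegrE ?invr_ge0.
have b1 := sq _ (@sum_cs_progression_le n x 0 s0).
have b2 := sq _ (@sum_sn_progression_le n x 0 s0).
have -> : 4 / (1 - cs r) = 2 / ((1 - cs r) / 2) by field; lra.
apply: (@le_trans _ _ (2 * (sn (x / 2) ^+ 2)^-1)); last first.
  rewrite ler_wpM2l // lef_pV2 ?posrE //; lra.
rewrite -[iota 0 n]/(index_iota 0 0 ++ iota 0 n) /=.
have -> : iota 0 n = index_iota 0 n by rewrite /index_iota subn0.
have e1 : \sum_(h <- index_iota 0 n) cs (h%:R * x) = \sum_(0 <= k < n) cs (k%:R * x + 0).
  by apply: eq_bigr => k _; rewrite addr0.
have e2 : \sum_(h <- index_iota 0 n) sn (h%:R * x) = \sum_(0 <= k < n) sn (k%:R * x + 0).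
  by apply: eq_bigr => k _; rewrite addr0.
by rewrite e1 e2; lra.
Qed.

End Trig.

(** * Counting visits to an interval through Weyl sums *)

Section Fejer.
Variable R : realType.
Implicit Types (theta : nat -> R) (s : seq nat).

(** Up to sign, these are the nonzero frequencies that occur in the Fejer kernel of order [n]. *)
Definition small_weyl_sums (n : nat) (e : R) s theta :=
  forall h : nat, (0 < h < n)%N ->
    `|\sum_(k <- s) cs (h%:R * theta k)| <= e * (size s)%:R /\
    `|\sum_(k <- s) sn (h%:R * theta k)| <= e * (size s)%:R.

(** The diagonal gives [1 / n]. A pair [h <> l] has frequency [|h - l|], and the addition formula
    bounds it by one Weyl sum of each kind, hence the [2 * e]. *)
Lemma sum_fejer_le n (e : R) s theta (beta : R) : (0 < n)%N -> 0 <= e ->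
  small_weyl_sums n e s theta ->
  \sum_(k <- s) fejer n (theta k - beta) <= (size s)%:R * (n%:R^-1 + 2 * e).
Proof.
move=> n_gt0 e0 H; have n0 : (n%:R : R) != 0 by rewrite pnatr_eq0; lia.
have np : 0 < (n%:R : R) by rewrite ltr0n.
under eq_bigr do rewrite fejerE.
rewrite -mulr_suml ler_pdivrMr ?exprn_gt0 // exchange_big /=.
set N := (size s)%:R; have N0 : 0 <= N by rewrite ler0n.
apply: (@le_trans _ _ (\sum_(h <- iota 0 n) (N + n%:R * (2 * e * N)))); last first.
  rewrite big_const_seq iter_addr addr0 count_predT size_iota -mulr_natr ?mul1r.
  by apply: le_of_eq; field.
rewrite big_seq [X in _ <= X]big_seq; apply: ler_sum => h; rewrite mem_iota /= add0n => hn.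
rewrite exchange_big /= (bigD1_seq h) ?iota_uniq ?mem_iota //=.
apply: lerD.
  under eq_bigr do rewrite subrr mul0r cs0.
  by rewrite big_const_seq iter_addr addr0 count_predT.
apply: (@le_trans _ _ (\sum_(l <- iota 0 n | l != h) 2 * e * N)); last first.
  rewrite big_const_seq iter_addr addr0 -[X in X <= _]mulr_natl ler_wpM2r //.
    by rewrite !mulr_ge0.
  by rewrite ler_nat -[X in (_ <= X)%N](size_iota 0) count_size.
rewrite big_seq_cond [X in _ <= X]big_seq_cond.
apply: ler_sum => l; rewrite mem_iota /= add0n => /andP[ln lh].
pose d : nat := if (l < h)%N then (h - l)%N else (l - h)%N.
have dn : (0 < d < n)%N by rewrite /d; case: (ltngtP l h) lh => // lh _; clear -ln hn lh; lia.
have [Hc Hs] := H d dn.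
have E (k : nat) : cs ((h%:R - l%:R) * (theta k - beta)) =
     cs (d%:R * theta k) * cs (d%:R * beta) + sn (d%:R * theta k) * sn (d%:R * beta).
  rewrite -csB -mulrBr /d; case: ltnP => hl; first by rewrite natrB // ltnW.
  by rewrite natrB // -csN -mulNr opprB.
under eq_bigr do rewrite E.
rewrite big_split /= -!mulr_suml.
apply: le_trans (ler_norm _) _; apply: le_trans (ler_normD _ _) _; rewrite !normrM.
have -> : 2 * e * N = e * N * 1 + e * N * 1 by ring.
by apply: lerD; apply: ler_pM => //; rewrite ?cs_max ?sn_max.
Qed.

(** The first [M] translates of the kernel, centred at the points [a - r + m / n] of
    [[a - r, c + r]], sum to at least [1 - eps / 8] on [[a, c]], because the remaining ones are
    centred at distance at least [r] modulo 1. Averaged over the sequence they sum to about [M / n],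
    which is close to [c - a + 2 * r]. *)
Lemma fejer_count (eps : R) : 0 < eps -> exists n (e : R), [/\ (0 < n)%N, 0 < e &
  forall s (P : pred nat) theta (a c : R), a <= c -> small_weyl_sums n e s theta ->
   (forall k, k \in s -> P k -> exists z : int, a <= theta k - z%:~R <= c) ->
   (count P s)%:R <= (c - a + eps) * (size s)%:R].
Proof.
wlog e1 : eps / eps <= 1.
  move=> W e0; have [/W|e1] := lerP eps 1; first exact.
  have [n [e [n0 e00 H]]] := W 1 (lexx _) ltr01; exists n, e; split => //.
  move=> s P th a c ac h1 h2; apply: le_trans (H s P th a c ac h1 h2) _.
  by rewrite ler_wpM2r // lerD2l ltW.
move=> e0; pose r := eps / 8.
have r0 : 0 < r by rewrite /r; lra.
have r2 : r <= 2^-1 by rewrite /r; lra.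
have c1 : 0 < 1 - cs r by rewrite subr_gt0; apply: cs_lt1; rewrite r0.
(* For [n > B], both [1 / n] and the total [n * (4 / (1 - cs r) / n ^ 2)] of the far translates are
   at most [eps / 8]. *)
pose B := 4 / (1 - cs r) * 8 / eps + 8 / eps.
have B1 : 0 < 8 / eps by rewrite divr_gt0.
have B2 : 0 < 4 / (1 - cs r) * 8 / eps by rewrite !divr_gt0 // mulr_gt0 // divr_gt0.
pose n := (Num.truncn B).+1.
have nB : B < n%:R by exact: truncnS_gt.
have np : 0 < (n%:R : R) by rewrite ltr0n.
have n0 : (n%:R : R) != 0 by rewrite gt_eqF.
have n1 : n%:R^-1 <= eps / 8.
  by rewrite -[eps / 8]invf_div lef_pV2 ?posrE //; rewrite /B in nB; lra.
have n2 : 4 / (1 - cs r) / n%:R <= eps / 8.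
  rewrite ler_pdivrMr //; have : eps / 8 * B <= eps / 8 * n%:R.
    by rewrite ler_wpM2l //; lra.
  have -> : eps / 8 * B = 4 / (1 - cs r) + 1 by rewrite /B; field; lra.
  lra.
exists n, (eps / 16 / n%:R); split => //; first by rewrite !divr_gt0.
move=> s P th a c ac Hw HP; set N := (size s)%:R : R.
have cN : (count P s)%:R <= N by rewrite ler_nat count_size.
pose X := c - a + 2 * r; have X0 : 0 <= X by rewrite /X; lra.
pose M := (Num.truncn (n%:R * X)).+1.
have M1 : n%:R * X < M%:R by exact: truncnS_gt.
have M2 : M%:R <= n%:R * X + 1.
  rewrite /M -addn1 natrD lerD2r truncn_le mulr_ge0 //.
have XE : X = c - a + eps / 4 by rewrite /X /r; lra.
(* Here [[a - r, c + r]] nearly fills the circle, and the claimed bound is at least the size of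
   [s]. *)
have [nM|Mn] := leqP n M.
  apply: (le_trans cN); rewrite -[X in X <= _]mul1r ler_wpM2r //.
  have : n%:R * 1 <= n%:R * (X + n%:R^-1).
    by rewrite mulrDr mulfV // mulr1; apply: le_trans M2; rewrite ler_nat.
  by rewrite ler_pM2l //; lra.
have X1 : X < 1.
  by rewrite -(ltr_pM2l np) mulr1; apply: lt_trans M1 _; rewrite ltr_nat.
pose T k := \sum_(0 <= m < M) fejer n (th k - (a - r + m%:R / n%:R)).
have T1 k : k \in s -> P k -> 1 - eps / 8 <= T k.
  move=> ks Pk; have [z /andP[z1 z2]] := HP k ks Pk.
  have E1 : \sum_(0 <= m < n) fejer n (th k - (a - r + m%:R / n%:R)) = 1.
    rewrite -[RHS](@sum_fejer R n (th k - (a - r))) //.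
    by apply: eq_bigr => m _; rewrite opprD addrA.
  move: E1; rewrite (big_cat_nat (n := M)) //=; last exact: ltnW.
  rewrite -/(T k); suff : \sum_(M <= m < n) fejer n (th k - (a - r + m%:R / n%:R)) <= eps / 8 by lra.
  apply: le_trans n2.
  apply: (@le_trans _ _ (\sum_(M <= m < n) 4 / (1 - cs r) / n%:R ^+ 2)).
    rewrite big_nat_cond [X in _ <= X]big_nat_cond.
    apply: ler_sum => m /andP[/andP[Mm mn] _].
    (* Shifting by [z - 1] moves the argument into [[r, 1 - r]]. *)
    rewrite -(fejerBint _ _ (z - 1)).
    have mn' : m%:R / n%:R <= (1 : R) by rewrite ler_pdivrMr // mul1r ler_nat ltnW.
    have mM : X <= m%:R / n%:R.
      rewrite ler_pdivlMr // mulrC; apply: le_trans (ltW M1) _; by rewrite ler_nat.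
    rewrite intrB; apply: fejer_far => //; rewrite /X in mM; lra.
  rewrite big_const_nat iter_addr addr0 expr2 invfM -[X in X <= _]mulr_natl.
  apply: (@le_trans _ _ (n%:R * (4 / (1 - cs r) * (n%:R^-1 / n%:R)))).
    rewrite ler_wpM2r //; last by rewrite ler_nat leq_subr.
    by rewrite !mulr_ge0 ?invr_ge0 ?ltW // mulr_ge0.
  by apply: le_of_eq; field; rewrite n0 /= gt_eqF.
have T0 k : 0 <= T k by apply: sumr_ge0 => m _; exact: fejer_ge0.
have T2 : \sum_(k <- s) T k <= M%:R * (N * (n%:R^-1 + 2 * (eps / 16 / n%:R))).
  rewrite /T exchange_big /=.
  apply: (@le_trans _ _ (\sum_(0 <= m < M) (N * (n%:R^-1 + 2 * (eps / 16 / n%:R))))).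
    by apply: ler_sum => m _; apply: sum_fejer_le => //; rewrite !divr_ge0 // ltW.
  by rewrite big_const_nat iter_addr addr0 subn0 [X in _ <= X]mulr_natl.
have T3 : (count P s)%:R * (1 - eps / 8) <= \sum_(k <- s) T k.
  rewrite -sum1_count natr_sum mulr_suml big_seq_cond.
  rewrite [X in _ <= X](bigID (fun k => P k)) /= -[X in X <= _]addr0.
  apply: lerD; last by apply: sumr_ge0.
  rewrite [X in _ <= X]big_seq_cond; apply: ler_sum => k /andP[ks Pk].
  by rewrite mul1r T1.
have T4 : M%:R * (N * (n%:R^-1 + 2 * (eps / 16 / n%:R))) <= N * ((X + eps / 8) * (1 + eps / 8)).
  apply: (@le_trans _ _ ((n%:R * X + 1) * (N * (n%:R^-1 + 2 * (eps / 16 / n%:R))))).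
    rewrite ler_wpM2r // mulr_ge0 // addr_ge0 ?invr_ge0 // mulr_ge0 // !divr_ge0 // ltW //.
  have -> : (n%:R * X + 1) * (N * (n%:R^-1 + 2 * (eps / 16 / n%:R))) =
            N * ((X + n%:R^-1) * (1 + eps / 8)) by field.
  by rewrite ler_wpM2l // ler_wpM2r //; lra.
have T5 : N * ((X + eps / 8) * (1 + eps / 8)) <= N * (X + eps / 8 + eps / 4).
  rewrite ler_wpM2l // mulrDr mulr1 lerD2l.
  have -> : eps / 4 = 2 * (eps / 8) by field.
  by rewrite ler_wpM2r //; lra.
have T6 : (count P s)%:R * (eps / 8) <= N * (eps / 8) by rewrite ler_wpM2r //; lra.
have T7 : (count P s)%:R <= N * (X + eps / 8 + eps / 4) + N * (eps / 8) by lra.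
apply: le_trans T7 _; rewrite -mulrDr mulrC ler_wpM2r //; lra.
Qed.

End Fejer.

(** * Benford estimates *)

Lemma exists_expr_le (R : realType) (x e : R) : 0 <= x < 1 -> 0 < e ->
  exists J, x ^+ J <= e.
Proof.
move=> /andP[x0 x1] e0.
have : (x ^+ n @[n --> \oo] --> 0) by apply: cvg_expr; rewrite ger0_norm.
move/cvgrPdist_lt => /(_ e e0) [J _ /(_ J (leqnn J))] /=.
rewrite sub0r normrN ger0_norm ?exprn_ge0 // => h.
by exists J; exact: ltW.
Qed.

Lemma big_nat_block (T : Type) (idx : T) (op : Monoid.law idx) (b A B : nat)
  (F : nat -> T) : (A <= B)%N ->
  \big[op/idx]_(A * b <= w < B * b) F w =
  \big[op/idx]_(A <= v < B) \big[op/idx]_(0 <= D < b) F (v * b + D)%N.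
Proof.
elim: B => [|B IH]; first by rewrite leqn0 => /eqP ->; rewrite mul0n !big_geq.
rewrite leq_eqVlt => /predU1P[->|]; first by rewrite !big_geq.
rewrite ltnS => AB; rewrite big_nat_recr //= -IH //.
rewrite (big_cat_nat (n := (B * b)%N)) /= ?leq_mul //.
congr (op _ _); rewrite mulSn addnC -{1}(add0n (B * b)%N) big_addn addKn.
by apply: eq_bigr => D _; rewrite addnC.
Qed.

Section Benford.
Variables (R : realType) (b r : nat).
Hypotheses (b2 : (2 < b)%N) (r2 : (1 < r)%N).
Hypothesis indep : forall h m : nat, (0 < h)%N -> (r ^ h)%N <> (b ^ m)%N.

Let lnb0 : 0 < ln (b%:R : R).
Proof. by rewrite ln_gt0 // ltr1n ltnW. Qed.

Let lnr0 : 0 < ln (r%:R : R).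
Proof. by rewrite ln_gt0 // ltr1n. Qed.

Let b0 : 0 < (b%:R : R). Proof. by rewrite ltr0n; lia. Qed.

Let r0 : 0 < (r%:R : R). Proof. by rewrite ltr0n; lia. Qed.

Let alpha : R := ln r%:R / ln b%:R.

Lemma irrational_log_ratio (h : nat) (z : int) : (0 < h)%N -> h%:R * alpha != z%:~R.
Proof.
move=> h0; apply/eqP => E.
have E1 : h%:R * ln (r%:R : R) = z%:~R * ln b%:R.
  by rewrite -E /alpha; field; exact: lt0r_neq0.
have z0 : 0 < (z%:~R : R).
  by rewrite -(pmulr_lgt0 _ lnb0) -E1 mulr_gt0 // ltr0n.
case: z z0 E1 E => [m|m]; last by rewrite ltr0z.
move=> _ E1 _; apply: (@indep h m h0).
apply/eqP; rewrite -(@eqr_nat R) !natrX; apply/eqP.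
apply: ln_inj; rewrite ?posrE ?exprn_gt0 //.
rewrite !lnXn //.
by rewrite -[LHS]mulr_natl -[RHS]mulr_natl.
Qed.

(** In units of [b ^ -J]: the length of [[log_b w, log_b (w + 1)]] is at most [1 / ln b] for
    [w >= b ^ J], and 1 is the tolerance. *)
Let C : R := 1 + (ln b%:R)^-1.

(** [y0 * r ^ k] begins with the word [w] in base [b] when [k * alpha + log_b y0] lies modulo 1 in
    an interval of logarithms. As [alpha] is irrational, the Weyl sums are geometric sums, bounded
    independently of the phase; hence [N0] serves all [y0] and [w] at once. *)
Lemma leading_digit_visits (J : nat) : exists N0 : nat,
  forall (N : nat) (y0 : R) (w : nat) (P : pred nat), (N0 <= N)%N -> 0 < y0 ->
  (b ^ J <= w)%N ->
  (forall k, (k < N)%N -> P k -> exists e : nat,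
      w%:R * b%:R ^+ e <= y0 * r%:R ^+ k < w.+1%:R * b%:R ^+ e) ->
  (count P (iota 0 N))%:R <= C / b%:R ^+ J * N%:R.
Proof.
have eps0 : 0 < (b%:R ^+ J : R)^-1 by rewrite invr_gt0 exprn_gt0.
have [n [e [n0 e0 H]]] := fejer_count eps0.
(* Bounds the Weyl sums of all frequencies from 1 to [n - 1]; the term [h = 0] is [0^-1 = 0]. *)
pose S : R := \sum_(0 <= h < n) `|sn (h%:R * alpha / 2)|^-1.
exists (Num.truncn (S / e)).+1 => N y0 w P NN y00 bw HP.
have w0 : (0 < w)%N by apply: leq_trans bw; rewrite expn_gt0; lia.
have SN : S <= e * N%:R.
  rewrite mulrC -ler_pdivrMr //; apply: ltW; apply: lt_le_trans (truncnS_gt _) _.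
  by rewrite ler_nat.
pose a : R := ln w%:R / ln b%:R; pose c : R := ln w.+1%:R / ln b%:R.
have wp : 0 < (w%:R : R) by rewrite ltr0n.
have ac : a <= c by rewrite ler_pM2r ?invr_gt0 // ler_ln ?posrE // ler_nat.
have ca : c - a <= (b%:R ^+ J)^-1 / ln b%:R.
  rewrite /c /a -mulrBl ler_pM2r ?invr_gt0 // -ln_div ?posrE //.
  have -> : w.+1%:R / w%:R = 1 + (w%:R)^-1 :> R.
    by rewrite -addn1 natrD mulrDl divff ?gt_eqF // div1r.
  have wi : 0 < (w%:R : R)^-1 by rewrite invr_gt0.
  apply: le_trans (le_ln1Dx _) _; first by lra.
  by rewrite lef_pV2 ?posrE ?exprn_gt0 // -natrX ler_nat.
pose th (k : nat) : R := k%:R * alpha + ln y0 / ln b%:R.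
have := H (iota 0 N) P th a c ac; rewrite size_iota => HH.
apply: le_trans (HH _ _) _.
- move=> h /andP[h0 hn]; rewrite size_iota.
  have hs : `|sn (h%:R * alpha / 2)|^-1 <= e * N%:R.
    apply: le_trans SN; rewrite /S (bigD1_seq h) ?mem_index_iota ?iota_uniq //=.
    by rewrite lerDl; apply: sumr_ge0 => i _; rewrite invr_ge0.
  have s0 : sn (h%:R * alpha / 2) != 0.
    by apply: sn_half_neq0 => z; exact: irrational_log_ratio.
  have thE k : h%:R * th k = k%:R * (h%:R * alpha) + h%:R * (ln y0 / ln b%:R).
    by rewrite /th; ring.
  have -> : iota 0 N = index_iota 0 N by rewrite /index_iota subn0.
  split; apply: le_trans hs.
    by under eq_bigr do rewrite thE; exact: sum_cs_progression_le.
  by under eq_bigr do rewrite thE; exact: sum_sn_progression_le.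
- move=> k; rewrite mem_iota /= add0n => kN Pk.
  have [e' /andP[h1 h2]] := HP k kN Pk; exists e'%:Z.
  have bp : 0 < (b%:R ^+ e' : R) by rewrite exprn_gt0.
  have rp : 0 < (r%:R ^+ k : R) by rewrite exprn_gt0.
  have thE : (th k + 0 - (e'%:Z)%:~R) * ln b%:R = ln (y0 * r%:R ^+ k) - ln (b%:R ^+ e').
    rewrite lnM ?posrE // !lnXn //.
    rewrite /th /alpha -(mulr_natl (ln r%:R)) -(mulr_natl (ln b%:R)) -[(e'%:Z)%:~R]/(e'%:R); field; exact: lt0r_neq0.
  rewrite addr0 in thE.
  apply/andP; split.
    rewrite ler_pdivrMr // thE lerBrDr -lnM ?posrE // ler_ln ?posrE //; exact: mulr_gt0.
  rewrite ler_pdivlMr // thE lerBlDr -lnM ?posrE // ler_ln ?posrE ?ltW //; exact: mulr_gt0.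
rewrite ler_wpM2r // /C mulrDl mul1r (mulrC (ln _)^-1); lra.
Qed.

Variables (rho0 : R) (phi : R -> R).
Hypotheses (rho0_ge0 : 0 <= rho0) (rho0_lt1 : rho0 < 1).

(* [rho] bounds [phi z] by the first base-[b] digit of the fractional part of [z]: only the digits
   [0] and [b - 1] allow [z] to be close to an integer. *)
Definition rho (D : nat) : R := if (D == 0%N) || (D == b.-1) then 1 else rho0.

Hypothesis phi01 : forall z, 0 <= phi z <= 1.
Hypothesis phi_rho : forall (z : R) (w : nat),
  w%:R <= b%:R * z < w.+1%:R -> phi z <= rho (w %% b).

Fixpoint gam (J w : nat) : R :=
  if J is J'.+1 then gam J' (w %/ b) * rho (w %% b) else 1.

Lemma rho_ge0 D : 0 <= rho D.
Proof. by rewrite /rho; case: ifP. Qed.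

Lemma gam_ge0 J w : 0 <= gam J w.
Proof. by elim: J w => //= J IH w; rewrite mulr_ge0 ?rho_ge0. Qed.

Lemma prod_phi_le_gam J (w : nat) (z : R) : w%:R <= z < w.+1%:R ->
  \prod_(1 <= u < J.+1) phi (z / b%:R ^+ u) <= gam J w.
Proof.
elim: J w z => [|J IH] w z /andP[wz zw]; first by rewrite big_geq.
rewrite big_nat_recl //= mulrC.
have H1 : phi (z / b%:R ^+ 1) <= rho (w %% b).
  apply: phi_rho; rewrite expr1 mulrC divfK ?gt_eqF //; exact/andP.
have E : \prod_(1 <= i < J.+1) phi (z / b%:R ^+ i.+1) =
         \prod_(1 <= u < J.+1) phi (z / b%:R / b%:R ^+ u).
  by apply: eq_bigr => i _; rewrite exprS invfM mulrA.
rewrite E; apply: ler_pM => //.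
- by apply: prodr_ge0 => i _; case/andP: (phi01 (z / b%:R / b%:R ^+ i)).
- by case/andP: (phi01 (z / b%:R ^+ 1)).
apply: IH; rewrite ler_pdivlMr // ltr_pdivrMr //.
have bb : (0 < b)%N by nlia.
apply/andP; split; [apply: le_trans wz | apply: lt_le_trans zw _].
  by rewrite -natrM ler_nat leq_divM.
by rewrite -natrM ler_nat; have := ltn_ceil w bb; nlia.
Qed.

Lemma sum_rho : \sum_(0 <= D < b) rho D = 2 + (b%:R - 2) * rho0.
Proof.
have -> : index_iota 0 b = index_iota 0 (b.-2).+2 by congr index_iota; lia.
rewrite big_nat_recl // big_nat_recr //= (eq_big_nat _ _ (F2 := fun _ => rho0)).
  rewrite big_const_nat iter_addr addr0 subn0 /rho eqxx /=.
  rewrite (_ : b.-2.+1 = b.-1); last by lia.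
  rewrite eqxx -(mulr_natl rho0) (_ : b.-2 = (b - 2)%N); last by lia.
  by rewrite natrB; [ring | lia].
by move=> i ib; rewrite /rho ifF //; apply/negbTE; lia.
Qed.

(** The leading digit is free, and each of the other [J] digits contributes the factor of [sum_rho].
    That factor is smaller than [b], and this gain over the number of words is the source of the
    decay. *)
Lemma sum_gam J : \sum_(b ^ J <= w < b ^ J.+1) gam J w =
  (b%:R - 1) * (2 + (b%:R - 2) * rho0) ^+ J.
Proof.
elim: J => [|J IH].
  rewrite expn0 expn1 big_const_nat iter_addr addr0 expr0 mulr1.
  by rewrite natrB //; lia.
rewrite (expnSr _ J) (expnSr _ J.+1) big_nat_block; last by rewrite leq_exp2l //; lia.
under eq_bigr => v _.
  under eq_big_nat => D Db /=.
    rewrite divnMDl; last by lia.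
    rewrite modnMDl divn_small; last by lia.
    rewrite modn_small; last by lia.
    rewrite addn0.
    over.
  rewrite -mulr_sumr.
  over.
by rewrite -mulr_suml IH sum_rho exprSr mulrA.
Qed.

(** Only the [J] factors at the places just above [e] are used: they see the digits of [y] that
    follow its leading digit. The bounds on [y] put these places inside the range of the product. *)
Lemma leading_word (n N J : nat) (y : R) :
  b%:R ^+ (n + J) <= y < b%:R ^+ (n + N) ->
  exists e w : nat, [/\ (b ^ J <= w < b ^ J.+1)%N,
    w%:R * b%:R ^+ e <= y < w.+1%:R * b%:R ^+ e &
    \prod_(n.+1 <= j < (n + N).+1) phi (y / b%:R ^+ j) <= gam J w].
Proof.
move=> /andP[y1 y2].
have y0 : 0 < y by apply: lt_le_trans y1; rewrite exprn_gt0.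
have ty : (b ^ (n + J) <= Num.truncn y)%N by rewrite truncn_ge_nat ?natrX // ltW.
have tb : (0 < Num.truncn y)%N by apply: leq_trans ty; rewrite expn_gt0; nlia.
have b1 : (1 < b)%N by nlia.
have /andP[m1 m2] := trunc_log_bounds b1 tb; set m := trunc_log b _ in m1 m2.
have Jm : (n + J <= m)%N by rewrite -ltnS -(ltn_exp2l _ _ b1); exact: leq_ltn_trans m2.
pose e := (m - J)%N; have me : m = (e + J)%N by rewrite subnK // (leq_trans (leq_addl n J)).
have be : 0 < (b%:R ^+ e : R) by rewrite exprn_gt0.
pose w := Num.truncn (y / b%:R ^+ e).
have /andP[w1 w2] : w%:R <= y / b%:R ^+ e < w.+1%:R.
  by apply: truncn_itv; rewrite divr_ge0 // ltW.
have ym : b%:R ^+ m <= y.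
  rewrite -natrX; apply: (@le_trans _ _ (Num.truncn y)%:R); rewrite ?ler_nat //.
  by rewrite truncn_le ltW.
have ye0 : 0 <= y / b%:R ^+ e by rewrite divr_ge0 // ltW.
exists e, w; split.
- apply/andP; split.
    rewrite /w truncn_ge_nat // natrX ler_pdivlMr //.
    by rewrite -exprD addnC -me.
  rewrite /w truncn_lt_nat // natrX ltr_pdivrMr // -exprD.
  rewrite (_ : (J.+1 + e)%N = m.+1); last by rewrite me addSn addnC.
  apply: lt_le_trans (truncnS_gt _) _; by rewrite -natrX ler_nat.
- by rewrite -ler_pdivlMr // -ltr_pdivrMr // w1 w2.
have en : (n <= e)%N by nlia.
have eN : (e + J < n + N)%N.
  rewrite -me -(ltn_exp2l _ _ b1) -(ltr_nat R) !natrX.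
  exact: le_lt_trans ym y2.
rewrite (big_cat_nat (n := e.+1)) //=; last by nlia.
rewrite [X in _ * X](big_cat_nat (n := (e + J).+1)) //=; try nlia.
have p01 i j : 0 <= \prod_(i <= k < j) phi (y / b%:R ^+ k) <= 1.
  apply/andP; split; first by apply: prodr_ge0 => k _; case/andP: (phi01 (y / b%:R ^+ k)).
  by apply: prodr_ile1 => k _; exact: phi01.
have /andP[A0 A1] := p01 n.+1 e.+1.
have /andP[B0 B1] := p01 e.+1 (e + J).+1.
have /andP[C0 C1] := p01 (e + J).+1 (n + N).+1.
apply: (@le_trans _ _ (\prod_(e.+1 <= k < (e + J).+1) phi (y / b%:R ^+ k))).
  rewrite -[X in _ <= X]mul1r; apply: ler_pM => //; first exact: mulr_ge0.
  by rewrite -[X in _ <= X]mulr1; apply: ler_wpM2l.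
rewrite -(add1n e) big_addn -addnS addKn.
under eq_bigr do rewrite addnC exprD invfM mulrA.
by apply: prod_phi_le_gam; rewrite w1 w2.
Qed.

(** Grouped by the leading words [w] of [y0 * r ^ k], the sum is at most [C / b ^ J * m] times the
    sum of [gam J w], that is [C * (b - 1) * kap ^ J * m] with [kap < 1]. The term [N0] pays for the
    [m] too small for equidistribution. *)
Lemma sum_prod_phi (eps : R) : 0 < eps -> exists J N0 : nat,
  forall (m n N : nat) (y0 : R), 0 < y0 ->
  (forall k, (k < m)%N -> b%:R ^+ (n + J) <= y0 * r%:R ^+ k < b%:R ^+ (n + N)) ->
  \sum_(0 <= k < m) \prod_(n.+1 <= j < (n + N).+1) phi (y0 * r%:R ^+ k / b%:R ^+ j)
    <= eps * m%:R + N0%:R.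
Proof.
move=> eps0; pose kap := (2 + (b%:R - 2) * rho0) / b%:R.
have b3 : 2 < (b%:R : R) by rewrite (ltr_nat R 2).
have k01 : 0 <= kap < 1.
  have q0 : 0 <= (b%:R - 2) * rho0 by rewrite mulr_ge0 //; lra.
  have q1 : 0 < (b%:R - 2) * (1 - rho0) by rewrite mulr_gt0 ?subr_gt0.
  rewrite divr_ge0 //=; last by lra.
  by rewrite ltr_pdivrMr // mul1r; lra.
have C0 : 0 < C * (b%:R - 1).
  by rewrite mulr_gt0 //; [rewrite addr_gt0 // invr_gt0 | lra].
have [J HJ] := exists_expr_le k01 (divr_gt0 eps0 C0).
have [N0 HN] := leading_digit_visits J; exists J, N0 => m n N y0 y00 Hk.
have [mN|Nm] := ltnP m N0.
  apply: (@le_trans _ _ (\sum_(0 <= k < m) 1)).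
    apply: ler_sum => k _; apply: prodr_ile1 => j _; exact: phi01.
  rewrite big_const_nat iter_addr addr0 subn0.
  rewrite -[X in X <= _]add0r; apply: lerD; last by rewrite ler_nat ltnW.
  by rewrite mulr_ge0 // ltW.
have /choice [W HW] : forall k, exists w, (k < m)%N -> exists e : nat,
   [/\ (b ^ J <= w < b ^ J.+1)%N,
    w%:R * b%:R ^+ e <= y0 * r%:R ^+ k < w.+1%:R * b%:R ^+ e &
    \prod_(n.+1 <= j < (n + N).+1) phi (y0 * r%:R ^+ k / b%:R ^+ j) <= gam J w].
  move=> k; have [km|_] := ltnP k m; last by exists 0%N.
  by have [e [w H]] := leading_word (Hk k km); exists w => _; exists e.
apply: (@le_trans _ _ (eps * m%:R)); last by rewrite lerDl.
apply: (@le_trans _ _ (\sum_(0 <= k < m) gam J (W k))).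
  rewrite big_nat_cond [X in _ <= X]big_nat_cond; apply: ler_sum => k /andP[/andP[_ km] _].
  by have [e []] := HW k km.
have -> : \sum_(0 <= k < m) gam J (W k) =
   \sum_(b ^ J <= w < b ^ J.+1) gam J w * (count (fun k => W k == w) (iota 0 m))%:R.
  transitivity (\sum_(0 <= k < m) \sum_(b ^ J <= w < b ^ J.+1) gam J w * (W k == w)%:R).
    rewrite big_nat_cond [RHS]big_nat_cond; apply: eq_bigr => k /andP[/andP[_ km] _].
    have [e [wb _ _]] := HW k km.
    rewrite (bigD1_seq (W k)) ?mem_index_iota ?iota_uniq //= eqxx mulr1.
    rewrite big1 ?addr0 // => w; rewrite eq_sym => /negbTE ->; by rewrite mulr0.
  rewrite exchange_big /=; apply: eq_bigr => w _.
  rewrite -mulr_sumr; congr (_ * _).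
  rewrite -sum1_count natr_sum [RHS]big_mkcond /= /index_iota subn0.
  by apply: eq_bigr => k _; case: (W k == w).
apply: (@le_trans _ _ (\sum_(b ^ J <= w < b ^ J.+1) gam J w * (C / b%:R ^+ J * m%:R))).
  rewrite big_nat_cond [X in _ <= X]big_nat_cond; apply: ler_sum => w /andP[/andP[bw _] _].
  rewrite ler_wpM2l ?gam_ge0 //; apply: (HN _ y0 w) => // k km /eqP Wk.
  by have [e [_ + _]] := HW k km; rewrite Wk; exists e.
rewrite -mulr_suml sum_gam.
have -> : (b%:R - 1) * (2 + (b%:R - 2) * rho0) ^+ J * (C / b%:R ^+ J * m%:R) =
          C * (b%:R - 1) * kap ^+ J * m%:R.
  by rewrite /kap expr_div_n; ring.
by rewrite ler_wpM2r // mulrC -ler_pdivlMr.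
Qed.

End Benford.

(** * Random words *)

Lemma sum_square_by_diff (R : realType) (g : nat -> nat -> R) (m : nat) :
  (forall k l, g k l = g l k) ->
  \sum_(0 <= k < m) \sum_(0 <= l < m) g k l =
  \sum_(0 <= k < m) g k k +
  2 * \sum_(1 <= d < m) \sum_(0 <= k < m - d) g k (k + d)%N.
Proof.
move=> sym; elim: m => [|m IH]; first by rewrite !big_geq // mulr0 addr0.
have -> : \sum_(0 <= k < m.+1) \sum_(0 <= l < m.+1) g k l =
   \sum_(0 <= k < m) \sum_(0 <= l < m) g k l + g m m + 2 * \sum_(0 <= k < m) g k m.
  rewrite big_nat_recr //= [X in _ + X = _]big_nat_recr //=.
  under eq_bigr do rewrite big_nat_recr //=.
  rewrite big_split /=; under [X in _ + (X + _) = _]eq_bigr do rewrite sym; ring.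
rewrite IH [X in _ = X + _]big_nat_recr //=.
suff -> : \sum_(1 <= d < m.+1) \sum_(0 <= k < m.+1 - d) g k (k + d)%N =
   \sum_(1 <= d < m) \sum_(0 <= k < m - d) g k (k + d)%N + \sum_(0 <= k < m) g k m.
  by ring.
case: m {IH} => [|m]; first by rewrite !big_geq // addr0.
have -> : \sum_(1 <= d < m.+1) \sum_(0 <= k < m.+1 - d) g k (k + d)%N =
          \sum_(1 <= d < m.+2) \sum_(0 <= k < m.+1 - d) g k (k + d)%N.
  by rewrite [RHS]big_nat_recr //= subnn [X in _ = _ + X]big_geq // addr0.
rewrite [X in _ = _ + X]big_nat_rev /= add0n.
rewrite (_ : \sum_(0 <= i < m.+1) g (m.+1 - i.+1)%N m.+1 =
             \sum_(1 <= d < m.+2) g (m.+1 - d)%N m.+1); last by rewrite big_add1.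
rewrite -big_split /= big_nat_cond [RHS]big_nat_cond.
apply: eq_bigr => d /andP[/andP[d1 d2] _].
by rewrite subSn // big_nat_recr //= subnK.
Qed.

Section Words.
Variables (R : realType) (b : nat) (p : nat -> R).
Hypothesis b2 : (2 < b)%N.
Hypothesis p_gt0 : forall D, (D < b)%N -> 0 < p D.
Hypothesis sum_p : \sum_(0 <= D < b) p D = 1.

Let b_gt0 : (0 < b)%N. Proof. by lia. Qed.

Let b0 : 0 < (b%:R : R). Proof. by rewrite ltr0n. Qed.

(** A word of length [N] is a number [w < b ^ N] with its leading zeros kept; this is its
    probability for independent digits of law [p]. *)
Fixpoint pw (N w : nat) : R :=
  if N is N'.+1 then pw N' (w %/ b) * p (w %% b) else 1.

Lemma pw_ge0 N w : 0 <= pw N w.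
Proof. by elim: N w => //= N IH w; rewrite mulr_ge0 // ltW // p_gt0 // ltn_pmod. Qed.

Lemma pw_le N w (pm : R) : (forall D, (D < b)%N -> p D <= pm) -> pw N w <= pm ^+ N.
Proof.
move=> H; elim: N w => //= N IH w; rewrite exprSr; apply: ler_pM => //.
- exact: pw_ge0.
- by rewrite ltW // p_gt0 // ltn_pmod.
- by rewrite H // ltn_pmod.
Qed.

Lemma sum_pwS N (F : nat -> R) :
  \sum_(0 <= w < b ^ N.+1) pw N.+1 w * F w =
  \sum_(0 <= v < b ^ N) pw N v * \sum_(0 <= D < b) p D * F (v * b + D)%N.
Proof.
rewrite expnSr -{1}(mul0n b) big_nat_block //.
apply: eq_bigr => v _; rewrite mulr_sumr big_nat_cond [RHS]big_nat_cond.
apply: eq_bigr => D /andP[/andP[_ Db] _] /=.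
by rewrite divnMDl // modnMDl divn_small // modn_small // addn0 mulrA.
Qed.

Lemma sum_pw N : \sum_(0 <= w < b ^ N) pw N w = 1.
Proof.
elim: N => [|N IH]; first by rewrite expn0 big_nat1.
have := @sum_pwS N (fun _ => 1).
under eq_bigr do rewrite mulr1; move=> ->.
under eq_bigr => v _.
  under eq_bigr do rewrite mulr1.
  rewrite sum_p mulr1.
  over.
exact: IH.
Qed.

Lemma markov_words N (Y : nat -> R) : (forall w, 0 <= Y w) ->
  \sum_(0 <= w < b ^ N) pw N w * Y w <= 2^-1 ->
  2^-1 <= \sum_(0 <= w < b ^ N | Y w < 1) pw N w.
Proof.
move=> Y0 HY; have := sum_pw N; rewrite (bigID (fun w => Y w < 1)) /= => E.
have : \sum_(0 <= w < b ^ N | ~~ (Y w < 1)) pw N w <= 2^-1; last by lra.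
apply: le_trans HY; rewrite [X in _ <= X](bigID (fun w => Y w < 1)) /=.
rewrite -[X in X <= _]add0r; apply: lerD.
  by apply: sumr_ge0 => w _; rewrite mulr_ge0 // pw_ge0.
apply: ler_sum => w; rewrite -leNgt => Y1.
by rewrite -[X in X <= _]mulr1 ler_wpM2l // pw_ge0.
Qed.

Fixpoint cntw (N D w : nat) : nat :=
  if N is N'.+1 then (cntw N' D (w %/ b) + (w %% b == D))%N else 0%N.

Lemma sum_p_ind D : (D < b)%N ->
  \sum_(0 <= E < b) p E * ((E == D)%:R - p D) = 0.
Proof.
move=> Db; under eq_bigr do rewrite mulrBr.
rewrite sumrB -mulr_suml sum_p mul1r (bigD1_seq D) ?mem_index_iota ?iota_uniq //=.
rewrite eqxx mulr1 big1 ?addr0 ?subrr // => E /negbTE ->; by rewrite mulr0.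
Qed.

(** Given the prefix, the centred indicator of the new digit has mean 0, so the cross term vanishes
    and each digit adds at most 1 to the variance. *)
Lemma lln_words N D : (D < b)%N ->
  \sum_(0 <= w < b ^ N) pw N w * ((cntw N D w)%:R - N%:R * p D) = 0 /\
  \sum_(0 <= w < b ^ N) pw N w * ((cntw N D w)%:R - N%:R * p D) ^+ 2 <= N%:R.
Proof.
move=> Db; elim: N => [|N [IH1 IH2]].
  by rewrite expn0 !big_nat1 /= mul0r subrr mulr0 expr0n mulr0.
have Z v E : (E < b)%N -> (cntw N.+1 D (v * b + E))%:R - N.+1%:R * p D =
    ((cntw N D v)%:R - N%:R * p D) + ((E == D)%:R - p D).
  move=> Eb /=; rewrite divnMDl // modnMDl divn_small // modn_small // addn0.
  by rewrite natrD -(addn1 N) natrD; ring.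
have V : \sum_(0 <= E < b) p E * ((E == D)%:R - p D) ^+ 2 <= 1.
  rewrite -[X in _ <= X]sum_p big_nat_cond [X in _ <= X]big_nat_cond.
  apply: ler_sum => E /andP[/andP[_ Eb] _].
  have pE := ltW (p_gt0 Eb); rewrite -[X in _ <= X]mulr1; apply: ler_wpM2l => //.
  have pD : 0 < p D <= 1.
    rewrite p_gt0 //= -[X in _ <= X]sum_p (bigD1_seq D) ?mem_index_iota ?iota_uniq //= lerDl.
    rewrite big_seq_cond; apply: sumr_ge0 => i; rewrite mem_index_iota => /andP[/andP[_ ib] _].
    exact/ltW/p_gt0.
  case: (E == D) => /=; nra.
split.
  rewrite sum_pwS -[RHS]IH1; apply: eq_bigr => v _; congr (_ * _).
  rewrite (eq_big_nat _ _ (F2 := fun E => p E * ((cntw N D v)%:R - N%:R * p D) + p E * ((E == D)%:R - p D))).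
    by rewrite big_split /= sum_p_ind // -mulr_suml sum_p mul1r addr0.
  by move=> E /andP[_ Eb]; rewrite Z // mulrDr.
rewrite sum_pwS [X in _ <= X](_ : N.+1%:R = N%:R + 1); last by rewrite -addn1 natrD.
apply: (@le_trans _ _ (\sum_(0 <= v < b ^ N) (pw N v * ((cntw N D v)%:R - N%:R * p D) ^+ 2 + pw N v))); last first.
  by rewrite big_split /= sum_pw lerD2r.
apply: ler_sum => v _; rewrite -[X in _ <= _ + X]mulr1 -mulrDr ler_wpM2l ?pw_ge0 //.
set x := _ - _.
rewrite (eq_big_nat _ _ (F2 := fun E => p E * x ^+ 2 + 2 * x * (p E * ((E == D)%:R - p D)) +
   p E * ((E == D)%:R - p D) ^+ 2)); last first.
  by move=> E /andP[_ Eb]; rewrite Z // -/x; ring.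
rewrite !big_split /= -mulr_sumr sum_p_ind // mulr0 addr0 -mulr_suml sum_p mul1r.
by rewrite lerD2l.
Qed.

(* The modulus of the characteristic function of [p] at [2 pi z]. *)
Definition phi (z : R) : R :=
  Num.sqrt ((\sum_(0 <= D < b) p D * cs (D%:R * z)) ^+ 2 +
            (\sum_(0 <= D < b) p D * sn (D%:R * z)) ^+ 2).

Lemma phi_sqr z : phi z ^+ 2 =
  \sum_(0 <= D < b) \sum_(0 <= E < b) p D * p E * cs ((D%:R - E%:R) * z).
Proof.
rewrite /phi sqr_sqrtr ?addr_ge0 ?sqr_ge0 // !expr2 !big_distrlr /= -big_split /=.
apply: eq_bigr => D _; rewrite -big_split /=; apply: eq_bigr => E _.
by rewrite mulrBl csB; ring.
Qed.

(** [1 - phi z ^ 2] is a sum of nonnegative terms [p D * p E * (1 - cs ((D - E) * z))], of which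
    only the pairs [(0, 1)] and [(1, 0)] are kept. *)
Lemma phi_sqr_le z : phi z ^+ 2 <= 1 - 2 * p 0 * p 1 * (1 - cs z).
Proof.
have E1 : 1 = \sum_(0 <= D < b) \sum_(0 <= E < b) p D * p E.
  by under eq_bigr do rewrite -mulr_sumr sum_p mulr1; rewrite sum_p.
rewrite lerBrDl -lerBrDr phi_sqr [X in _ <= X - _]E1 -sumrB.
under eq_bigr do rewrite -sumrB.
pose T D E := p D * p E - p D * p E * cs ((D%:R - E%:R) * z).
have T0 D E : (D < b)%N -> (E < b)%N -> 0 <= T D E.
  move=> Db Eb; rewrite /T -{1}(mulr1 (p D * p E)) -mulrBr mulr_ge0 //.
    by rewrite mulr_ge0 // ltW // p_gt0.
  by have := cs_max ((D%:R - E%:R) * z); rewrite ler_norml => /andP[_]; lra.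
have row D : (D < b)%N -> 0 <= \sum_(0 <= E < b) T D E.
  move=> Db; rewrite big_nat_cond; apply: sumr_ge0 => E /andP[/andP[_ Eb] _]; exact: T0.
have b1' : (1 < b)%N by lia.
have r0 : T 0%N 1%N <= \sum_(0 <= E < b) T 0%N E.
  rewrite (bigD1_seq 1%N) ?mem_index_iota ?iota_uniq //= lerDl.
  rewrite big_seq_cond; apply: sumr_ge0 => E; rewrite mem_index_iota => /andP[/andP[_ Eb] _].
  exact: T0.
have r1 : T 1%N 0%N <= \sum_(0 <= E < b) T 1%N E.
  rewrite (bigD1_seq 0%N) ?mem_index_iota ?iota_uniq //= lerDl.
  rewrite big_seq_cond; apply: sumr_ge0 => E; rewrite mem_index_iota => /andP[/andP[_ Eb] _].
  exact: T0.
have -> : 2 * p 0 * p 1 * (1 - cs z) = T 0%N 1%N + T 1%N 0%N.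
  by rewrite /T sub0r mulNr subr0 !mul1r csN; ring.
apply: le_trans (lerD r0 r1) _.
rewrite [X in _ <= X](bigD1_seq 0%N) ?mem_index_iota ?iota_uniq //= lerD2l.
rewrite [X in _ <= X]big_mkcond /= [X in _ <= X](bigD1_seq 1%N) ?mem_index_iota ?iota_uniq //= lerDl.
rewrite big_seq_cond; apply: sumr_ge0 => D; rewrite mem_index_iota => /andP[/andP[_ Db] _].
by case: ifP => // _; exact: row.
Qed.

Lemma phi01 z : 0 <= phi z <= 1.
Proof.
rewrite sqrtr_ge0 /= -(@ler_pXn2r _ 2) ?nnegrE ?sqrtr_ge0 // expr1n.
apply: le_trans (phi_sqr_le z) _; rewrite gerBl mulr_ge0 //.
  by rewrite !mulr_ge0 // ltW // p_gt0 //; lia.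
by have := cs_max z; rewrite ler_norml => /andP[_]; lra.
Qed.

(** The bound of [phi_sqr_le] at distance [1 / b] from the integers: a first digit other than [0]
    and [b - 1] keeps [z] at least that far away. *)
Definition rho1 : R := Num.sqrt (1 - 2 * p 0 * p 1 * (1 - cs (b%:R^-1))).

Let binv : 0 < (b%:R : R)^-1 <= 2^-1.
Proof. by rewrite invr_gt0 b0 /= lef_pV2 ?posrE // (ler_nat R 2) ltnW. Qed.

Lemma rho1_lt1 : rho1 < 1.
Proof.
rewrite /rho1 -[X in _ < X]sqrtr1 ltr_sqrt // gtrBl mulr_gt0 //.
  by rewrite !mulr_gt0 // p_gt0 //; lia.
by rewrite subr_gt0; exact: cs_lt1.
Qed.

Lemma phi_le_rho (z : R) (w : nat) :
  w%:R <= b%:R * z < w.+1%:R -> phi z <= rho b rho1 (w %% b).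
Proof.
move=> /andP[wz zw]; rewrite /rho; case: ifP => [_|]; first by case/andP: (phi01 z).
move=> /negbT; rewrite negb_or => /andP[D0 D1].
have ph0 : 0 <= phi z by case/andP: (phi01 z).
rewrite /rho1 -(ger0_norm ph0) -sqrtr_sqr.
rewrite ler_wsqrtr //; apply: le_trans (phi_sqr_le z) _.
rewrite lerD2l lerN2 ler_wpM2l //; first by rewrite !mulr_ge0 // ltW // p_gt0 //; lia.
rewrite lerD2l lerN2 -(csBint z (w %/ b)%:Z).
have /andP[i0 i1] := binv.
have Dlt : (w %% b < b)%N by rewrite ltn_pmod.
have wE : (w%:R : R) = (w %/ b)%:R * b%:R + (w %% b)%:R.
  by rewrite -natrM -natrD -divn_eq.
have e1 : b%:R * (b%:R)^-1 = 1 :> R by rewrite mulfV // gt_eqF.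
have D0' : 1 <= (w %% b)%:R :> R by rewrite ler1n lt0n.
have D1' : (w %% b)%:R + 2 <= b%:R :> R by rewrite -natrD ler_nat; clear -Dlt D1 b2; lia.
rewrite -[((w %/ b)%:Z)%:~R]/((w %/ b)%:R).
apply: cs_le_far; first exact: ltW.
  by rewrite -(ler_pM2l b0); lra.
by rewrite -(ler_pM2l b0); lra.
Qed.

Lemma char_fun_sqr N (th : R) :
  (\sum_(0 <= w < b ^ N) pw N w * cs (w%:R * th)) ^+ 2 +
  (\sum_(0 <= w < b ^ N) pw N w * sn (w%:R * th)) ^+ 2 =
  \prod_(0 <= i < N) phi (th * b%:R ^+ i) ^+ 2.
Proof.
elim: N th => [|N IH] th.
  by rewrite expn0 !big_nat1 big_geq // mul0r cs0 sn0 /= mulr1 mulr0 expr1n expr0n addr0.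
rewrite !sum_pwS big_nat_recl //= expr0 mulr1.
have -> : \prod_(0 <= i < N) phi (th * b%:R ^+ i.+1) ^+ 2 =
          \prod_(0 <= i < N) phi (th * b%:R * b%:R ^+ i) ^+ 2.
  by apply: eq_bigr => i _; rewrite (exprS b%:R) mulrA.
rewrite -IH /phi sqr_sqrtr ?addr_ge0 ?sqr_ge0 //.
set c := \sum_(0 <= D < b) _ * cs _; set s := \sum_(0 <= D < b) _ * sn _.
have ec v : \sum_(0 <= D < b) p D * cs ((v * b + D)%:R * th) =
   cs (v%:R * (th * b%:R)) * c - sn (v%:R * (th * b%:R)) * s.
  rewrite /c /s !mulr_sumr -sumrB; apply: eq_bigr => D _.
  have -> : (v * b + D)%:R * th = v%:R * (th * b%:R) + D%:R * th.
    by rewrite natrD natrM; ring.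
  by rewrite csD; ring.
have es v : \sum_(0 <= D < b) p D * sn ((v * b + D)%:R * th) =
   sn (v%:R * (th * b%:R)) * c + cs (v%:R * (th * b%:R)) * s.
  rewrite /c /s !mulr_sumr -big_split /=; apply: eq_bigr => D _.
  have -> : (v * b + D)%:R * th = v%:R * (th * b%:R) + D%:R * th.
    by rewrite natrD natrM; ring.
  by rewrite snD; ring.
under eq_bigr do rewrite ec mulrBr !(mulrA (pw _ _)).
under [X in _ + X ^+ 2 = _]eq_bigr do rewrite es mulrDr !(mulrA (pw _ _)).
rewrite sumrB big_split /= -!mulr_suml; ring.
Qed.

Lemma char_fun_le N (th t : R) :
  `|\sum_(0 <= w < b ^ N) pw N w * cs (w%:R * th + t)| <=
  \prod_(0 <= i < N) phi (th * b%:R ^+ i).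
Proof.
have P0 : 0 <= \prod_(0 <= i < N) phi (th * b%:R ^+ i).
  by apply: prodr_ge0 => i _; case/andP: (phi01 (th * b%:R ^+ i)).
rewrite -(@ler_pXn2r _ 2) ?nnegrE // real_normK ?num_real // -prodrXl -char_fun_sqr.
under eq_bigr do rewrite csD mulrBr !mulrA.
rewrite sumrB -!mulr_suml.
set A := \sum_(_ <= _ < _) _; set B := \sum_(_ <= _ < _) _.
have := cs2Dsn2 t; have := sqr_ge0 (A * sn t + B * cs t); nra.
Qed.

Lemma char_fun_at n N (v : nat) (y : R) :
  `|\sum_(0 <= w < b ^ N) pw N w * cs (y * ((v * b ^ N + w)%:R / b%:R ^+ (n + N)))| <=
  \prod_(n.+1 <= j < (n + N).+1) phi (y / b%:R ^+ j).
Proof.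
pose th := y / b%:R ^+ (n + N).
have -> : \prod_(n.+1 <= j < (n + N).+1) phi (y / b%:R ^+ j) =
          \prod_(0 <= i < N) phi (th * b%:R ^+ i).
  rewrite -{1}(add0n n.+1) big_addn subSS addKn.
  rewrite big_nat_rev /= add0n big_nat_cond [RHS]big_nat_cond.
  apply: eq_bigr => i /andP[/andP[_ iN] _]; congr phi.
  rewrite /th (_ : (n + N = 0 + N - i.+1 + n.+1 + i)%N); last by lia.
  by rewrite [in RHS]exprD; field; rewrite !expf_neq0 // gt_eqF.
have e w : y * ((v * b ^ N + w)%:R / b%:R ^+ (n + N)) = w%:R * th + (v * b ^ N)%:R * th.
  by rewrite natrD /th; ring.
under [X in `|X|]eq_bigr do rewrite e.
exact: char_fun_le.
Qed.

Section SecondMoment.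
Variable r : nat.
Hypotheses (r2 : (1 < r)%N)
  (indep : forall h m : nat, (0 < h)%N -> (r ^ h)%N <> (b ^ m)%N).

(** When the square is expanded, the mean of the term [(k, l)] is at most a product of [phi] at the
    frequency [h * r ^ A * (r ^ k - r ^ l)]. For a fixed difference of [k] and [l] these frequencies
    form a geometric progression of ratio [r], and [sum_prod_phi] applies. *)
Lemma second_moment (eps : R) : 0 < eps -> exists J T0 : nat,
  forall (n N v A m h : nat), (0 < h)%N ->
  (b ^ (n + J) <= r ^ A)%N -> (h * r ^ (A + m) <= b ^ (n + N))%N ->
  \sum_(0 <= w < b ^ N) pw N w *
    (let X := (v * b ^ N + w)%:R / b%:R ^+ (n + N) in
     (\sum_(k <- iota A m) cs (h%:R * (r%:R ^+ k * X))) ^+ 2 +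
     (\sum_(k <- iota A m) sn (h%:R * (r%:R ^+ k * X))) ^+ 2)
  <= eps * m%:R ^+ 2 + T0%:R * m%:R.
Proof.
move=> e0; have e20 : 0 < eps / 2 by rewrite divr_gt0.
have [J [N0 H]] := @sum_prod_phi R b r b2 r2 indep rho1 phi (sqrtr_ge0 _) rho1_lt1
   phi01 phi_le_rho (eps / 2) e20.
(* Each difference costs [N0] for either order of [k] and [l]; the diagonal costs [m]. *)
exists J, (2 * N0 + 1)%N => n N v A m h h0 HA HB /=.
pose X w : R := (v * b ^ N + w)%:R / b%:R ^+ (n + N).
pose g (k l : nat) : R := if k == l then 1 else
  \prod_(n.+1 <= j < (n + N).+1)
    phi (h%:R * (r%:R ^+ (maxn k l) - r%:R ^+ (minn k l)) * r%:R ^+ A / b%:R ^+ j).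
have gsym k l : g k l = g l k by rewrite /g eq_sym maxnC minnC.
have p01 y : 0 <= \prod_(n.+1 <= j < (n + N).+1) phi (y / b%:R ^+ j) <= 1.
  apply/andP; split; first by apply: prodr_ge0 => k _; case/andP: (phi01 (y / b%:R ^+ k)).
  by apply: prodr_ile1 => k _; exact: phi01.
have im (F : nat -> R) : \sum_(k <- iota A m) F k = \sum_(0 <= k < m) F (A + k)%N.
  by rewrite -{1}(addn0 A) iotaDl big_map /index_iota subn0.
apply: (@le_trans _ _ (\sum_(0 <= k < m) \sum_(0 <= l < m) g k l)).
  under eq_bigr do rewrite sqmod_sum -/(X _) mulr_sumr.
  rewrite exchange_big /= im; apply: ler_sum => k _.
  under eq_bigr do rewrite mulr_sumr.
  rewrite exchange_big /= im; apply: ler_sum => l _.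
  rewrite /g; case: eqVneq => [->|kl].
    by under eq_bigr do rewrite subrr cs0 mulr1; rewrite sum_pw.
  apply: le_trans (ler_norm _) _.
  under eq_bigr => w _.
    rewrite (_ : h%:R * (r%:R ^+ (A + k) * X w) - h%:R * (r%:R ^+ (A + l) * X w) =
       (h%:R * (r%:R ^+ k - r%:R ^+ l) * r%:R ^+ A) * X w); last by rewrite !exprD; ring.
    over.
  have [kl'|kl'] := leqP l k.
    exact: char_fun_at.
  under [X in `|X|]eq_bigr do rewrite -csN -mulNr -mulNr -mulrN opprB.
  exact: char_fun_at.
rewrite sum_square_by_diff //.
have -> : \sum_(0 <= k < m) g k k = m%:R.
  under eq_bigr do rewrite /g eqxx.
  by rewrite big_const_nat iter_addr addr0 subn0.
have step d : (1 <= d < m)%N -> \sum_(0 <= k < m - d) g k (k + d)%N <= eps / 2 * m%:R + N0%:R.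
  move=> /andP[d1 dm].
  have rd : (1 < r ^ d)%N by rewrite -(exp1n d) ltn_exp2r.
  have rd1 : 1 <= (r%:R ^+ d - 1 : R) by rewrite lerBrDr -natrX -(natrD R 1 1) ler_nat.
  pose y0 : R := h%:R * (r%:R ^+ d - 1) * r%:R ^+ A.
  have hp : 1 <= (h%:R : R) by rewrite ler1n.
  have r0 : 1 <= (r%:R : R) by rewrite ler1n ltnW.
  have rA : 0 < (r%:R ^+ A : R) by rewrite exprn_gt0 // (lt_le_trans ltr01).
  have hr : 1 <= h%:R * (r%:R ^+ d - 1) :> R by nra.
  have y00 : 0 < y0 by rewrite mulr_gt0 // (lt_le_trans ltr01).
  apply: (@le_trans _ _ (eps / 2 * (m - d)%:R + N0%:R)); last first.
    rewrite lerD2r; apply: ler_wpM2l; first exact: ltW.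
    by rewrite ler_nat leq_subr.
  apply: le_trans (H (m - d)%N n N y0 y00 _); last first.
    move=> k kmd; apply/andP; split.
      apply: (@le_trans _ _ (r%:R ^+ A)); first by rewrite -!natrX ler_nat.
      apply: (@le_trans _ _ y0); first by rewrite /y0 ler_peMl // ltW.
      by rewrite ler_peMr ?exprn_ege1 // ltW.
    apply: (@lt_le_trans _ _ (h%:R * r%:R ^+ (A + m))); last first.
      by rewrite -!natrX -natrM ler_nat.
    have rk : 0 < (r%:R ^+ k : R) by rewrite exprn_gt0 // (lt_le_trans ltr01).
    have -> : y0 * r%:R ^+ k = h%:R * (r%:R ^+ A * (r%:R ^+ (d + k) - r%:R ^+ k)).
      by rewrite /y0 exprD; ring.
    rewrite ltr_pM2l ?(lt_le_trans ltr01) // (exprD _ A m) ltr_pM2l //.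
    apply: (@lt_le_trans _ _ (r%:R ^+ (d + k))); first by rewrite gtrBl.
    by apply: ler_weXn2l => //; clear -kmd dm; lia.
  apply: ler_sum => k _; rewrite /g ifF; last by clear -d1; lia.
  rewrite (maxn_idPr (leq_addr _ _)) (minn_idPl (leq_addr _ _)).
  apply: le_of_eq; apply: eq_bigr => j _; congr (phi (_ / _)).
  by rewrite /y0 exprD; ring.
have S : \sum_(1 <= d < m) \sum_(0 <= k < m - d) g k (k + d)%N <=
         m%:R * (eps / 2 * m%:R + N0%:R).
  apply: (@le_trans _ _ (\sum_(1 <= d < m) (eps / 2 * m%:R + N0%:R))).
    rewrite big_nat_cond [X in _ <= X]big_nat_cond; apply: ler_sum => d /andP[dm _]; exact: step.
  rewrite big_const_nat iter_addr addr0 -[X in X <= _]mulr_natl ler_wpM2r //.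
    by rewrite addr_ge0 // mulr_ge0 // ltW.
  by rewrite ler_nat leq_subr.
rewrite natrD natrM; have : 0 <= (m%:R : R) by []; lra.
Qed.

End SecondMoment.
End Words.

(** * Biased laws of digit blocks *)

Definition digit_at (s i D : nat) : nat := (D %/ s ^ i %% s)%N.

Lemma digit_at_cat s K X lo j : (0 < s)%N -> (lo < s ^ K)%N ->
  digit_at s j (X * s ^ K + lo) =
  if (j < K)%N then digit_at s j lo else digit_at s (j - K) X.
Proof.
move=> s0 loK; rewrite /digit_at; case: ltnP => jK.
  have -> : (X * s ^ K = X * s ^ (K - j.+1) * s * s ^ j)%N.
    by rewrite -mulnA -expnS -mulnA -expnD; congr (_ * _ ^ _)%N; lia.
  by rewrite divnMDl ?expn_gt0 ?s0 // modnMDl.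
have -> : (s ^ j = s ^ K * s ^ (j - K))%N by rewrite -expnD subnKC.
rewrite divnMA divnMDl ?expn_gt0 ?s0 //.
by rewrite (divn_small loK) addn0.
Qed.

Lemma exists_digits s m (t : nat -> nat) : (forall i, (t i < s)%N) ->
  exists2 d, (d < s ^ m)%N & forall i, (i < m)%N -> digit_at s i d = t i.
Proof.
elim: m t => [|m IH] t ts; first by exists 0%N.
have s0 : (0 < s)%N by apply: leq_ltn_trans (ts 0%N).
have [d dm Hd] := IH (fun i => t i.+1) (fun i => ts i.+1).
exists (d * s ^ 1 + t 0%N)%N.
  by have := leq_mul dm (leqnn s); have := ts 0%N; rewrite expn1 expnSr mulSn; lia.
move=> i im; rewrite digit_at_cat ?expn1 //; case: i im => [|i] im /=.
  by rewrite /digit_at expn0 divn1 modn_small.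
by rewrite subn1 /= Hd.
Qed.

Section Distribution.
Variables (R : realType) (s m0 L : nat) (a : R).
Hypotheses (s2 : (1 < s)%N) (m0_gt0 : (0 < m0)%N) (L_gt0 : (0 < L)%N) (m0L : (m0 %| L)%N).
Hypothesis a01 : 0 <= a < 1.

Let s0 : (0 < s)%N. Proof. by lia. Qed.
Let sR : 0 < (s%:R : R). Proof. by rewrite ltr0n. Qed.
Let LR : 0 < (L%:R : R). Proof. by rewrite ltr0n. Qed.
Let m0R : 0 < (m0%:R : R). Proof. by rewrite ltr0n. Qed.

Definition bias_digit (e : nat) : R := (e == 0%N)%:R - (e == 1%N)%:R.

(* The sum of these weights over a period of an arithmetic progression of step [m] vanishes unless
   [m0] divides [m]. *)
Definition bias_weight (i : nat) : R := cs (i%:R / m0%:R).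

Definition bias (D : nat) : R :=
  \sum_(0 <= i < L) bias_weight i * bias_digit (digit_at s i D).

(** Since [|bias D| <= L], the factor [a / L] keeps the density relative to the uniform law within
    [[1 - a, 1 + a]], whatever [L] is. *)
Definition block_law (D : nat) : R := (1 + a / L%:R * bias D) / s%:R ^+ L.

Lemma sum_bias_digit : \sum_(0 <= e < s) bias_digit e = 0.
Proof.
rewrite /bias_digit; have -> : index_iota 0 s = index_iota 0 (s - 2).+2.
  by congr index_iota; lia.
by rewrite !big_nat_recl //= big1 ?addr0; [ring | move=> i _; rewrite subrr].
Qed.

Lemma bias_digit_max e : `|bias_digit e| <= 1.
Proof.
rewrite /bias_digit; case: e => [|[|e]] /=; rewrite ?subr0 ?sub0r ?normrN ?normr1 ?normr0 //.
Qed.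

Lemma bias_max D : `|bias D| <= L%:R.
Proof.
apply: le_trans (ler_norm_sum _ _ _) _.
apply: (@le_trans _ _ (\sum_(0 <= i < L) 1)).
  apply: ler_sum => i _; rewrite normrM -[X in _ <= X]mulr1.
  by apply: ler_pM => //; rewrite ?cs_max ?bias_digit_max.
by rewrite big_const_nat iter_addr addr0 subn0.
Qed.

Lemma block_law_bounds D :
  (1 - a) / s%:R ^+ L <= block_law D <= (1 + a) / s%:R ^+ L.
Proof.
have /andP[a0 a1] := a01; have sL : 0 < (s%:R ^+ L : R)^-1 by rewrite invr_gt0 exprn_gt0.
rewrite /block_law !ler_pM2r //.
have : `|a / L%:R * bias D| <= a.
  rewrite normrM ger0_norm; last by rewrite divr_ge0.
  by rewrite -mulrA ler_piMr // mulrC ler_pdivrMr // mul1r bias_max.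
by rewrite ler_norml => /andP[h1 h2]; apply/andP; split; lra.
Qed.

Lemma block_law_gt0 D : 0 < block_law D.
Proof.
have /andP[h _] := block_law_bounds D; apply: lt_le_trans h.
by have /andP[_ a1] := a01; rewrite divr_gt0 ?exprn_gt0 // subr_gt0.
Qed.

Lemma sum_split3 (A m B : nat) (F : nat -> R) :
  \sum_(0 <= D < s ^ (A + m + B)) F D =
  \sum_(0 <= e < s ^ m) \sum_(0 <= hi < s ^ A) \sum_(0 <= lo < s ^ B)
     F ((hi * s ^ m + e) * s ^ B + lo)%N.
Proof.
rewrite expnD -{1}(mul0n (s ^ B)%N) big_nat_block // expnD -{1}(mul0n (s ^ m)%N).
by rewrite big_nat_block // exchange_big.
Qed.

Lemma sum_bias_digit_at len j : (j < len)%N ->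
  \sum_(0 <= D < s ^ len) bias_digit (digit_at s j D) = 0.
Proof.
move=> jl; rewrite (_ : len = (len - j.+1 + 1 + j)%N); last by lia.
rewrite sum_split3 (eq_big_nat _ _ (F2 := fun e => \sum_(0 <= hi < s ^ (len - j.+1))
   \sum_(0 <= lo < s ^ j) bias_digit e)).
  under eq_bigr do rewrite big_const_nat iter_addr addr0.
  under eq_bigr do rewrite big_const_nat iter_addr addr0.
  by rewrite !sumrMnl expn1 sum_bias_digit !mul0rn.
move=> e; rewrite expn1 => /andP[_ es]; apply: eq_bigr => hi _.
rewrite big_nat_cond [RHS]big_nat_cond; apply: eq_bigr => lo /andP[/andP[_ lj] _].
by rewrite digit_at_cat // ltnn subnn /digit_at expn0 divn1 modnMDl modn_small.
Qed.

(** The digits outside the fixed middle block run freely, and their terms cancel because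
    [bias_digit] sums to zero. *)
Lemma sum_bias_fiber (A m B d : nat) : (A + m + B = L)%N -> (d < s ^ m)%N ->
  \sum_(0 <= hi < s ^ A) \sum_(0 <= lo < s ^ B) bias ((hi * s ^ m + d) * s ^ B + lo) =
  (s%:R ^+ (A + B)) * \sum_(0 <= i < m) bias_weight (B + i) * bias_digit (digit_at s i d).
Proof.
move=> E dm; rewrite /bias.
under eq_bigr do rewrite exchange_big /=.
rewrite exchange_big /=.
pose G j := \sum_(0 <= hi < s ^ A) \sum_(0 <= lo < s ^ B)
   bias_weight j * bias_digit (digit_at s j ((hi * s ^ m + d) * s ^ B + lo)).
rewrite -/(G _) (big_cat_nat (n := B)) //=; last by lia.
rewrite [X in _ + X](big_cat_nat (n := (B + m)%N)) //=; try lia.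
have -> : \sum_(0 <= i < B) G i = 0.
  rewrite big_nat_cond big1 // => j /andP[/andP[_ jB] _]; rewrite /G big1 // => hi _.
  rewrite -mulr_sumr (eq_big_nat _ _ (F2 := fun lo => bias_digit (digit_at s j lo))).
    by rewrite sum_bias_digit_at // mulr0.
  by move=> lo /andP[_ lB]; rewrite digit_at_cat // jB.
have -> : \sum_(B + m <= i < L) G i = 0.
  rewrite big_nat_cond big1 // => j /andP[/andP[jB jL] _].
  rewrite /G exchange_big big_nat_cond big1 // => lo /andP[/andP[_ lB] _].
  rewrite -mulr_sumr (eq_bigr (fun hi => bias_digit (digit_at s (j - B - m) hi))).
    by rewrite sum_bias_digit_at ?mulr0 //; lia.
  move=> hi _; rewrite digit_at_cat // ifF; last by lia.
  by rewrite digit_at_cat // ifF //; lia.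
rewrite add0r addr0 -{1}(add0n B) big_addn addKn mulr_sumr big_nat_cond [RHS]big_nat_cond.
apply: eq_bigr => i /andP[/andP[_ im] _].
rewrite /G (eq_bigr (fun _ => s%:R ^+ B * (bias_weight (B + i) * bias_digit (digit_at s i d)))).
  by rewrite big_const_nat iter_addr addr0 subn0 -[LHS]mulr_natl natrX exprD mulrA.
move=> hi _; rewrite (eq_big_nat _ _ (F2 := fun _ => bias_weight (B + i) * bias_digit (digit_at s i d))).
  by rewrite big_const_nat iter_addr addr0 subn0 -[LHS]mulr_natl natrX.
move=> lo /andP[_ lB]; rewrite digit_at_cat // ifF; last by lia.
by rewrite addnK digit_at_cat // im addnC.
Qed.

Lemma sum_block_law_fiber (m c d : nat) : (m * c + m <= L)%N -> (d < s ^ m)%N ->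
  \sum_(0 <= D < s ^ L | (D %/ s ^ (m * c) %% s ^ m == d)%N) block_law D =
  (1 + a / L%:R * \sum_(0 <= i < m) bias_weight (m * c + i) * bias_digit (digit_at s i d))
   / s%:R ^+ m.
Proof.
move=> mc dm; pose A := (L - m - m * c)%N; pose B := (m * c)%N.
have E : (A + m + B = L)%N by rewrite /A /B; lia.
rewrite big_mkcond -/B -{1}E sum_split3.
rewrite (bigD1_seq d) ?mem_index_iota ?iota_uniq //= [X in _ + X]big1_seq ?addr0; last first.
  move=> e; rewrite mem_index_iota => /andP[ed /andP[_ em]].
  rewrite big1 // => hi _; rewrite big_nat_cond big1 // => lo /andP[/andP[_ lB] _].
  by rewrite divnMDl ?expn_gt0 ?s0 // (divn_small lB) addn0 modnMDl modn_small // (negbTE ed).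
rewrite (eq_bigr (fun hi => \sum_(0 <= lo < s ^ B)
   (s%:R ^- L + a / L%:R / s%:R ^+ L * bias ((hi * s ^ m + d) * s ^ B + lo)))); last first.
  move=> hi _; rewrite big_nat_cond [RHS]big_nat_cond.
  apply: eq_bigr => lo /andP[/andP[_ lB] _].
  rewrite divnMDl ?expn_gt0 ?s0 // (divn_small lB) addn0 modnMDl modn_small // eqxx.
  by rewrite /block_law; ring.
under eq_bigr do rewrite big_split /=.
rewrite big_split /=.
under [X in _ + X]eq_bigr do rewrite -mulr_sumr.
rewrite -mulr_sumr sum_bias_fiber //.
under eq_bigr do rewrite big_const_nat iter_addr addr0 subn0.
rewrite big_const_nat iter_addr addr0 subn0 -mulrnA -[X in X + _]mulr_natl natrM !natrX.
have sn0 k : (s%:R : R) ^+ k != 0 by rewrite expf_neq0 // gt_eqF.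
have -> : s%:R ^+ L = s%:R ^+ A * s%:R ^+ m * s%:R ^+ B :> R by rewrite -!exprD E.
by rewrite exprD; field; rewrite !sn0 gt_eqF.
Qed.

Lemma sum_block_law : \sum_(0 <= D < s ^ L) block_law D = 1.
Proof.
have := @sum_block_law_fiber 0 0 0; rewrite muln0 add0n expn0 (@big_geq _ _ _ 0 0) //.
rewrite mulr0 addr0 expr0 divr1 => <- //.
by apply: eq_bigl => D; rewrite modn1.
Qed.

(** In turns, the step [m / m0] is not an integer but the total advance [L / m0] is, so the
    telescoped sum returns to its starting value. *)
Lemma sum_bias_weight_progression m i : (0 < m)%N -> (m %| L)%N -> ~~ (m0 %| m)%N ->
  \sum_(0 <= c < L %/ m) bias_weight (m * c + i) = 0.
Proof.
move=> m_gt0 mL m0m; pose al : R := m%:R / m0%:R.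
have s1 : sn (al / 2) != 0.
  apply: sn_half_neq0 => z; apply/negP => /eqP E.
  have E2 : (m%:R : R) = z%:~R * m0%:R by rewrite -E /al divfK // gt_eqF.
  have E3 : m%:Z = z * m0%:Z by apply: (@intr_inj R); rewrite intrM.
  by move/negP: m0m; apply; rewrite -[m]absz_nat E3 abszM absz_nat dvdn_mull.
apply: (mulfI (x := 2 * sn (al / 2))); first by rewrite mulf_neq0 // pnatr_eq0.
rewrite mulr0 (eq_bigr (fun c => cs (c%:R * al + i%:R / m0%:R))); last first.
  by move=> c _; rewrite /bias_weight natrD natrM /al; congr cs; ring.
rewrite sum_cs_progression; apply/eqP; rewrite subr_eq0; apply/eqP.
have -> : (L %/ m)%:R * al + i%:R / m0%:R - al / 2 =
          i%:R / m0%:R - al / 2 - (- (L %/ m0)%N%:Z)%:~R.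
  have e1 : (L %/ m)%:R * m%:R = (L%:R : R) by rewrite -natrM divnK.
  have e2 : (L %/ m0)%:R * m0%:R = (L%:R : R) by rewrite -natrM divnK.
  have -> : (L %/ m)%:R * al = (L%:R : R) / m0%:R by rewrite /al mulrA e1.
  by rewrite -e2 mulfK ?gt_eqF // mulrNz opprK -pmulrn; ring.
exact: snBint.
Qed.

(** A single block may be biased; only the mean over the positions [c] is uniform, and digit
    frequencies see nothing else. *)
Lemma block_law_uniform m d : (0 < m)%N -> (m %| L)%N -> (d < s ^ m)%N ->
  ~~ (m0 %| m)%N \/ a = 0 ->
  \sum_(0 <= c < L %/ m) \sum_(0 <= D < s ^ L | (D %/ s ^ (m * c) %% s ^ m == d)%N) block_law D
  = (L %/ m)%:R / s%:R ^+ m.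
Proof.
move=> m_gt0 mL dm H.
rewrite (eq_big_nat _ _ (F2 := fun c => s%:R ^- m + a / L%:R / s%:R ^+ m *
   \sum_(0 <= i < m) bias_weight (m * c + i) * bias_digit (digit_at s i d))); last first.
  move=> c /andP[_ cL]; rewrite sum_block_law_fiber //; first by ring.
  by rewrite addnC -mulnS mulnC -(divnK mL) leq_mul2r cL orbT.
rewrite big_split /= -mulr_sumr big_const_nat iter_addr addr0 subn0 -[X in X + _]mulr_natl.
case: H => [m0m|->]; last by rewrite !mul0r addr0.
rewrite exchange_big /= big1 ?mulr0 ?addr0 // => i _.
by rewrite -mulr_suml sum_bias_weight_progression // mul0r.
Qed.

(** The subdigits of [d] are 0 or 1 according to the signs of the weights. The weights have period
    [m0], so every aligned block favours [d], at least by the term [i = 0], whose weight is 1. *)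
Lemma block_law_biased : exists2 d, (d < s ^ m0)%N &
  (L %/ m0)%:R * ((1 + a / L%:R) / s%:R ^+ m0) <=
  \sum_(0 <= c < L %/ m0) \sum_(0 <= D < s ^ L | (D %/ s ^ (m0 * c) %% s ^ m0 == d)%N) block_law D.
Proof.
have ts i : (nat_of_bool (bias_weight i < 0)%R < s)%N by case: (_ < _)%R; lia.
have [d dm Hd] := exists_digits m0 ts; exists d => //.
rewrite (eq_big_nat _ _ (F2 := fun c => (1 + a / L%:R * \sum_(0 <= i < m0) `|bias_weight i|) / s%:R ^+ m0)); last first.
  move=> c /andP[_ cL]; rewrite sum_block_law_fiber //; last first.
    by rewrite addnC -mulnS mulnC -(divnK m0L) leq_mul2r cL orbT.
  congr ((1 + _ * _) / _); rewrite big_nat_cond [RHS]big_nat_cond.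
  apply: eq_bigr => i /andP[/andP[_ im] _].
  have -> : bias_weight (m0 * c + i) = bias_weight i.
    rewrite /bias_weight -[RHS](csBint _ (- c%:Z)) mulrNz opprK -pmulrn natrD natrM.
    by congr cs; field; rewrite gt_eqF.
  rewrite Hd //; case: ltP => w0; rewrite /bias_digit /=.
    by rewrite sub0r mulrN1 ltr0_norm.
  by rewrite subr0 mulr1 ger0_norm.
rewrite big_const_nat iter_addr addr0 subn0 -[X in _ <= X]mulr_natl ler_wpM2l //.
rewrite ler_pM2r ?invr_gt0 ?exprn_gt0 // lerD2l.
have /andP[a0 _] := a01; rewrite -[X in X <= _]mulr1; apply: ler_wpM2l.
  by rewrite divr_ge0.
rewrite (bigD1_seq 0%N) ?mem_index_iota ?iota_uniq //=.
rewrite /bias_weight mul0r cs0 normr1 lerDl; exact: sumr_ge0.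
Qed.

End Distribution.

(** * Digits of real numbers *)

(* The number of base-[r] digits that resolve the scale [1 / q]. *)
Definition kap (r q : nat) : nat := up_log r q.

Section Kap.
Variable r : nat.
Hypothesis r2 : (1 < r)%N.

Lemma leq_kap q q' : (q <= q')%N -> (kap r q <= kap r q')%N.
Proof. exact: leq_up_log. Qed.

Lemma kap_exp q : (q <= r ^ kap r q)%N.
Proof. exact: up_logP. Qed.

Lemma exp_kap q : (0 < q)%N -> (r ^ kap r q <= r * q)%N.
Proof.
case: q => [//|[|q]] _; first by rewrite /kap up_log1 muln1 ltnW.
rewrite /kap -[up_log _ _]prednK ?up_log_gt0 ?r2 // expnS leq_mul2l.
by rewrite ltnW ?orbT // up_log_gtn.
Qed.

Lemma kapM q q' : (kap r (q * q') <= kap r q + kap r q')%N.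
Proof. by apply: up_log_min; rewrite // expnD leq_mul // kap_exp. Qed.

Lemma kap_window b q Q N : (1 < b)%N -> (0 < q)%N -> (q * b ^ N <= Q)%N ->
  (N <= r * (kap r Q - kap r q).+1)%N.
Proof.
move=> b1 q0 qQ; have qQ' : (q <= Q)%N by apply: leq_trans qQ; rewrite leq_pmulr // expn_gt0 ltnW.
set W := (kap r Q - kap r q)%N.
have kE : (kap r Q = kap r q + W)%N by rewrite subnKC // leq_kap.
have h : (b ^ N <= r ^ W.+1)%N.
  rewrite -(leq_pmul2l q0); apply: leq_trans qQ _; apply: leq_trans (kap_exp Q) _.
  by rewrite kE expnD expnS mulnA leq_mul2r (mulnC q) exp_kap ?orbT.
have h2 : (2 ^ N <= 2 ^ (r * W.+1))%N.
  rewrite expnM; apply: leq_trans (_ : b ^ N <= _)%N; first by case: N {qQ h} => // N; rewrite leq_exp2r.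
  by apply: leq_trans h _; rewrite leq_exp2r // ltnW // ltn_expl.
by rewrite leq_exp2l in h2.
Qed.

End Kap.

Lemma truncn_divn (R : realType) (c : nat) (y : R) : (0 < c)%N -> 0 <= y ->
  (Num.truncn (c%:R * y) %/ c)%N = Num.truncn y.
Proof.
move=> c0 y0; have cR : 0 < (c%:R : R) by rewrite ltr0n.
have cy0 : 0 <= c%:R * y by rewrite mulr_ge0.
apply/eqP; rewrite eq_sym truncn_eq //; set T := Num.truncn _.
have /andP[T1 T2] := truncn_itv cy0; rewrite -/T in T1 T2.
apply/andP; split; rewrite -(ler_pM2l cR) || rewrite -(ltr_pM2l cR).
  by apply: le_trans T1; rewrite -natrM ler_nat mulnC leq_divM.
apply: lt_le_trans T2 _; rewrite -natrM ler_nat mulnC.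
exact: ltn_ceil.
Qed.

Section Digits.
Variable R : realType.
Implicit Types (x : R) (r d k : nat).

(* Only meaningful for [0 <= x]: [Num.truncn] vanishes on negative numbers. *)
Definition dig r (j : nat) x : nat := (Num.truncn (r%:R ^+ j * x) %% r)%N.

(** Index [k] stands for the digit [k + 1], the first digit of the fractional part of
    [r ^ k * x]. *)
Definition hits r d k0 k1 x : nat := (\sum_(k0 <= k < k1) (dig r k.+1 x == d))%N.

Lemma hits_cat r d k1 k0 k2 x : (k0 <= k1)%N -> (k1 <= k2)%N ->
  hits r d k0 k2 x = (hits r d k0 k1 x + hits r d k1 k2 x)%N.
Proof. by move=> h1 h2; rewrite /hits (big_cat_nat (n := k1)). Qed.

Lemma hits_le r d k0 k1 x : (hits r d k0 k1 x <= k1 - k0)%N.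
Proof.
rewrite /hits -[X in (_ <= X)%N]muln1 -sum_nat_const_nat; apply: leq_sum => k _.
by case: eqP.
Qed.

Lemma truncn_expr_divn r (j k : nat) x : (0 < r)%N -> 0 <= x ->
  (Num.truncn (r%:R ^+ (j + k) * x) %/ r ^ k)%N = Num.truncn (r%:R ^+ j * x).
Proof.
move=> r0 x0; have -> : r%:R ^+ (j + k) * x = (r ^ k)%:R * (r%:R ^+ j * x).
  by rewrite natrX exprD; ring.
by rewrite truncn_divn ?expn_gt0 ?r0 // mulr_ge0 // exprn_ge0.
Qed.

Lemma weyl_digits r (eps : R) : (1 < r)%N -> 0 < eps -> exists n (e : R),
  [/\ (0 < n)%N, 0 < e & forall A m x, 0 <= x ->
    small_weyl_sums n e (iota A m) (fun k => r%:R ^+ k * x) ->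
    forall d, (d < r)%N ->
    (hits r d A (A + m) x)%:R <= (r%:R^-1 + eps) * m%:R].
Proof.
move=> r2 e0; have [n [e [n0 ee0 H]]] := fejer_count e0.
exists n, e; split => // A m x x0 Hw d dr.
have rR : 0 < (r%:R : R) by rewrite ltr0n; lia.
have := H (iota A m) (fun k => dig r k.+1 x == d) _ (d%:R / r%:R) (d.+1%:R / r%:R) _ Hw.
rewrite size_iota => HH.
have -> : hits r d A (A + m) x = count (fun k => dig r k.+1 x == d) (iota A m).
  rewrite /hits /index_iota addKn -sum1_count [RHS]big_mkcond.
  by apply: eq_bigr => k _; case: eqP.
apply: le_trans (HH _ _) _.
- by rewrite ler_pM2r ?invr_gt0 // ler_nat.
- move=> k _ /eqP dk.
  have y0 : 0 <= r%:R ^+ k.+1 * x by rewrite mulr_ge0 // exprn_ge0 // ltW.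
  have /andP[T1 T2] := truncn_itv y0.
  set T := Num.truncn _ in T1 T2; have TE : T = (T %/ r * r + d)%N.
    by rewrite {1}(divn_eq T r) -dk.
  exists (T %/ r)%N%:Z; rewrite -[(_%:Z)%:~R]/((T %/ r)%:R).
  have E : r%:R * (r%:R ^+ k * x - (T %/ r)%:R) = r%:R ^+ k.+1 * x - (T %/ r * r)%:R :> R.
    by rewrite exprS natrM; ring.
  apply/andP; split.
    rewrite ler_pdivrMr // mulrC E lerBrDr -natrD addnC -TE //.
  rewrite ler_pdivlMr // mulrC E lerBlDr -natrD addSn addnC -TE ltW //.
rewrite -mulrBl -natrB // subSnn div1r //.
Qed.

(** A word fixes [x] only up to [1 / Q]. The Lipschitz bound carries the Weyl sums over from the
    left end [X], as long as [h * r ^ k] is small against [Q]. *)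
Lemma small_weyl_sums_near r n (e : R) A m (X x Q : R) : 0 < Q ->
  X <= x <= X + Q^-1 ->
  (forall h k, (h < n)%N -> (k < A + m)%N -> 2 * pi * (h%:R * r%:R ^+ k) <= e / 2 * Q) ->
  small_weyl_sums n (e / 2) (iota A m) (fun k => r%:R ^+ k * X) ->
  small_weyl_sums n e (iota A m) (fun k => r%:R ^+ k * x).
Proof.
move=> Q0 /andP[Xx xX] H HX h hn; have [c1 c2] := HX h hn; rewrite size_iota in c1 c2.
rewrite size_iota.
have pi0 : 0 < (pi : R) := pi_gt0 R.
have lip (f : R -> R) : (forall y z, `|f y - f z| <= 2 * pi * `|y - z|) ->
    `|\sum_(k <- iota A m) f (h%:R * (r%:R ^+ k * X))| <= e / 2 * m%:R ->
    `|\sum_(k <- iota A m) f (h%:R * (r%:R ^+ k * x))| <= e * m%:R.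
  move=> fl fX.
  have D : `|\sum_(k <- iota A m) f (h%:R * (r%:R ^+ k * x)) -
             \sum_(k <- iota A m) f (h%:R * (r%:R ^+ k * X))| <= e / 2 * m%:R.
    rewrite -sumrB; apply: le_trans (ler_norm_sum _ _ _) _.
    apply: (@le_trans _ _ (\sum_(k <- iota A m) e / 2)); last first.
      by rewrite big_const_seq iter_addr addr0 count_predT size_iota -[X in X <= _]mulr_natr.
    rewrite big_seq [X in _ <= X]big_seq; apply: ler_sum => k.
    rewrite mem_iota => /andP[_ kAm]; apply: le_trans (fl _ _) _.
    have -> : h%:R * (r%:R ^+ k * x) - h%:R * (r%:R ^+ k * X) = (h%:R * r%:R ^+ k) * (x - X) by ring.
    rewrite ger0_norm; last by rewrite mulr_ge0 // subr_ge0.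
    apply: (@le_trans _ _ (2 * pi * (h%:R * r%:R ^+ k * Q^-1))).
      apply: ler_wpM2l; first by rewrite mulr_ge0 // ltW.
      by apply: ler_wpM2l => //; rewrite lerBlDl.
    rewrite mulrA ler_pdivrMr //; apply: H => //; by case/andP: hn.
  have := ler_normD (\sum_(k <- iota A m) f (h%:R * (r%:R ^+ k * x)) -
             \sum_(k <- iota A m) f (h%:R * (r%:R ^+ k * X)))
             (\sum_(k <- iota A m) f (h%:R * (r%:R ^+ k * X))).
  rewrite subrK; lra.
by split; apply: lip => //; [exact: cs_le_lip | exact: sn_le_lip].
Qed.

(** One-sided on purpose: upper bounds for all [r] digits imply lower bounds, as the frequencies sum
    to 1 ([cvg_hits]). *)
Definition digits_le r (eps : R) (q Q : nat) x : Prop := forall d, (d < r)%N ->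
  (hits r d (kap r q) (kap r Q) x)%:R <= (r%:R^-1 + eps) * (kap r Q - kap r q)%:R.

End Digits.

(** * Requirements met by most words *)

Section Control.
Variables (R : realType) (b : nat) (p : nat -> R).
Hypothesis b2 : (2 < b)%N.
Hypothesis p_gt0 : forall D, (D < b)%N -> 0 < p D.
Hypothesis sum_p : \sum_(0 <= D < b) p D = 1.

Let b_gt0 : (0 < b)%N. Proof. by lia. Qed.
Let b1 : (1 < b)%N. Proof. by lia. Qed.
Let b0 : 0 < (b%:R : R). Proof. by rewrite ltr0n. Qed.

(* [controlled P]: the words of length [N] appended at depth [n] that do not force [P] have
   arbitrarily small probability once [N] is large, uniformly in [n] and in the prefix [v];
   the depth [n] is the first one fine enough for an interval of length [1 / q]. *)
Definition controlled (P : nat -> nat -> nat -> R -> Prop) : Prop :=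
  forall beta : R, 0 < beta -> exists N0 : nat, forall N n q v : nat, (N0 <= N)%N ->
    (0 < q)%N -> (q <= b ^ n)%N -> (b ^ n <= 2 * b * q)%N ->
    exists Y : nat -> R, [/\ forall w, 0 <= Y w,
      \sum_(0 <= w < b ^ N) pw b p N w * Y w <= beta &
      forall w x, (w < b ^ N)%N -> Y w < 1 -> 0 <= x ->
        Num.truncn (b%:R ^+ (n + N) * x) = (v * b ^ N + w)%N -> P q n N x].

Lemma controlled_impl P P' : controlled P ->
  (exists N0, forall q n N x, (N0 <= N)%N -> (0 < q)%N -> (q <= b ^ n)%N ->
     (b ^ n <= 2 * b * q)%N -> 0 <= x -> P q n N x -> P' q n N x) -> controlled P'.
Proof.
move=> HP [N1 HPP] beta b_pos; have [N0 H] := HP beta b_pos.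
exists (maxn N0 N1) => N n q v; rewrite geq_max => /andP[NN NN1] q0 qb bq.
have [Y [Y0 EY HY]] := H N n q v NN q0 qb bq; exists Y; split => // w x wb Yw x0 E.
by apply: HPP => //; exact: HY E.
Qed.

Lemma controlled_and P P' : controlled P -> controlled P' ->
  controlled (fun q n N x => P q n N x /\ P' q n N x).
Proof.
move=> HP HP' beta b_pos; have b_pos2 : 0 < beta / 2 by rewrite divr_gt0.
have [N0 H] := HP _ b_pos2; have [N1 H1] := HP' _ b_pos2.
exists (maxn N0 N1) => N n q v; rewrite geq_max => /andP[NN NN1] q0 qb bq.
have [Y [Y0 EY HY]] := H N n q v NN q0 qb bq.
have [Z [Z0 EZ HZ]] := H1 N n q v NN1 q0 qb bq.
exists (fun w => Y w + Z w); split => [w||w x wb Yw x0 E]; first exact: addr_ge0.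
  by under eq_bigr do rewrite mulrDr; rewrite big_split /=; lra.
have := Y0 w; have := Z0 w.
by split; [apply: HY E | apply: HZ E] => //; lra.
Qed.

Lemma controlled_forall (K : nat) (P : nat -> nat -> nat -> nat -> R -> Prop) :
  (forall k, (k < K)%N -> controlled (P k)) ->
  controlled (fun q n N x => forall k, (k < K)%N -> P k q n N x).
Proof.
elim: K => [|K IH] H.
  move=> beta b_pos; exists 0%N => N n q v _ _ _ _; exists (fun => 0); split=> //.
  by under eq_bigr do rewrite mulr0; rewrite big1 // ltW.
have := controlled_and (IH (fun k kK => H k (leqW kK))) (H K (ltnSn K)).
move/controlled_impl; apply; exists 0%N => q n N x _ _ _ _ _ [h1 h2] k.
by rewrite ltnS leq_eqVlt => /predU1P[->|] //; exact: h1.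
Qed.

Lemma controlled_words P (pm : R) : controlled P ->
  (forall D, (D < b)%N -> p D <= pm) -> exists N0 : nat, forall N n q v : nat,
    (N0 <= N)%N -> (0 < q)%N -> (q <= b ^ n)%N -> (b ^ n <= 2 * b * q)%N ->
    exists ws : seq nat, [/\ uniq ws, 2^-1 <= (size ws)%:R * pm ^+ N &
      forall w, w \in ws -> (w < b ^ N)%N /\ forall x, 0 <= x ->
        Num.truncn (b%:R ^+ (n + N) * x) = (v * b ^ N + w)%N -> P q n N x].
Proof.
move=> HP Hpm; have [|N0 H] := HP (2^-1); first by rewrite invr_gt0.
exists N0 => N n q v NN q0 qb bq; have [Y [Y0 EY HY]] := H N n q v NN q0 qb bq.
exists [seq w <- iota 0 (b ^ N) | Y w < 1]; split.
- by rewrite filter_uniq // iota_uniq.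
- apply: le_trans (markov_words b2 p_gt0 sum_p Y0 EY) _.
  rewrite size_filter -sum1_count natr_sum mulr_suml.
  rewrite /index_iota subn0; apply: ler_sum => w _; rewrite mul1r.
  exact: pw_le.
- move=> w; rewrite mem_filter mem_iota add0n /= => /andP[Yw wb]; split => // x x0 E.
  exact: HY E.
Qed.

Lemma sum_dig_cntw n N v w D (x : R) : 0 <= x -> (w < b ^ N)%N ->
  Num.truncn (b%:R ^+ (n + N) * x) = (v * b ^ N + w)%N ->
  (\sum_(0 <= i < N) (dig b (n + i).+1 x == D))%N = cntw b N D w.
Proof.
move=> x0; elim: N w => [|N IH] w wb E; first by rewrite big_geq.
rewrite big_nat_recr //= (IH (w %/ b)%N).
- congr (_ + (_ == D))%N; rewrite /dig -addnS E expnSr mulnA modnMDl //.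
- by rewrite ltn_divLR // -expnSr.
have := @truncn_expr_divn R b (n + N) 1 x b_gt0 x0.
rewrite -addnA addn1 E expn1 => <-.
by rewrite expnSr mulnA divnMDl.
Qed.

Definition blocks_near (eps : R) (q n N : nat) (x : R) : Prop := forall D, (D < b)%N ->
  `|(\sum_(0 <= i < N) (dig b (n + i).+1 x == D))%:R - N%:R * p D| <= eps * N%:R.

Lemma controlled_blocks (eps : R) : 0 < eps -> controlled (blocks_near eps).
Proof.
move=> e0 beta b_pos; pose B := b%:R / (eps ^+ 2 * beta).
exists (Num.truncn B).+1 => N n q v NN q0 qb bq.
have BN : B <= N%:R.
  by apply: le_trans (ltW (truncnS_gt B)) _; rewrite ler_nat.
have N0 : 0 < (N%:R : R) by rewrite ltr0n; apply: leq_ltn_trans NN.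
have eN : 0 < (eps * N%:R) ^+ 2 by rewrite exprn_gt0 // mulr_gt0.
exists (fun w => \sum_(0 <= D < b) ((cntw b N D w)%:R - N%:R * p D) ^+ 2 / (eps * N%:R) ^+ 2).
split.
- move=> w; apply: sumr_ge0 => D _; apply: divr_ge0; [exact: sqr_ge0 | exact: ltW].
- under eq_bigr do rewrite mulr_sumr.
  rewrite exchange_big /=.
  apply: (@le_trans _ _ (\sum_(0 <= D < b) N%:R / (eps * N%:R) ^+ 2)).
    rewrite big_nat_cond [X in _ <= X]big_nat_cond; apply: ler_sum => D /andP[/andP[_ Db] _].
    under eq_bigr do rewrite mulrA.
    rewrite -mulr_suml ler_pM2r ?invr_gt0 //.
    by have [] := lln_words b2 p_gt0 sum_p N Db.
  rewrite big_const_nat iter_addr addr0 subn0 -[X in X <= _]mulr_natl.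
  have -> : b%:R * (N%:R / (eps * N%:R) ^+ 2) = b%:R / eps ^+ 2 / N%:R :> R.
    by field; rewrite !gt_eqF.
  rewrite ler_pdivrMr //.
  have -> : b%:R / eps ^+ 2 = beta * B by rewrite /B; field; rewrite !gt_eqF.
  by rewrite ler_pM2l.
- move=> w x wb Yw x0 E D Db; rewrite (sum_dig_cntw D x0 wb E).
  rewrite -(@ler_pXn2r _ 2) ?nnegrE //; last by rewrite mulr_ge0 // ltW.
  rewrite real_normK ?num_real // -(mul1r ((_ * _) ^+ 2)) -ler_pdivrMr //.
  apply: le_trans (ltW Yw); rewrite [X in _ <= X](bigD1_seq D) ?mem_index_iota ?iota_uniq //=.
  by rewrite lerDl; apply: sumr_ge0 => i _; apply: divr_ge0; [exact: sqr_ge0 | exact: ltW].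
Qed.

(** The digits from [kap r q] to [kap r (b ^ (n + N))] are cut at [A] and [E]. In between, [r ^ k]
    is at least [b ^ (n + J)], as [second_moment] asks, and so far below [b ^ (n + N)] that the word
    determines the Weyl sums. The two ends have at most [c] digits, a number independent of [n] and
    [N]. *)
Lemma controlled_independent (r : nat) (eps : R) : (1 < r)%N ->
  (forall h m : nat, (0 < h)%N -> (r ^ h)%N <> (b ^ m)%N) -> 0 < eps ->
  controlled (fun q n N x => digits_le r eps q (b ^ (n + N)) x).
Proof.
move=> r2 indep e0 beta b_pos.
have e20 : 0 < eps / 2 by rewrite divr_gt0.
have [nF [e [nF0 ee0 HF]]] := weyl_digits r2 e20.
have nFR : 0 < (nF%:R : R) by rewrite ltr0n.
(* The mean of the squares will be at most [2 * del * m ^ 2]; divided by [(e / 2 * m) ^ 2] this is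
   [beta / nF] for each frequency. *)
pose del := beta * e ^+ 2 / (8 * nF%:R).
have del0 : 0 < del by rewrite divr_gt0 ?mulr_gt0 ?exprn_gt0.
have [J [T0 HS]] := second_moment b2 p_gt0 sum_p r2 indep del0.
(* The summand 1 keeps the frequencies below [b ^ (n + N)]; the other one makes the passage from [X]
   to [x] change each term by at most [e / 2]. *)
pose Z := (nF%:R * r%:R) * (1 + 4 * pi / e) : R.
pose J2 := (Num.truncn Z).+1.
have ZJ : Z <= b%:R ^+ J2.
  apply: ltW; apply: lt_le_trans (truncnS_gt Z) _; rewrite -natrX ler_nat -/J2.
  exact/ltnW/ltn_expl.
pose c := (kap r (2 * b * b ^ J) + kap r (b ^ J2))%N.
(* With [B] digits in all, removing the ends leaves [m >= T0 / del], and [c] is at most [eps / 2] of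
   the total. *)
pose B := (c + (Num.truncn (T0%:R / del)).+1 + (Num.truncn (c%:R / (eps / 2))).+1)%N.
exists (r * B.+1 + J + J2)%N => N n q v NN q0 qb bq.
pose A := kap r (b ^ (n + J)); pose E := kap r (b ^ (n + N - J2)).
pose k0 := kap r q; pose k1 := kap r (b ^ (n + N)).
have JN : (n + J <= n + N - J2)%N by nlia.
have J2N : (n + N - J2 + J2 = n + N)%N by nlia.
have kA : (k0 <= A)%N.
  by apply: leq_kap => //; apply: leq_trans qb _; rewrite leq_exp2l // leq_addr.
have AE : (A <= E)%N by apply: leq_kap => //; rewrite leq_exp2l.
have Ek : (E <= k1)%N by apply: leq_kap => //; rewrite leq_exp2l // leq_subr.
have c1 : (A <= k0 + kap r (2 * b * b ^ J))%N.
  apply: leq_trans (kapM r2 _ _); apply: leq_kap => //.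
  by rewrite expnD mulnA (mulnC q) leq_mul2r bq orbT.
have c2 : (k1 <= E + kap r (b ^ J2))%N.
  by apply: leq_trans (kapM r2 _ _); apply: leq_kap => //; rewrite -expnD J2N.
have W : (B <= k1 - k0)%N.
  have h : (N <= r * (k1 - k0).+1)%N.
    by apply: (@kap_window r r2 b q (b ^ (n + N)) N b1 q0); rewrite expnD leq_mul2r qb orbT.
  rewrite -ltnS -(@leq_pmul2l r) ?(ltnW r2) //; apply: leq_trans h.
  by apply: leq_trans NN; rewrite -addnA leq_addr.
pose m := (E - A)%N; have AmE : (A + m = E)%N by rewrite subnKC.
have mB : ((Num.truncn (T0%:R / del)).+1 <= m)%N by move: W; rewrite /m /B /c; nlia.
have m0 : 0 < (m%:R : R) by rewrite ltr0n; apply: leq_trans mB.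
have mT : T0%:R <= del * m%:R.
  rewrite mulrC -ler_pdivrMr //; apply: le_trans (ltW (truncnS_gt _)) _; by rewrite ler_nat.
have cB : c%:R <= eps / 2 * (k1 - k0)%:R.
  rewrite mulrC -ler_pdivrMr //; apply: le_trans (ltW (truncnS_gt _)) _.
  by rewrite ler_nat; apply: leq_trans W; rewrite /B leq_addl.
have rE : (r ^ (A + m) * b ^ J2 <= r * b ^ (n + N))%N.
  rewrite AmE -[in X in (_ <= X)%N]J2N (expnD b) mulnA leq_mul2r exp_kap ?orbT // expn_gt0 b_gt0 //.
have bQ : 0 < (b%:R ^+ (n + N) : R) by rewrite exprn_gt0.
have pi0 : 0 < (pi : R) := pi_gt0 R.
have r0R : 0 < (r%:R : R) by rewrite ltr0n ltnW.
have pe : 0 < 4 * pi / e by rewrite divr_gt0 // mulr_gt0.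
have hJ h : (h < nF)%N -> (h * r <= b ^ J2)%N.
  move=> hn; rewrite -(ler_nat R) natrX natrM; apply: le_trans ZJ.
  rewrite /Z -[X in X <= _]mulr1; apply: ler_pM => //; rewrite ?mulr_ge0 //; last by lra.
  by rewrite ler_pM2r // ler_nat ltnW.
pose Y h w := let X := (v * b ^ N + w)%:R / b%:R ^+ (n + N) in
    ((\sum_(k <- iota A m) cs (h%:R * (r%:R ^+ k * X))) ^+ 2 +
     (\sum_(k <- iota A m) sn (h%:R * (r%:R ^+ k * X))) ^+ 2) / (e / 2 * m%:R) ^+ 2 : R.
have em0 : 0 < e / 2 * m%:R by rewrite mulr_gt0 // divr_gt0.
have Y0 h w : 0 <= Y h w.
  by apply: divr_ge0; [apply: addr_ge0; exact: sqr_ge0 | apply/ltW/exprn_gt0].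
exists (fun w => \sum_(1 <= h < nF) Y h w); split.
- by move=> w; apply: sumr_ge0.
- under eq_bigr do rewrite mulr_sumr.
  rewrite exchange_big /=.
  apply: (@le_trans _ _ (\sum_(1 <= h < nF) beta / nF%:R)); last first.
    rewrite big_const_nat iter_addr addr0 -[X in X <= _]mulr_natl.
    rewrite mulrCA ger_pMr // ler_pdivrMr // mul1r ler_nat; exact: leq_subr.
  rewrite big_nat_cond [X in _ <= X]big_nat_cond.
  apply: ler_sum => h /andP[/andP[h0 hn] _].
  rewrite /Y; under eq_bigr do rewrite mulrA.
  rewrite -mulr_suml ler_pdivrMr ?exprn_gt0 //.
  apply: le_trans (HS n N v A m h h0 (kap_exp r2 _) _) _.
    rewrite -(@leq_pmul2r (b ^ J2)) ?expn_gt0 ?b_gt0 // -mulnA.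
    apply: leq_trans (_ : h * (r * b ^ (n + N)) <= _)%N; first by rewrite leq_mul2l rE orbT.
    by rewrite mulnA mulnC leq_mul2l hJ ?orbT.
  have E1 : beta / nF%:R * (e / 2 * m%:R) ^+ 2 = 2 * del * m%:R ^+ 2.
    by rewrite /del; field; rewrite gt_eqF.
  rewrite E1; have : T0%:R * m%:R <= del * m%:R * m%:R by rewrite ler_pM2r.
  by rewrite -mulrA -expr2; lra.
move=> w x wb Yw x0 Et d dr.
pose X : R := (v * b ^ N + w)%:R / b%:R ^+ (n + N).
have HX : small_weyl_sums nF (e / 2) (iota A m) (fun k => r%:R ^+ k * X).
  move=> h /andP[h0 hn]; rewrite size_iota.
  have Yh : Y h w < 1.
    apply: le_lt_trans Yw; rewrite (bigD1_seq h) ?mem_index_iota ?iota_uniq ?h0 //=.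
    by rewrite lerDl; apply: sumr_ge0.
  move: Yh; rewrite /Y -/X ltr_pdivrMr ?exprn_gt0 // mul1r => Yh.
  have sq (u t : R) : u ^+ 2 + t ^+ 2 < (e / 2 * m%:R) ^+ 2 -> `|u| <= e / 2 * m%:R.
    move=> h1; rewrite -(@ler_pXn2r _ 2) ?nnegrE ?(ltW em0) // real_normK ?num_real //.
    by have := sqr_ge0 t; lra.
  by split; apply: sq; [exact: Yh | rewrite addrC; exact: Yh].
have Xx : X <= x <= X + (b%:R ^+ (n + N))^-1.
  have y0 : 0 <= b%:R ^+ (n + N) * x by rewrite mulr_ge0 // ltW.
  have /andP[t1 t2] := truncn_itv y0; rewrite Et in t1 t2.
  rewrite /X -[X in _ <= _ + X]div1r -mulrDl ler_pdivrMr // ler_pdivlMr // (mulrC x) t1 /=.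
  by rewrite -(natrD R _ 1) addn1 ltW.
have Hw := small_weyl_sums_near bQ Xx _ HX.
have /HF HHF : small_weyl_sums nF e (iota A m) (fun k => r%:R ^+ k * x).
  apply: Hw => h k hn kE.
  have rk : r%:R ^+ k <= (r%:R ^+ (A + m) : R).
    by rewrite -!natrX ler_nat leq_exp2l // ltnW.
  have s1 : h%:R * r%:R ^+ k * b%:R ^+ J2 <= h%:R * r%:R * b%:R ^+ (n + N) :> R.
    rewrite -!mulrA; apply: ler_wpM2l => //.
    apply: (@le_trans _ _ (r%:R ^+ (A + m) * b%:R ^+ J2)).
      by apply: ler_wpM2r => //; rewrite exprn_ge0 // ltW.
    by rewrite -!natrX -!natrM ler_nat.
  have s2 : 4 * pi / e * (h%:R * r%:R) <= b%:R ^+ J2 :> R.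
    have hr1 : h%:R * r%:R <= nF%:R * r%:R :> R by rewrite ler_pM2r // ler_nat ltnW.
    apply: le_trans ZJ; rewrite /Z mulrC; apply: ler_pM => //; first exact: ltW.
    by lra.
  have bJ : 0 < (b%:R ^+ J2 : R) by rewrite exprn_gt0.
  rewrite -(ler_pM2r bJ).
  have s3 : 2 * pi * (h%:R * r%:R * b%:R ^+ (n + N)) <= e / 2 * b%:R ^+ J2 * b%:R ^+ (n + N).
    rewrite !mulrA ler_pM2r //.
    have : e / 2 * (4 * pi / e * (h%:R * r%:R)) <= e / 2 * b%:R ^+ J2.
      by apply: ler_wpM2l => //; lra.
    have -> : e / 2 * (4 * pi / e * (h%:R * r%:R)) = 2 * pi * h%:R * r%:R.
      by field; rewrite gt_eqF.
    by [].
  apply: le_trans (_ : 2 * pi * (h%:R * r%:R * b%:R ^+ (n + N)) <= _).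
    by rewrite -[X in X <= _]mulrA; apply: ler_wpM2l => //; rewrite mulr_ge0 // ltW.
  by rewrite [X in _ <= X]mulrAC.
have Hd := HHF x0 d dr.
rewrite -/k0 -/k1 (hits_cat r d x kA (leq_trans AE Ek)) (hits_cat r d x AE Ek).
have i1 := hits_le r d k0 A x; have i2 := hits_le r d E k1 x.
rewrite AmE in Hd.
have i3 : (hits r d k0 A x + hits r d E k1 x <= c)%N by rewrite /c; nlia.
have i4 : (hits r d k0 A x)%:R + (hits r d E k1 x)%:R <= (c%:R : R) by rewrite -natrD ler_nat.
have i5 : (m%:R : R) <= (k1 - k0)%:R by rewrite ler_nat /m; nlia.
have i6 : (r%:R^-1 + eps / 2) * m%:R <= (r%:R^-1 + eps / 2) * (k1 - k0)%:R.
  by apply: ler_wpM2l => //; rewrite addr_ge0 // ?invr_ge0 ltW.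
rewrite !natrD; lra.
Qed.

End Control.

(** * Powers of the base *)

Section Powers.
Variables (R : realType) (b : nat) (p : nat -> R).
Hypothesis b2 : (2 < b)%N.
Hypothesis p_gt0 : forall D, (D < b)%N -> 0 < p D.
Hypothesis sum_p : \sum_(0 <= D < b) p D = 1.
Variables (be K : nat).
Hypotheses (be2 : (1 < be)%N) (K0 : (0 < K)%N) (beK : (be ^ K = b)%N).

Let b_gt0 : (0 < b)%N. Proof. by nlia. Qed.
Let be0 : (0 < be)%N. Proof. by nlia. Qed.

Let G (d D : nat) : nat := (\sum_(0 <= c < K) (digit_at be c D == d))%N.

Definition subdigit_mass (d : nat) : R :=
  \sum_(0 <= c < K) \sum_(0 <= D < b | digit_at be c D == d) p D.

(** [digit_at] counts from the least significant digit and [dig] from the point onward, so the order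
    within a block is reversed. *)
Lemma dig_power (i c : nat) (x : R) : 0 <= x -> (c < K)%N ->
  dig be (i * K + c).+1 x = digit_at be (K - c.+1) (dig b i.+1 x).
Proof.
move=> x0 cK; rewrite {1}/dig.
have -> : Num.truncn (be%:R ^+ (i * K + c).+1 * x) =
          (Num.truncn (b%:R ^+ i.+1 * x) %/ be ^ (K - c.+1))%N.
  have -> : b%:R ^+ i.+1 * x = be%:R ^+ ((i * K + c).+1 + (K - c.+1)) * x.
    rewrite -beK natrX -exprM; congr (_ ^+ _ * _).
    by rewrite -addnS -addnA subnKC // mulnS mulnC addnC.
  by rewrite truncn_expr_divn.
rewrite -/(digit_at be (K - c.+1) _) /dig.
set T := Num.truncn _.
transitivity (digit_at be (K - c.+1) (T %/ b * be ^ K + T %% b)).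
  by rewrite beK -divn_eq.
rewrite digit_at_cat //.
  by rewrite ifT //; nlia.
by rewrite beK ltn_pmod.
Qed.

Lemma hits_blocks d n N (x : R) : 0 <= x ->
  hits be d (K * n) (K * (n + N)) x =
  (\sum_(0 <= D < b) G d D * \sum_(0 <= i < N) (dig b (n + i).+1 x == D))%N.
Proof.
move=> x0; rewrite /hits !(mulnC K) big_nat_block ?leq_addr //.
rewrite -{1}(add0n n) big_addn addKn.
under [RHS]eq_bigr do rewrite big_distrr /=.
rewrite [RHS]exchange_big /=; apply: eq_bigr => i _.
rewrite [RHS](bigD1_seq (dig b (n + i).+1 x)) ?mem_index_iota ?iota_uniq //=; last first.
  by rewrite /dig ltn_pmod.
rewrite eqxx muln1 [X in _ = (_ + X)%N]big1 ?addn0; last first.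
  by move=> D; rewrite eq_sym => /negbTE ->; rewrite muln0.
rewrite /G [RHS]big_nat_rev /= add0n big_nat_cond [RHS]big_nat_cond.
by apply: eq_bigr => c /andP[/andP[_ cK] _]; rewrite dig_power // (addnC i).
Qed.

Lemma G_le d D : (G d D <= K)%N.
Proof.
rewrite /G -[X in (_ <= X)%N]subn0 -[X in (_ <= X)%N]muln1 -sum_nat_const_nat.
by apply: leq_sum => c _; case: eqP.
Qed.

Lemma subdigit_massE d : subdigit_mass d = \sum_(0 <= D < b) (G d D)%:R * p D.
Proof.
rewrite /subdigit_mass (eq_bigr (fun c => \sum_(0 <= D < b) (digit_at be c D == d)%:R * p D)).
  rewrite exchange_big /=; apply: eq_bigr => D _.
  by rewrite -mulr_suml natr_sum.
move=> c _; rewrite big_mkcond; apply: eq_bigr => D _.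
by case: eqP => _; rewrite ?mul1r ?mul0r.
Qed.

(** Base-[be] counts are combinations of the [b] base-[b] counts with coefficients [G d D <= K],
    whence the tolerance [eps / (b * K)] for the latter. *)
Lemma controlled_hits (eps : R) : 0 < eps -> controlled b p (fun q n N x => forall d,
  `|(hits be d (K * n) (K * (n + N)) x)%:R - N%:R * subdigit_mass d| <= eps * N%:R).
Proof.
move=> e0; have bK : 0 < (b%:R * K%:R : R) by rewrite mulr_gt0 // ltr0n.
have e1 : 0 < eps / (b%:R * K%:R) by rewrite divr_gt0.
apply: controlled_impl (controlled_blocks b2 p_gt0 sum_p e1) _.
exists 0%N => q n N x _ _ _ _ x0 H d.
rewrite hits_blocks // subdigit_massE natr_sum mulr_sumr -sumrB.
apply: le_trans (ler_norm_sum _ _ _) _.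
apply: (@le_trans _ _ (\sum_(0 <= D < b) K%:R * (eps / (b%:R * K%:R) * N%:R))).
  rewrite big_nat_cond [X in _ <= X]big_nat_cond; apply: ler_sum => D /andP[/andP[_ Db] _].
  rewrite natrM mulrCA -mulrBr normrM; apply: ler_pM => //; last exact: H.
  by rewrite ger0_norm // ler_nat G_le.
rewrite big_const_nat iter_addr addr0 subn0 -[X in X <= _]mulr_natl.
apply: le_of_eq; field; rewrite !pnatr_eq0; apply/andP; split; nlia.
Qed.

Let kQ n N : kap be (b ^ (n + N)) = (K * (n + N))%N.
Proof. by rewrite -beK -expnM /kap up_expnK. Qed.

Let edge q n : (b ^ n <= 2 * b * q)%N -> (K * n <= kap be q + kap be (2 * b))%N.
Proof.
move=> H; rewrite addnC; apply: leq_trans (kapM be2 _ _).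
by apply: leq_trans (leq_kap be H); rewrite -beK -expnM /kap up_expnK.
Qed.

Let edge0 q n : (q <= b ^ n)%N -> (kap be q <= K * n)%N.
Proof. by move/(leq_kap be); rewrite -beK -expnM /kap up_expnK. Qed.

(** The stretch begins at scale [q], up to [c] digits before the depth [n] where the word starts; a
    long word absorbs these. *)
Lemma controlled_power (eps : R) : 0 < eps ->
  (forall d, (d < be)%N -> subdigit_mass d = K%:R / be%:R) ->
  controlled b p (fun q n N x => digits_le be eps q (b ^ (n + N)) x).
Proof.
move=> e0 Hd; have e20 : 0 < eps / 2 by rewrite divr_gt0.
apply: controlled_impl (controlled_hits e20) _.
pose c := kap be (2 * b); exists (Num.truncn (c%:R / (eps / 2))).+1.
move=> q n N x NN q0 qb bq x0 H d db; rewrite kQ.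
have h1 := edge bq; have h2 := edge0 qb; rewrite -/c in h1.
rewrite (@hits_cat _ _ _ (K * n)%N) //; last by rewrite leq_mul2l leq_addr orbT.
have := H d; rewrite Hd // ler_norml => /andP[_ h3].
have h4 : ((hits be d (kap be q) (K * n) x)%:R : R) <= c%:R.
  by rewrite ler_nat; apply: leq_trans (hits_le _ _ _ _ _) _; rewrite leq_subLR.
have cN : c%:R <= eps / 2 * N%:R :> R.
  by rewrite mulrC -ler_pdivrMr //; apply: le_trans (ltW (truncnS_gt _)) _; rewrite ler_nat.
have W : (K * N <= K * (n + N) - kap be q)%N by rewrite mulnDr; nlia.
have W1 : (N%:R : R) <= (K * (n + N) - kap be q)%:R.
  by rewrite ler_nat; apply: leq_trans W; rewrite leq_pmull.
have W2 : (K%:R * N%:R : R) <= (K * (n + N) - kap be q)%:R by rewrite -natrM ler_nat.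
have beR : 0 < (be%:R : R)^-1 by rewrite invr_gt0 ltr0n.
have W3 : be%:R^-1 * (K%:R * N%:R) <= be%:R^-1 * (K * (n + N) - kap be q)%:R :> R.
  by rewrite ler_pM2l.
have W4 : eps / 2 * N%:R <= eps / 2 * (K * (n + N) - kap be q)%:R by rewrite ler_pM2l.
have E : N%:R * (K%:R / be%:R) = be%:R^-1 * (K%:R * N%:R) :> R by ring.
by rewrite natrD; rewrite E in h3; lra.
Qed.

(** Half of the excess [2 * eta] is given up: [eta / 2] to the fluctuations and [eta / 2] to the
    digits before depth [n]. *)
Lemma controlled_bias (eta : R) (d : nat) : 0 < eta ->
  K%:R * (be%:R^-1 + 2 * eta) <= subdigit_mass d ->
  controlled b p (fun q n N x => (be%:R^-1 + eta) *
    (kap be (b ^ (n + N)) - kap be q)%:R <=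
     (hits be d (kap be q) (kap be (b ^ (n + N))) x)%:R).
Proof.
move=> e0 Hd; have e20 : 0 < eta / 2 by rewrite divr_gt0.
apply: controlled_impl (controlled_hits e20) _.
pose c := kap be (2 * b); exists (Num.truncn ((1 + eta) * c%:R / (eta / 2))).+1.
move=> q n N x NN q0 qb bq x0 H; rewrite kQ.
have h1 := edge bq; have h2 := edge0 qb; rewrite -/c in h1.
rewrite (@hits_cat _ _ _ (K * n)%N) //; last by rewrite leq_mul2l leq_addr orbT.
have := H d; rewrite ler_norml => /andP[h3 _].
have cN : (1 + eta) * c%:R <= eta / 2 * N%:R.
  rewrite mulrC (mulrC (eta / 2)) -ler_pdivrMr // (mulrC c%:R).
  by apply: le_trans (ltW (truncnS_gt _)) _; rewrite ler_nat.
have W : (K * (n + N) - kap be q <= K * N + c)%N by rewrite mulnDr; nlia.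
have W2 : (K * (n + N) - kap be q)%:R <= (K%:R * N%:R + c%:R : R).
  by rewrite -natrM -natrD ler_nat.
have beR : 0 < (be%:R : R)^-1 by rewrite invr_gt0 ltr0n.
have beR1 : (be%:R : R)^-1 <= 1 by rewrite invf_le1 ?ltr0n // ler1n.
have K1 : 1 <= (K%:R : R) by rewrite ler1n.
have h5 : (be%:R^-1 + eta) * (K * (n + N) - kap be q)%:R <= (be%:R^-1 + eta) * (K%:R * N%:R + c%:R).
  by rewrite ler_pM2l // addr_gt0.
have h6 : N%:R * (K%:R * (be%:R^-1 + 2 * eta)) <= N%:R * subdigit_mass d by rewrite ler_wpM2l.
have h7 : (be%:R^-1 + eta) * c%:R <= (1 + eta) * c%:R by rewrite ler_wpM2r // lerD2r.
have h8 : eta * N%:R <= eta * (K%:R * N%:R) by rewrite ler_pM2l // ler_peMl.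
apply: (le_trans h5); rewrite natrD.
have h9 : 0 <= (hits be d (kap be q) (K * n) x)%:R :> R by [].
lra.
Qed.

End Powers.

(** A node is the interval [[u / q, (u + 1) / q[]. It is narrowed to some [[v / b ^ n, (v + 1) / b ^
    n[], and its children are good words of length [N] appended to [v]. Exactly [K] of them are
    kept, for all [q] and [u], so that the branching is constant on each level. *)
Lemma controlled_children (R : realType) (b : nat) (p : nat -> R) (pm t : R)
  (P : nat -> nat -> nat -> R -> Prop) : (2 < b)%N ->
  (forall D, (D < b)%N -> 0 < p D <= pm) -> \sum_(0 <= D < b) p D = 1 ->
  0 < t -> pm * b%:R `^ t < 1 -> controlled b p P ->
  exists (B K : nat) (nxt : nat -> nat), forall q, (0 < q)%N ->
  [/\ (2 * q <= nxt q)%N, (nxt q <= B * q)%N, ((nxt q)%:R / q%:R) `^ t <= (K%:R : R) &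
   forall u : nat, exists ch : seq nat, [/\ uniq ch, size ch = K &
     forall u', u' \in ch -> [/\ (u * nxt q <= u' * q)%N, (u'.+1 * q < u.+1 * nxt q)%N &
       forall x, 0 <= x -> Num.truncn ((nxt q)%:R * x) = u' ->
       exists n N, nxt q = (b ^ (n + N))%N /\ P q n N x]]].
Proof.
move=> b2 Hp sum_p t0 pmb HP.
have b_gt0 : (0 < b)%N by nlia.
have b1 : (1 < b)%N by nlia.
have b0 : 0 < (b%:R : R) by rewrite ltr0n.
have p_gt0 D : (D < b)%N -> 0 < p D by move=> /Hp /andP[].
have p_le D : (D < b)%N -> p D <= pm by move=> /Hp /andP[].
have pm0 : 0 < pm by apply: lt_le_trans (p_gt0 0%N _) (p_le 0%N _).
have [N0 HN] := controlled_words b2 p_gt0 sum_p HP p_le.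
pose mu : R := b%:R `^ t; have mu0 : 0 < mu by apply: powR_gt0.
have E1 : (1 : R) `^ t = 1 by rewrite powR1.
have mu1 : 1 <= mu.
  by rewrite -[X in X <= _]E1; apply: ge0_ler_powR; rewrite ?nnegrE ?ler1n // ltW.
(* The ratio of scales is at most [2 * b * b ^ N], whose power [t] is the first summand times
   [mu ^ N]; the summand 1 absorbs the rounding in [K]. *)
pose c : R := (2 * b%:R) `^ t + 1.
have c0 : 0 < c by rewrite addr_gt0 // powR_gt0 // mulr_gt0.
have pm1 : 0 <= pm * mu < 1 by rewrite pmb andbT mulr_ge0 // ltW.
have c2 : 0 < (2 * c)^-1 by rewrite invr_gt0 mulr_gt0.
have [J HJ] := exists_expr_le pm1 c2.
pose N := maxn N0 J.
have HJN : (pm * mu) ^+ N <= (2 * c)^-1.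
  apply: le_trans HJ; have /andP[g0 g1] := pm1; apply: ler_wiXn2l => //; first exact: ltW.
  exact: leq_maxr.
pose K := Num.truncn ((2 * pm ^+ N)^-1).
(* An interval of length [1 / q] contains an aligned one of length [b ^ -n] once [b ^ n >= 2 * q];
   [v] below is the least admissible position. *)
pose nn q := kap b (2 * q).
exists (2 * b * b ^ N)%N, K, (fun q => (b ^ (nn q + N))%N) => q q0.
have nq : (2 * q <= b ^ nn q)%N by apply: kap_exp.
have nq' : (b ^ nn q <= 2 * b * q)%N.
  by rewrite -mulnA mulnCA; apply: exp_kap; rewrite // muln_gt0.
have qR : 0 < (q%:R : R) by rewrite ltr0n.
have N_pos : 0 < pm ^+ N by rewrite exprn_gt0.
split.
- by rewrite expnD; apply: leq_trans nq _; rewrite leq_pmulr // expn_gt0 b_gt0.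
- by rewrite expnD mulnAC leq_mul2r nq' orbT.
- apply: (@le_trans _ _ ((2 * b%:R * b%:R ^+ N) `^ t)).
    have h1 : (b ^ (nn q + N))%:R / q%:R <= 2 * b%:R * b%:R ^+ N :> R.
      by rewrite ler_pdivrMr // -natrX -!natrM ler_nat expnD mulnAC leq_mul2r nq' orbT.
    have h2 : 0 <= 2 * b%:R * b%:R ^+ N :> R by rewrite !mulr_ge0 // exprn_ge0.
    have h3 : 0 <= (b ^ (nn q + N))%:R / q%:R :> R by rewrite divr_ge0.
    by apply: ge0_ler_powR; rewrite ?nnegrE // ltW.
  have E : (2 * b%:R * b%:R ^+ N) `^ t = (2 * b%:R) `^ t * mu ^+ N.
    rewrite powRM ?mulr_ge0 ?exprn_ge0 //; congr (_ * _).
    by rewrite -powR_mulrn // -powRrM mulrC powRrM powR_mulrn // powR_ge0.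
  rewrite E.
  have h1 : c * mu ^+ N <= (2 * pm ^+ N)^-1.
    rewrite -[(2 * _)^-1]div1r ler_pdivlMr ?mulr_gt0 //.
    have -> : c * mu ^+ N * (2 * pm ^+ N) = 2 * c * (pm * mu) ^+ N by rewrite exprMn; ring.
    by rewrite mulrC -ler_pdivlMr ?mulr_gt0 // div1r.
  have h2 : 1 <= mu ^+ N by apply: exprn_ege1.
  have := truncnS_gt ((2 * pm ^+ N)^-1); rewrite -/K -(addn1 K) natrD => h3.
  move: h1; rewrite /c mulrDl mul1r; lra.
move=> u; pose v := ((u * b ^ nn q + q.-1) %/ q)%N.
have v1 : (u * b ^ nn q <= v * q)%N.
  by have := ltn_ceil (u * b ^ nn q + q.-1) q0; rewrite -/v; nlia.
have v2 : (v * q < u * b ^ nn q + q)%N.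
  by have := leq_divM (u * b ^ nn q + q.-1) q; rewrite -/v; nlia.
have qn : (q <= b ^ nn q)%N by nlia.
have [ws [ws_uniq ws_size Hws]] := HN N (nn q) q v (leq_maxl _ _) q0 qn nq'.
have Kws : (K <= size ws)%N.
  rewrite -(ler_nat R); apply: (@le_trans _ _ (2 * pm ^+ N)^-1).
    by rewrite truncn_le invr_ge0 ltW // mulr_gt0.
  by rewrite -[(2 * _)^-1]div1r ler_pdivrMr ?mulr_gt0 //; lra.
exists [seq (v * b ^ N + w)%N | w <- take K ws]; split.
- by rewrite map_inj_uniq ?take_uniq // => w w' /addnI.
- by rewrite size_map size_takel.
move=> u' /mapP[w wK ->]; have [wb Hw] := Hws w (mem_take wK).
have bN : (0 < b ^ N)%N by rewrite expn_gt0 b_gt0.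
split.
- by rewrite expnD mulnA mulnDl (mulnAC v); have := leq_mul v1 (leqnn (b ^ N)); nlia.
- rewrite expnD mulnA.
  apply: leq_ltn_trans (_ : (v.+1 * q) * b ^ N < _)%N.
    by rewrite mulnAC leq_mul2r mulSn -addnS addnC leq_add2r wb orbT.
  by rewrite ltn_mul2r bN /=; rewrite !mulSn; nlia.
move=> x x0; rewrite natrX => E; exists (nn q), N; split => //; exact: Hw.
Qed.

(** * Stages *)

Section Stage.
Variables (R : realType) (M : nat -> set nat).

(* Nothing is asked about a base [s ^ m] with [m] outside [M s], except for [s ^ m0], where the
   digit [d0] has to be too frequent. *)
Definition stage_good (s m0 i : nat) (c0 : R) (d0 q Q : nat) (x : R) : Prop :=
  (forall r, (1 < r <= i)%N ->
     (forall k, r <> (s ^ k)%N) \/ (exists2 m, M s m & r = (s ^ m)%N) ->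
     digits_le r (i.+1%:R^-1) q Q x) /\
  (~ M s m0 -> ((s ^ m0)%:R^-1 + c0) * (kap (s ^ m0) Q - kap (s ^ m0) q)%:R <=
     (hits (s ^ m0) d0 (kap (s ^ m0) q) (kap (s ^ m0) Q) x)%:R).

Definition stage_step (t : R) (P : nat -> nat -> R -> Prop) (B K : nat) (nxt : nat -> nat) : Prop :=
  forall q, (0 < q)%N ->
  [/\ (2 * q <= nxt q)%N, (nxt q <= B * q)%N, ((nxt q)%:R / q%:R) `^ t <= (K%:R : R) &
   forall u : nat, exists ch : seq nat, [/\ uniq ch, size ch = K &
     forall u', u' \in ch -> [/\ (u * nxt q <= u' * q)%N, (u'.+1 * q < u.+1 * nxt q)%N &
       forall x, 0 <= x -> Num.truncn ((nxt q)%:R * x) = u' -> P q (nxt q) x]]].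

Lemma controlled_true (b : nat) (p : nat -> R) (P : nat -> nat -> nat -> R -> Prop) :
  (forall q n N x, P q n N x) -> controlled b p P.
Proof.
move=> H beta b0; exists 0%N => N n q v _ _ _ _; exists (fun => 0); split => //.
by under eq_bigr do rewrite mulr0; rewrite big1 // ltW.
Qed.

(** [X] is room for the requirement on the favoured digit. A base [r <= i] is no power of [s], or a
    power with exponent in [M s], or another power of [s], about which nothing is asked. *)
Lemma stage_core (s m0 L i : nat) (a t : R) (X : nat -> nat -> R -> Prop) :
  non_perfect_powers s -> (0 < m0)%N -> (m0 %| L)%N -> (1 < L)%N -> 0 <= a < 1 ->
  0 < t < 1 -> 1 + a < 2 `^ (1 - t) ->
  (forall m, M s m -> (0 < m)%N -> (s ^ m <= i)%N -> (m %| L)%N /\ (~~ (m0 %| m)%N \/ a = 0)) ->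
  controlled (s ^ L) (block_law s m0 L a) (fun q n N x => X q ((s ^ L) ^ (n + N))%N x) ->
  exists B K nxt, stage_step t (fun q Q x =>
    (forall r, (1 < r <= i)%N ->
     (forall k, r <> (s ^ k)%N) \/ (exists2 m, M s m & r = (s ^ m)%N) ->
     digits_le r (i.+1%:R^-1) q Q x) /\ X q Q x) B K nxt.
Proof.
move=> ns m00 m0L L1 a01 /andP[t0 t1] at2 HM HX.
have s2 : (1 < s)%N by case: ns.
have L0 : (0 < L)%N by apply: ltnW.
have b2 : (2 < s ^ L)%N.
  apply: (@leq_trans (2 ^ 2)) => //; apply: leq_trans (_ : s ^ 2 <= _)%N.
    by rewrite leq_exp2r.
  by rewrite leq_exp2l.
have p_gt0 D : (D < s ^ L)%N -> 0 < block_law s m0 L a D.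
  by move=> _; exact: (block_law_gt0 s2 m00 L0 m0L).
have sp := sum_block_law s2 m00 L0 m0L a01.
have i0 : 0 < (i.+1%:R : R)^-1 by rewrite invr_gt0 ltr0n.
pose P (r q n N : nat) (x : R) : Prop := (1 < r)%N ->
     (forall k, r <> (s ^ k)%N) \/ (exists2 m, M s m & r = (s ^ m)%N) ->
     digits_le r (i.+1%:R^-1) q ((s ^ L) ^ (n + N)) x.
have HP r : (r < i.+1)%N -> controlled (s ^ L) (block_law s m0 L a) (P r).
  move=> ri; have [r1|r1] := boolP (1 < r)%N; last first.
    by apply: controlled_true => q n N x r1'; rewrite r1' in r1.
  have [nr|] := pselect (forall k, r <> (s ^ k)%N).
    apply: controlled_impl (controlled_independent b2 p_gt0 sp r1 _ i0) _.
      move=> h m h0; rewrite -expnM => E; have [k /nr] := non_perfect_power_root ns h0 E.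
      by [].
    by exists 0%N => q n N x _ _ _ _ _ H _ _.
  move=> nr; have [[m Mm rE]|nm] := pselect (exists2 m, M s m & r = (s ^ m)%N); last first.
    by apply: controlled_true => q n N x _ [].
  have m_gt0 : (0 < m)%N by case: m rE {Mm} r1 => // ->; rewrite expn0.
  have smi : (s ^ m <= i)%N by rewrite -rE.
  have [mL Hm] := HM m Mm m_gt0 smi.
  have K0 : (0 < L %/ m)%N by rewrite divn_gt0 // dvdn_leq.
  have beK : ((s ^ m) ^ (L %/ m) = s ^ L)%N by rewrite -expnM mulnC divnK.
  have be2 : (1 < s ^ m)%N by rewrite -rE.
  apply: controlled_impl (controlled_power b2 p_gt0 sp be2 K0 beK i0 _) _.
    move=> d dm; rewrite /subdigit_mass natrX.
    rewrite -(block_law_uniform s2 m00 L0 m0L a01 m_gt0 mL dm Hm).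
    by apply: eq_bigr => c _; apply: eq_bigl => D; rewrite /digit_at -expnM.
  by rewrite -rE; exists 0%N => q n N x _ _ _ _ _ H _ _.
have HH := controlled_and (controlled_forall HP) HX.
pose pm : R := (1 + a) / s%:R ^+ L.
have s0 : 0 < (s%:R : R) by rewrite ltr0n ltnW.
(* This is [1 + a < b ^ (1 - t)] for [b = s ^ L >= 2], so the admissible amplitude does not depend
   on [L]. *)
have pmb : pm * (s ^ L)%:R `^ t < 1.
  have bR : 0 < ((s ^ L)%:R : R) by rewrite ltr0n expn_gt0 ltnW.
  have bt : 0 < ((s ^ L)%:R : R) `^ t by apply: powR_gt0.
  have bt' : 2 `^ (1 - t) <= ((s ^ L)%:R : R) `^ (1 - t).
    by apply: ge0_ler_powR; rewrite ?nnegrE ?ler_nat ?(ltnW b2) // subr_ge0 ltW.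
  have bE : ((s ^ L)%:R : R) `^ (1 - t) * (s ^ L)%:R `^ t = s%:R ^+ L.
    rewrite -powRD; last by rewrite (gt_eqF bR) implybT.
    by rewrite subrK powRr1 ?natrX.
  rewrite /pm mulrAC ltr_pdivrMr ?exprn_gt0 // mul1r -bE ltr_pM2r //.
  exact: lt_le_trans at2 bt'.
have Hp D : (D < s ^ L)%N -> 0 < block_law s m0 L a D <= pm.
  move=> Db; rewrite p_gt0 //=; by have /andP[] := block_law_bounds s2 m00 L0 m0L a01 D.
have [B [K [nxt H]]] := controlled_children b2 Hp sp t0 pmb HH.
exists B, K, nxt => q q0; have [h1 h2 h3 h4] := H q q0; split => // u.
have [ch [ch1 ch2 ch3]] := h4 u; exists ch; split => // u' u'c.
have [g1 g2 g3] := ch3 u' u'c; split => // x x0 xE.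
have [n [N [-> [f1 f2]]]] := g3 x x0 xE; split => // r /andP[r1 ri].
by apply: f1.
Qed.

Lemma exists_amplitude (t : R) : t < 1 -> exists a : R, 0 < a < 1 /\ 1 + a < 2 `^ (1 - t).
Proof.
move=> t1; have h : 1 < 2 `^ (1 - t) :> R.
  have E1 : (1 : R) `^ (1 - t) = 1 by rewrite powR1.
  rewrite -[X in X < _]E1; apply: gt0_ltr_powR; rewrite ?nnegrE ?subr_gt0 //.
  by rewrite (ltr_nat R 1 2).
pose c := 2 `^ (1 - t) - 1 : R; have c0 : 0 < c by rewrite subr_gt0.
exists (Num.min 2^-1 (c / 2)); split.
  apply/andP; split; first by rewrite lt_min; apply/andP; split; lra.
  by apply: le_lt_trans (_ : 2^-1 < 1); [rewrite ge_min lexx | lra].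
apply: le_lt_trans (_ : 1 + c / 2 < _); first by rewrite lerD2l ge_min lexx orbT.
by move: c0; rewrite /c; lra.
Qed.

Lemma stage (s m0 : nat) (t : R) :
  (forall m d : nat, M s m -> (d %| m)%N -> M s d) ->
  (infinite_set (M s) -> M s = [set m : nat | (0 < m)%N]) ->
  non_perfect_powers s -> (0 < m0)%N -> 0 < t < 1 ->
  exists (c0 : R) (d0 : nat), [/\ 0 < c0, (d0 < s ^ m0)%N &
    forall i, exists B K nxt, stage_step t (stage_good s m0 i c0 d0) B K nxt].
Proof.
move=> M_div M_inf ns m00 t01; have s2 : (1 < s)%N by case: ns.
have /andP[t0 t1] := t01.
have [a [a01 at2]] := exists_amplitude t1.
have a01' : 0 <= a < 1 by case/andP: a01 => a0 a1; rewrite ltW.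
have [Mm0|nMm0] := pselect (M s m0).
  exists 1, 0%N; split; rewrite ?expn_gt0 ?(ltnW s2) // => i.
  have h01 : 0 <= (0 : R) < 1 by rewrite lexx ltr01.
  have h2 : 1 + 0 < 2 `^ (1 - t) by apply: lt_trans at2; rewrite ltrD2l; case/andP: a01.
  (* [M s] may be infinite here, but only the exponents with [s ^ m <= i] matter, and they divide
     this factorial. *)
  have L1 : (1 < i.+2`!)%N by rewrite factS; have := fact_gt0 i.+1; nia.
  have HL m : M s m -> (0 < m)%N -> (s ^ m <= i)%N ->
      (m %| i.+2`!)%N /\ (~~ (1 %| m)%N \/ 0 = 0 :> R).
    move=> Mm m_gt0 mi; split; last by right.
    apply: dvdn_fact; rewrite m_gt0 /=; apply: leq_trans (ltnW (ltn_expl m s2)) _.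
    by apply: leq_trans mi _; rewrite -addn2 leq_addr.
  have [B [K [nxt H]]] := @stage_core s 1 i.+2`! i 0 t (fun _ _ _ => True) ns isT (dvd1n _)
     L1 h01 t01 h2 HL (controlled_true _ _ (fun _ _ _ _ => I)).
  exists B, K, nxt => q q0; have [h3 h4 h5 h6] := H q q0; split => // u.
  have [ch [ch1 ch2 ch3]] := h6 u; exists ch; split => // u' u'c.
  have [g1 g2 g3] := ch3 u' u'c; split => // x x0 xE; split => //.
  by have [] := g3 x x0 xE.
have Mfin : finite_set (M s).
  by apply: contrapT => /M_inf E; apply: nMm0; rewrite E.
have [Bm HBm] : exists Bm, forall m, M s m -> (m <= Bm)%N.
  have /finite_seqP [sq ME] := Mfin; exists (\max_(k <- sq) k)%N => m; rewrite ME /= => mq.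
  exact: (@leq_bigmax_seq _ sq xpredT id m mq isT).
pose L := (2 * m0 * Bm`!)%N.
have m0L : (m0 %| L)%N by rewrite /L -mulnA dvdn_mull // dvdn_mulr.
have L1 : (1 < L)%N by rewrite /L; have := fact_gt0 Bm; nia.
have L0 : (0 < L)%N by apply: ltnW.
have LR : 0 < (L%:R : R) by rewrite ltr0n.
have HM i m : M s m -> (0 < m)%N -> (s ^ m <= i)%N -> (m %| L)%N /\ (~~ (m0 %| m)%N \/ a = 0).
  move=> Mm m_gt0 _; split.
    by rewrite /L dvdn_mull // dvdn_fact // m_gt0 HBm.
  by left; apply/negP => /(M_div _ _ Mm).
have [d0 d0m Hd0] := block_law_biased s2 m00 L0 m0L a01'.
have sR : 0 < ((s ^ m0)%:R : R) by rewrite ltr0n expn_gt0 ltnW.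
(* Half of the excess [a / L / s ^ m0] in [block_law_biased]; it does not involve [i]. *)
pose eta : R := a / (2 * L%:R * (s ^ m0)%:R).
have eta0 : 0 < eta by case/andP: a01 => a0 _; rewrite divr_gt0 // !mulr_gt0.
exists eta, d0; split => // i.
have b2 : (2 < s ^ L)%N.
  apply: (@leq_trans (2 ^ 2)) => //; apply: leq_trans (_ : s ^ 2 <= _)%N.
    by rewrite leq_exp2r.
  by rewrite leq_exp2l.
have p_gt0 D : (D < s ^ L)%N -> 0 < block_law s m0 L a D.
  by move=> _; exact: (block_law_gt0 s2 m00 L0 m0L).
have sp := sum_block_law s2 m00 L0 m0L a01'.
have K0 : (0 < L %/ m0)%N by rewrite divn_gt0 // dvdn_leq.
have beK : ((s ^ m0) ^ (L %/ m0) = s ^ L)%N by rewrite -expnM mulnC divnK.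
have be2 : (1 < s ^ m0)%N by rewrite -(exp1n m0) ltn_exp2r.
have Hm : (L %/ m0)%:R * ((s ^ m0)%:R^-1 + 2 * eta) <=
    subdigit_mass (s ^ L) (block_law s m0 L a) (s ^ m0) (L %/ m0) d0.
  apply: le_trans (le_trans Hd0 _).
    rewrite -natrX; apply: le_of_eq; congr (_ * _); rewrite /eta; field.
    by rewrite !gt_eqF.
  apply: le_of_eq; rewrite /subdigit_mass.
  by apply: eq_bigr => c _; apply: eq_bigl => D; rewrite /digit_at -expnM.
have HX := controlled_bias b2 p_gt0 sp be2 K0 beK eta0 Hm.
have [B [K [nxt H]]] := @stage_core s m0 L i a t
  (fun q Q x => ((s ^ m0)%:R^-1 + eta) * (kap (s ^ m0) Q - kap (s ^ m0) q)%:R <=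
     (hits (s ^ m0) d0 (kap (s ^ m0) q) (kap (s ^ m0) Q) x)%:R)
  ns m00 m0L L1 a01' t01 at2 (HM i) HX.
exists B, K, nxt => q q0; have [h3 h4 h5 h6] := H q q0; split => // u.
have [ch [ch1 ch2 ch3]] := h6 u; exists ch; split => // u' u'c.
have [g1 g2 g3] := ch3 u' u'c; split => // x x0 xE; split => //.
  by have [] := g3 x x0 xE.
by move=> _; have [] := g3 x x0 xE.
Qed.

End Stage.

(** * Hausdorff measure of trees *)

Lemma diameter_ge0 (R : realType) (U : set R) : (0 <= diameter U)%E.
Proof. by apply: ereal_sup_ubound; left. Qed.

Lemma diameter_ge (R : realType) (U : set R) (x y : R) : U x -> U y ->
  (`|x - y|%:E <= diameter U)%E.
Proof. by move=> Ux Uy; apply: ereal_sup_ubound; right; exists x => //; exists y. Qed.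

Lemma diameter_fin (R : realType) (U : set R) (d : R) : (diameter U <= d%:E)%E ->
  exists2 e : R, 0 <= e <= d & diameter U = e%:E.
Proof.
have := diameter_ge0 U; case: (diameter U) => [e| |] //.
by rewrite !lee_fin => h1 h2; exists e; rewrite ?h1.
Qed.

Section Tree.
Variables (R : realType) (q K : nat -> nat) (child : nat -> nat -> seq nat).
Hypotheses (q0 : q 0%N = 1%N) (q2 : forall j, (2 * q j <= q j.+1)%N).
Hypothesis child_uniq : forall j u, uniq (child j u).
Hypothesis child_size : forall j u, size (child j u) = K j.
Hypothesis child_in : forall j u u', u' \in child j u ->
  (u * q j.+1 <= u' * q j)%N /\ (u'.+1 * q j < u.+1 * q j.+1)%N.

Lemma q_gt j : (j < q j)%N.
Proof. by elim: j => [|j IH]; [rewrite q0 | have := q2 j; lia]. Qed.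

Lemma q_gt0 j : (0 < q j)%N.
Proof. by apply: leq_ltn_trans (q_gt j). Qed.

Let qR j : 0 < ((q j)%:R : R).
Proof. by rewrite ltr0n q_gt0. Qed.

Definition is_path (u : nat -> nat) : Prop :=
  u 0%N = 0%N /\ forall j, u j.+1 \in child j (u j).

(** The point is the supremum of the left ends. The right ends decrease strictly, which keeps it
    below each of them, as truncation requires. *)
Lemma path_point (u : nat -> nat) : is_path u ->
  exists2 x : R, 0 <= x & forall j, Num.truncn ((q j)%:R * x) = u j.
Proof.
move=> [u0 Hu]; pose a j : R := (u j)%:R / (q j)%:R; pose b j : R := (u j).+1%:R / (q j)%:R.
have aS j : a j <= a j.+1.
  have [h _] := child_in (Hu j).
  by rewrite /a ler_pdivrMr // mulrAC ler_pdivlMr // -!natrM ler_nat.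
have bS j : b j.+1 < b j.
  have [_ h] := child_in (Hu j).
  by rewrite /b ltr_pdivrMr // mulrAC ltr_pdivlMr // -!natrM ltr_nat.
have ab j : a j < b j by rewrite /a /b ltr_pM2r ?invr_gt0 // ltr_nat.
have aM j k : a j <= a (j + k)%N.
  by elim: k => [|k IH]; rewrite ?addn0 // addnS; apply: le_trans IH (aS _).
have bM j k : b (j + k)%N <= b j.
  by elim: k => [|k IH]; rewrite ?addn0 // addnS; apply: le_trans (ltW (bS _)) IH.
have aLb j k : a j <= b k.
  have := aM j k; have := ab (j + k)%N; have := bM k j; rewrite (addnC k j); lra.
have hs : has_sup (range a).
  by split; [exists (a 0%N); exists 0%N | exists (b 0%N) => _ [j _ <-]].
have ax j : a j <= sup (range a) by apply: sup_upper_bound => //; exists j.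
have xb j : sup (range a) <= b j.
  by apply: ge_sup; [exists (a 0%N); exists 0%N | move=> _ [k _ <-]].
have x0 : 0 <= sup (range a).
  by apply: le_trans (ax 0%N); rewrite /a u0 mul0r.
exists (sup (range a)) => // j; apply: truncn_def; apply/andP; split.
  by rewrite -ler_pdivrMl // mulrC; exact: ax.
by rewrite -ltr_pdivlMl // mulrC; exact: le_lt_trans (xb j.+1) (bS j).
Qed.

(* The branch of [y] in [[0, 1[] reads the digits of [y] in the mixed radix [K]. *)
Fixpoint node (j c : nat) : nat :=
  if j is j'.+1 then nth 0%N (child j' (node j' (c %/ K j'))) (c %% K j') else 0%N.

Definition width (j : nat) : nat := (\prod_(0 <= i < j) K i)%N.

Hypothesis K_gt0 : forall j, (0 < K j)%N.

Lemma width_gt0 j : (0 < width j)%N.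
Proof. by rewrite /width; elim/big_ind: _ => // x y; rewrite muln_gt0 => -> ->. Qed.

Lemma widthS j : width j.+1 = (width j * K j)%N.
Proof. by rewrite /width big_nat_recr. Qed.

Let wR j : 0 < ((width j)%:R : R).
Proof. by rewrite ltr0n width_gt0. Qed.

Lemma node_child j c : node j.+1 c \in child j (node j (c %/ K j)).
Proof. by rewrite /= mem_nth // child_size ltn_pmod. Qed.

Lemma child_parent j u v w : w \in child j u -> w \in child j v -> u = v.
Proof.
move=> /child_in [h1 h2] /child_in [h3 h4]; have := q_gt0 j; have := q_gt0 j.+1.
have h5 : (u * q j.+1 < v.+1 * q j.+1)%N by lia.
have h6 : (v * q j.+1 < u.+1 * q j.+1)%N by lia.
by move: h5 h6; rewrite !ltn_mul2r !ltnS => /andP[_ ?] /andP[_ ?]; lia.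
Qed.

Lemma node_inj j c c' : (c < width j)%N -> (c' < width j)%N ->
  node j c = node j c' -> c = c'.
Proof.
elim: j c c' => [|j IH] c c'; first by rewrite /width big_geq // !ltnS !leqn0 => /eqP -> /eqP ->.
rewrite widthS => h h' E.
have E1 : node j (c %/ K j) = node j (c' %/ K j).
  by apply: child_parent (node_child j c) _; rewrite E; exact: node_child.
have E2 : (c %/ K j = c' %/ K j)%N by apply: IH E1; rewrite ltn_divLR // -?widthS.
have E3 : (c %% K j = c' %% K j)%N.
  move: E => /=; rewrite E1 => /eqP; rewrite nth_uniq ?child_size ?ltn_pmod //.
  by move/eqP.
by rewrite (divn_eq c (K j)) (divn_eq c' (K j)) E2 E3.
Qed.

Definition index_of (y : R) (j : nat) : nat := Num.truncn ((width j)%:R * y).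

Lemma index_of_lt y j : 0 <= y < 1 -> (index_of y j < width j)%N.
Proof.
move=> /andP[y0 y1]; rewrite /index_of truncn_lt_nat ?mulr_ge0 //.
by rewrite gtr_pMr.
Qed.

Lemma node_path y : 0 <= y < 1 -> is_path (fun j => node j (index_of y j)).
Proof.
move=> /andP[y0 y1]; split => // j.
have -> : index_of y j = (index_of y j.+1 %/ K j)%N.
  have E : (width j.+1)%:R * y = (K j)%:R * ((width j)%:R * y).
    by rewrite widthS natrM; ring.
  rewrite /index_of E truncn_divn //.
  by rewrite mulr_ge0.
exact: node_child.
Qed.

Lemma node_cylinder j u : exists2 I : set R, measurable I /\
  (lebesgue_measure I <= ((width j)%:R^-1)%:E)%E &
  forall y, 0 <= y < 1 -> node j (index_of y j) = u -> I y.
Proof.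
have [[c [cw cu]]|no] := pselect (exists c, (c < width j)%N /\ node j c = u); last first.
  exists set0; first by rewrite measure0 lee_fin invr_ge0.
  by move=> y y01 E; case: no; exists (index_of y j); rewrite index_of_lt.
exists (`[c%:R / (width j)%:R, c.+1%:R / (width j)%:R]%classic).
  split; first exact: measurable_itv.
  rewrite lebesgue_measure_itv /= lte_fin ltr_pM2r ?invr_gt0 // ltr_nat ltnSn.
  by rewrite -EFinD lee_fin -mulrBl -natrB // subSnn div1r.
move=> y y01 E; have {E}E : index_of y j = c.
  by apply: (@node_inj j) => //; [exact: index_of_lt | rewrite E].
have /andP[y0 y1] := y01.
have /truncn_itv /andP[h1 h2] : 0 <= (width j)%:R * y by rewrite mulr_ge0.
rewrite /= in_itv /= ler_pdivrMr // ler_pdivlMr // (mulrC y).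
by move: h1 h2; rewrite -/(index_of y j) E => -> /ltW ->.
Qed.

Lemma truncn_near (a b : R) : `|a - b| <= 1 ->
  (Num.truncn a <= (Num.truncn b).+1)%N.
Proof.
move=> h; have [b0|b0] := lerP 0 b.
  have /andP[h1 h2] := truncn_itv b0.
  rewrite truncn_le_nat -addn1 natrD.
  by move: h; rewrite ler_norml => /andP[_ h3]; lra.
apply: (@leq_trans 1); last by [].
by rewrite truncn_le_nat; move: h; rewrite ler_norml => /andP[_ h3]; lra.
Qed.

Variables (A : set R).
Hypothesis A_path : forall u x, is_path u -> 0 <= x ->
  (forall j, Num.truncn ((q j)%:R * x) = u j) -> A x.

(* [U] meets at most three consecutive intervals of length [1 / q j]. *)
Lemma cover_parameters (pt : R -> R) (U : set R) (j : nat) :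
  (forall y, 0 <= y < 1 -> 0 <= pt y /\
     forall i, Num.truncn ((q i)%:R * pt y) = node i (index_of y i)) ->
  (diameter U <= ((q j)%:R^-1)%:E)%E ->
  exists2 W : set R, measurable W /\ (lebesgue_measure W <= (3 / (width j)%:R)%:E)%E &
    forall y, 0 <= y < 1 -> U (pt y) -> W y.
Proof.
move=> Hpt dU; have [[z Uz]|U0] := pselect (exists z, U z); last first.
  exists set0; first by rewrite measure0 lee_fin divr_ge0.
  by move=> y _ Uy; case: U0; exists (pt y).
pose a := Num.truncn ((q j)%:R * z).
have [I1 [m1 l1] H1] := node_cylinder j a.-1.
have [I2 [m2 l2] H2] := node_cylinder j a.
have [I3 [m3 l3] H3] := node_cylinder j a.+1.
exists (I1 `|` I2 `|` I3).
  have m12 : measurable (I1 `|` I2) by apply: measurableU.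
  split; first exact: measurableU.
  apply: le_trans (measureU2 _ _ _) _ => //.
  have -> : (3 / (width j)%:R)%:E = ((width j)%:R^-1)%:E + ((width j)%:R^-1)%:E + ((width j)%:R^-1)%:E :> \bar R.
    by rewrite -!EFinD; congr EFin; field; rewrite gt_eqF.
  apply: leeD => //; apply: le_trans (measureU2 _ _ _) _ => //.
  exact: leeD.
move=> y y01 Uy; have [py Hy] := Hpt y y01.
have near : `|(q j)%:R * pt y - (q j)%:R * z| <= 1.
  rewrite -mulrBr normrM ger0_norm // -ler_pdivlMl // mulr1 -lee_fin.
  exact: le_trans (diameter_ge Uy Uz) dU.
have near' : `|(q j)%:R * z - (q j)%:R * pt y| <= 1 by rewrite distrC.
have := truncn_near near; have := truncn_near near'; rewrite Hy -/a => h1 h2.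
have : node j (index_of y j) = a.-1 \/ node j (index_of y j) = a \/ node j (index_of y j) = a.+1.
  by clear -h1 h2; lia.
by case=> [/(H1 y y01)|[/(H2 y y01)|/(H3 y y01)]] h; [left; left|left; right|right].
Qed.

Variables (t C : R).
Hypotheses (t_gt0 : 0 < t) (C_gt0 : 0 < C).
Hypothesis growth : forall j, (q j.+1)%:R `^ t <= C * (width j)%:R.

Lemma width_unbounded (e : R) : 0 < e -> exists j, 3 / (width j)%:R <= e.
Proof.
move=> e0; pose y := (3 * C / e) `^ (t^-1); pose j := (Num.truncn y).+1.
exists j; have yj : y <= (q j.+1)%:R.
  apply: le_trans (ltW (truncnS_gt y)) _; rewrite ler_nat -/j.
  by apply: leq_trans (ltnW (q_gt j)) _; have := q2 j; clear; lia.
have b0 : 0 <= 3 * C / e by rewrite divr_ge0 ?mulr_ge0 // ltW.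
have h : 3 * C / e <= C * (width j)%:R.
  apply: le_trans (growth j).
  have -> : 3 * C / e = y `^ t by rewrite /y -powRrM mulVf ?powRr1 // gt_eqF.
  by apply: ge0_ler_powR; rewrite ?nnegrE ?powR_ge0 // ltW.
rewrite ler_pdivrMr // mulrC -ler_pdivrMr //.
rewrite -(ler_pM2l C_gt0); apply: le_trans h; rewrite mulrA (mulrC C).
exact: lexx.
Qed.

(** A positive diameter lies between [1 / q j.+1] and [1 / q j] for some [j], which is why [growth]
    compares [q j.+1] with [width j]. A set of diameter 0 can have weight 0 and is charged to [e] at
    a deep level. *)
Lemma cover_level (s e : R) (U : set R) : 0 <= s <= t -> 0 < e ->
  (diameter U <= 1%:E)%E -> exists2 j, (diameter U <= ((q j)%:R^-1)%:E)%E &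
   ((3 / (width j)%:R)%:E <= (3 * C)%:E * hausdorff_weight s U + e%:E)%E \/ U = set0.
Proof.
move=> /andP[s0 st] e0 /diameter_fin [d /andP[d0 d1] dE].
have w0 : (0 <= hausdorff_weight s U)%E.
  by rewrite /hausdorff_weight; case: ifP => // _; exact: poweR_ge0.
have C3 : 0 <= 3 * C by rewrite mulr_ge0 // ltW.
have [d00|dn0] := eqVneq d 0.
  have [j Hj] := width_unbounded e0; exists j; first by rewrite dE d00 lee_fin invr_ge0.
  left; apply: (@le_trans _ _ e%:E); first by rewrite lee_fin.
  by rewrite leeDr // mule_ge0.
have dp : 0 < d by rewrite lt_neqAle eq_sym dn0.
have exj : exists j, (1 < (q j)%:R * d)%R.
  exists (Num.truncn d^-1).+1; rewrite -ltr_pdivrMr // div1r.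
  by apply: lt_trans (truncnS_gt _) _; rewrite ltr_nat; exact: q_gt.
case: (ex_minnP exj) => -[|j]; first by rewrite q0 mul1r ltNge d1.
move=> hj minj; exists j.
  rewrite dE lee_fin -[X in _ <= X]div1r ler_pdivlMr // mulrC leNgt.
  by apply/negP => /minj; rewrite ltnn.
have [->|Un0] := eqVneq U set0; [by right | left].
rewrite /hausdorff_weight (negbTE Un0) dE poweR_EFin -EFinM -EFinD lee_fin.
apply: (@le_trans _ _ (3 * C * d `^ s)); last by rewrite lerDl ltW.
have ds : d `^ t <= d `^ s by apply: ger_powR; rewrite ?dp.
apply: (@le_trans _ _ (3 * C * d `^ t)); last by apply: ler_wpM2l.
rewrite ler_pdivrMr //.
have -> : 3 * C * d `^ t * (width j)%:R = 3 * (C * (width j)%:R * d `^ t) by ring.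
rewrite -[X in X <= _]mulr1; apply: ler_wpM2l => //.
have h : 1 <= ((q j.+1)%:R * d) `^ t.
  have E1 : (1 : R) `^ t = 1 by rewrite powR1.
  rewrite -[X in X <= _]E1; apply: ge0_ler_powR; rewrite ?nnegrE ?mulr_ge0 ?(ltW t_gt0) //.
  exact: ltW.
rewrite powRM // in h; apply: le_trans h _.
by apply: ler_wpM2r; rewrite ?powR_ge0.
Qed.

(** A mass distribution argument on parameters: a cover of [A] of small weight would yield a cover
    of [[0, 1[] of measure below 1. *)
Lemma tree_hausdorff (s : R) : 0 <= s <= t -> hausdorff_measure s A <> 0%E.
Proof.
move=> s0t H0; have C3 : 0 < 3 * C by rewrite mulr_gt0.
(* The weights then contribute at most [1 / 4], and the errors [2^-1 / 2 ^ (i + 1)] sum to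
   [1 / 2]. *)
pose e : R := (4 * (3 * C))^-1; have e0 : 0 < e by rewrite invr_gt0 mulr_gt0.
have /ereal_inf_lt [_ [U [AU Ud] <-] sumU] : (hausdorff_premeasure s 1 A < e%:E)%E.
  apply: (@le_lt_trans _ _ 0%E); last by rewrite lte_fin.
  by rewrite -H0; apply: ereal_sup_ubound; exists 1 => //=.
have w0 i : (0 <= hausdorff_weight s (U i))%E.
  by rewrite /hausdorff_weight; case: ifP => // _; exact: poweR_ge0.
have /choice [pt Hpt] : forall y : R, exists x : R, 0 <= y < 1 -> 0 <= x /\
     forall i, Num.truncn ((q i)%:R * x) = node i (index_of y i).
  move=> y; have [y01|ny] := boolP (0 <= y < 1); last by exists 0.
  by have [x x0 Hx] := path_point (node_path y01); exists x.
have /choice [W HW] : forall i, exists W : set R, [/\ measurable W,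
    (lebesgue_measure W <= (3 * C)%:E * hausdorff_weight s (U i) + (2^-1 / (2 ^ i.+1)%:R)%:E)%E &
    forall y, 0 <= y < 1 -> U i (pt y) -> W y].
  move=> i; have e1 : 0 < 2^-1 / (2 ^ i.+1)%:R :> R by rewrite divr_gt0 // ltr0n expn_gt0.
  have [j dj [Hj|U0]] := cover_level s0t e1 (Ud i); last first.
    exists set0; split => //; last by rewrite U0.
    rewrite measure0; apply: adde_ge0; last by rewrite lee_fin ltW.
    by apply: mule_ge0 => //; rewrite lee_fin ltW.
  by have [W [mW lW] HW] := cover_parameters Hpt dj; exists W; split => //; exact: le_trans lW Hj.
have sub : `[0%R, 1%R[ `<=` \bigcup_i W i.
  move=> y /=; rewrite in_itv /= => y01; have [py Hy] := Hpt y y01.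
  have Apt : A (pt y) by apply: A_path (node_path y01) py Hy.
  by have [i _ Ui] := AU _ Apt; exists i => //; have [_ _] := HW i; apply.
have mW i : measurable (W i) by have [] := HW i.
have L := measure_sigma_subadditive (@lebesgue_measure R) mW (measurable_itv _) sub.
have E : lebesgue_measure (`[0%R, 1%R[%classic : set R) = 1%E.
  by rewrite lebesgue_measure_itv /= lte_fin ltr01 oppr0 adde0.
have {L} : (1 <= \sum_(0 <= i <oo) lebesgue_measure (W i))%E by rewrite -E; exact: L.
apply/negP; rewrite -ltNge.
apply: (@le_lt_trans _ _ (\sum_(0 <= i <oo) ((3 * C)%:E * hausdorff_weight s (U i) + (2^-1 / (2 ^ i.+1)%:R)%:E))%E).
  by apply: lee_nneseries => // i _; have [] := HW i.
apply: le_lt_trans (epsilon_trick _ _ _) _ => //.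
  by move=> i; rewrite mule_ge0 ?lee_fin // ltW.
rewrite nneseriesZl //.
apply: (@lt_trans _ _ ((3 * C)%:E * e%:E + 2^-1%:E)%E).
  by apply: lte_leD => //; rewrite lte_pmul2l // lte_fin.
rewrite -EFinM -EFinD lte_fin /e.
have -> : 3 * C * (4 * (3 * C))^-1 = 4^-1 :> R by field; rewrite gt_eqF.
lra.
Qed.

End Tree.

(** * The schedule of stages *)

Section Schedule.
Variables (B : nat -> nat) (nxt : nat -> nat -> nat).
Hypothesis nxt2 : forall i q, (0 < q)%N -> (2 * q <= nxt i q)%N.
Hypothesis nxtB : forall i q, (0 < q)%N -> (nxt i q <= B i * q)%N.

(* A state consists of the current stage, the scale at which it began, and the current scale;
   a stage lasts until its scale dwarfs both its beginning and one step of the next stage. *)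
Fixpoint state (j : nat) : nat * nat * nat :=
  if j is j'.+1 then
    let: (i, qs, q) := state j' in
    if (B i.+1 ^ i.+1 <= nxt i q)%N && (qs ^ i.+1 <= nxt i q)%N
    then (i.+1, nxt i q, nxt i q) else (i, qs, nxt i q)
  else (0%N, 1%N, 1%N).

Definition stage_of j := (state j).1.1.
Definition scale j := (state j).2.

Lemma scale0 : scale 0 = 1%N. Proof. by []. Qed.

Lemma scaleS j : scale j.+1 = nxt (stage_of j) (scale j).
Proof. by rewrite /scale /stage_of /=; case: (state j) => [[i qs] q] /=; case: ifP. Qed.

Lemma scale_gt0 j : (0 < scale j)%N.
Proof. by elim: j => // j IH; rewrite scaleS; apply: leq_trans (nxt2 _ IH); rewrite muln_gt0. Qed.

Lemma scale2 j : (2 * scale j <= scale j.+1)%N.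
Proof. by rewrite scaleS; exact/nxt2/scale_gt0. Qed.

Lemma scale_step j : (scale j.+1 <= B (stage_of j) * scale j)%N.
Proof. by rewrite scaleS; exact/nxtB/scale_gt0. Qed.

Lemma leq_scale j k : (j <= k)%N -> (scale j <= scale k)%N.
Proof.
move/subnK <-; elim: (k - j)%N => // d IH; rewrite addSn; apply: leq_trans IH _.
by apply: leq_trans (scale2 _); rewrite leq_pmull.
Qed.

Lemma scale_gt j : (j < scale j)%N.
Proof. by elim: j => // j IH; have := scale2 j; lia. Qed.

Lemma stage_ofS j : stage_of j.+1 = stage_of j \/ stage_of j.+1 = (stage_of j).+1.
Proof.
by rewrite /stage_of /=; case: (state j) => [[i qs] q] /=; case: ifP => _; [right | left].
Qed.

Lemma stage_of_le j : (stage_of j <= j)%N.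
Proof. by elim: j => // j IH; case: (stage_ofS j) => ->; lia. Qed.

Lemma leq_stage_of j k : (j <= k)%N -> (stage_of j <= stage_of k)%N.
Proof.
move/subnK <-; elim: (k - j)%N => // d IH; rewrite addSn; apply: leq_trans IH _.
by case: (stage_ofS (d + j)) => ->.
Qed.

(** The threshold passed on entering a stage stays passed, as scales increase. With [scale_step], a
    step of stage [i > 0] from [q] multiplies the scale by at most [q ^ (1 / i)]. *)
Lemma step_small j : (B (stage_of j) ^ stage_of j <= scale j)%N.
Proof.
elim: j => [//|j IH]; have := scale2 j; rewrite scaleS.
move: IH; rewrite /stage_of /scale /=; case: (state j) => [[i qs] q] /= IH h.
by case: ifP => [/andP[]|_] //=; apply: leq_trans IH _; lia.
Qed.

Lemma stage_interval i : exists js je, [/\ (js < je)%N, (scale js ^ i.+1 <= scale je)%N,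
  state je = (i.+1, scale je, scale je) & forall j, (js <= j < je)%N -> stage_of j = i].
Proof.
suff next k js : state js = (k, scale js, scale js) ->
    exists je, [/\ (js < je)%N, (scale js ^ k.+1 <= scale je)%N,
      state je = (k.+1, scale je, scale je) & forall j, (js <= j < je)%N -> stage_of j = k].
  have start : exists js, state js = (i, scale js, scale js).
    elim: i => [|i [js Ejs]]; first by exists 0%N.
    by have [je [_ _ Eje _]] := next i js Ejs; exists je.
  by have [js /next[je He]] := start; exists js, je.
move=> Ejs; pose T := maxn (B k.+1 ^ k.+1) (scale js ^ k.+1).
(* Either the stage ends, or after [d] steps it still runs with scale below [T]; the latter fails
   for [d = T + 1] because [scale j > j]. *)
have main d : (exists je, [/\ (js < je)%N, (scale js ^ k.+1 <= scale je)%N,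
      state je = (k.+1, scale je, scale je) & forall j, (js <= j < je)%N -> stage_of j = k]) \/
    [/\ d = 0%N \/ (scale (js + d) < T)%N, state (js + d) = (k, scale js, scale (js + d)) &
      forall j, (js <= j <= js + d)%N -> stage_of j = k].
  elim: d => [|d [H|[_ E Hj]]]; [right | by left | ].
    rewrite addn0; split => //; first by left.
    by move=> j /anti_leq <-; rewrite /stage_of Ejs.
  have Es : stage_of (js + d) = k by apply: Hj; rewrite leq_addr leqnn.
  have En : scale (js + d).+1 = nxt k (scale (js + d)) by rewrite scaleS Es.
  have [cond|ncond] := boolP (T <= scale (js + d).+1)%N.
    left; exists (js + d).+1; move: (cond); rewrite geq_max => /andP[c1 c2]; split => //.
    - by rewrite ltnS leq_addr.
    - by rewrite /= E -En c1 c2.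
  right; rewrite addnS; split.
  - by right; rewrite ltnNge.
  - rewrite /= E -En; case: ifP => // /andP[c1 c2]; move/negP: ncond; case.
    by rewrite geq_max c1.
  move=> j /andP[j1 j2]; move: j2; rewrite leq_eqVlt => /predU1P[->|]; last first.
    by rewrite ltnS => j2; apply: Hj; rewrite j1.
  rewrite /stage_of /= E -En; case: ifP => // /andP[c1 c2]; move/negP: ncond; case.
  by rewrite geq_max c1.
have [//|[h _ _]] := main T.+1; case: h => // h.
by have := scale_gt (js + T.+1); lia.
Qed.

Lemma stage_of_unbounded i : exists j, forall k, (j <= k)%N -> (i <= stage_of k)%N.
Proof.
have [_ [je [_ _ E _]]] := stage_interval i; exists je => k jk.
by apply: leq_trans (leq_stage_of jk); rewrite /stage_of E.
Qed.

Variable R : realType.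

(** * Digit frequencies along the schedule *)

Section Frequencies.
Variables (r : nat) (x : R).
Hypothesis r2 : (1 < r)%N.

Let ka j := kap r (scale j).

Lemma ka_le j k : (j <= k)%N -> (ka j <= ka k)%N.
Proof. by move=> jk; apply/leq_kap/leq_scale. Qed.

Lemma ka_unbounded n : exists j, (n < ka j)%N.
Proof.
exists (r ^ n)%N; rewrite /ka ltnNge; apply/negP => h.
have := kap_exp r2 (scale (r ^ n)); have := scale_gt (r ^ n).
have : (r ^ kap r (scale (r ^ n)) <= r ^ n)%N by rewrite leq_exp2l.
lia.
Qed.

(* This compares [r ^ kap r q <= r * q] with [Q <= r ^ kap r Q]. *)
Lemma kap_pow_le e q Q : (0 < q)%N -> (q ^ e <= Q)%N -> (e * kap r q <= e + kap r Q)%N.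
Proof.
move=> q0 h; rewrite -(leq_exp2l _ _ r2) expnD mulnC expnM.
apply: leq_trans (_ : (r * q) ^ e <= _)%N.
  case: e {h} => [|e]; first by rewrite !expn0.
  by rewrite leq_exp2r // exp_kap.
by rewrite expnMn leq_mul2l; apply/orP; right; apply: leq_trans h (kap_exp r2 _).
Qed.

Lemma ka_step j : (stage_of j * (ka j.+1 - ka j) <= stage_of j + ka j)%N.
Proof.
have B0 : (0 < B (stage_of j))%N.
  have := scale_step j; have := scale_gt0 j.+1; case: (B _) => //; rewrite mul0n; lia.
apply: leq_trans (kap_pow_le B0 (step_small j)).
rewrite leq_mul2l; apply/orP; right; rewrite leq_subLR addnC.
by apply: leq_trans (kapM r2 _ _); apply/leq_kap/scale_step.
Qed.

(** At the ends of steps the bound follows by adding up the steps after [j1]; the digits before [j1]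
    are negligible. An arbitrary [n] is compared with the end of its step, at most [1 + n / I0]
    digits further on by [ka_step]. *)
Lemma hits_upper : (exists j0, forall j, (j0 <= j)%N ->
    digits_le r ((stage_of j).+1%:R^-1 : R) (scale j) (scale j.+1) x) ->
  forall eps : R, 0 < eps -> exists n0, forall n, (n0 <= n)%N ->
    forall d, (d < r)%N -> (hits r d 0 n x)%:R <= (r%:R^-1 + eps) * n%:R.
Proof.
move=> [j0 Hj0] eps e0.
pose y : R := 4 * (1 + eps) / eps; pose I0 := (Num.truncn y).+1.
have Iy : y < I0%:R by exact: truncnS_gt.
have I0R : 0 < (I0%:R : R) by rewrite ltr0n.
have [j2 Hj2] := stage_of_unbounded I0; pose j1 := maxn j0 j2.
have rI : 0 < (r%:R : R)^-1 <= 1.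
  by rewrite invr_gt0 ltr0n ltnW //= invf_le1 ?ltr0n ?ler1n ltnW.
have /andP[rI0 rI1] := rI.
have Ie : (I0%:R : R)^-1 <= eps / 4.
  rewrite -[eps / 4]invf_div lef_pV2 ?posrE ?divr_gt0 //.
  by apply: le_trans (ltW Iy); rewrite /y ler_pM2r ?invr_gt0 //; lra.
have Ie2 : (1 + eps) / I0%:R <= eps / 4.
  have -> : eps / 4 = (1 + eps) / y by rewrite /y; field; rewrite !gt_eqF //; lra.
  rewrite ler_pM2l; last by lra.
  by rewrite lef_pV2 ?posrE ?ltW // divr_gt0 // mulr_gt0 //; lra.
have claim d j : (d < r)%N -> (j1 <= j)%N ->
    (hits r d 0 (ka j) x)%:R <= (ka j1)%:R + (r%:R^-1 + eps / 4) * (ka j)%:R.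
  move=> dr; elim: j => [|j IH].
    rewrite leqn0 => /eqP ->; have := hits_le r d 0 (ka 0) x; rewrite subn0 => h.
    apply: (@le_trans _ _ (ka 0)%:R); first by rewrite ler_nat.
    by rewrite lerDl mulr_ge0 // addr_ge0 ?divr_ge0 // ltW.
  rewrite leq_eqVlt => /predU1P[<-|].
    have := hits_le r d 0 (ka j1) x; rewrite subn0 => h.
    apply: (@le_trans _ _ (ka j1)%:R); first by rewrite ler_nat.
    by rewrite lerDl mulr_ge0 // addr_ge0 ?divr_ge0 // ltW.
  rewrite ltnS => jj; have {}IH := IH jj.
  have kk : (ka j <= ka j.+1)%N by apply: ka_le.
  rewrite (hits_cat r d x (leq0n _) kk) natrD.
  have := Hj0 j (leq_trans (leq_maxl _ _) jj) d dr; rewrite -/(ka _) -/(ka _).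
  have ii : ((stage_of j).+1%:R : R)^-1 <= eps / 4.
    apply: le_trans Ie; rewrite lef_pV2 ?posrE ?ltr0n // ler_nat.
    by apply: leqW; apply: Hj2; apply: leq_trans jj; exact: leq_maxr.
  rewrite natrB // => h.
  have kkR : 0 <= (ka j.+1)%:R - (ka j)%:R :> R by rewrite subr_ge0 ler_nat.
  have hh : (r%:R^-1 + (stage_of j).+1%:R^-1) * ((ka j.+1)%:R - (ka j)%:R) <=
         (r%:R^-1 + eps / 4) * ((ka j.+1)%:R - (ka j)%:R) :> R.
    by apply: ler_wpM2r => //; rewrite lerD2l.
  apply: le_trans (lerD IH (le_trans h hh)) _.
  by rewrite -addrA lerD2l mulrBr addrC subrK.
pose n1 := (Num.truncn (((ka j1)%:R + 1 + eps) * 4 / eps) : nat).+1.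
exists (maxn (ka j1) n1) => n; rewrite geq_max => /andP[nk nn1] d dr.
have exj : exists j, (n < ka j)%N by exact: ka_unbounded.
case: (ex_minnP exj) => -[|j] hj minj.
  have := ka_le (leq0n j1); lia.
have jn : (ka j <= n)%N by rewrite leqNgt; apply/negP => /minj; rewrite ltnn.
have jj : (j1 <= j)%N.
  rewrite leqNgt; apply/negP => jj; have := ka_le jj; lia.
have h1 : (hits r d 0 n x <= hits r d 0 (ka j.+1) x)%N.
  by rewrite (hits_cat r d x (leq0n _) (ltnW hj)) leq_addr.
have h2 := claim d j.+1 dr (leqW jj).
have h3 := ka_step j.
have Is : (I0 <= stage_of j)%N by apply: Hj2; apply: leq_trans jj; exact: leq_maxr.
have h4 : (I0 * (ka j.+1 - ka j) <= I0 + ka j)%N.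
  have sp : (0 < stage_of j)%N by apply: leq_trans Is.
  rewrite -(leq_pmul2l sp) mulnCA.
  apply: leq_trans (_ : I0 * (stage_of j + ka j) <= _)%N; first by rewrite leq_mul2l h3 orbT.
  by rewrite mulnDr mulnDr leq_add ?leq_mul2r ?Is ?orbT // mulnC.
have h5 : (ka j.+1)%:R <= n%:R + 1 + n%:R / I0%:R :> R.
  have h6 : I0%:R * ((ka j.+1)%:R - (ka j)%:R) <= I0%:R + (ka j)%:R :> R.
    by rewrite -natrB ?ka_le // -natrM -natrD ler_nat.
  have h7 : (ka j)%:R <= n%:R :> R by rewrite ler_nat.
  rewrite -(ler_pM2l I0R).
  have -> : I0%:R * (n%:R + 1 + n%:R / I0%:R) = I0%:R * n%:R + I0%:R + n%:R :> R.
    by field; rewrite gt_eqF.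
  have : I0%:R * (ka j)%:R <= I0%:R * n%:R :> R by rewrite ler_pM2l.
  lra.
have h8 : (hits r d 0 n x)%:R <= (hits r d 0 (ka j.+1) x)%:R :> R by rewrite ler_nat.
have n0 : 0 <= (n%:R : R) by [].
have h9 : (r%:R^-1 + eps / 4) * (ka j.+1)%:R <=
          (r%:R^-1 + eps / 4) * (n%:R + 1 + n%:R / I0%:R) :> R.
  by apply: ler_wpM2l => //; rewrite addr_ge0 ?divr_ge0 // ltW.
have h10 : (r%:R^-1 + eps / 4) * (n%:R / I0%:R) <= eps / 4 * n%:R.
  rewrite mulrCA -[X in _ <= X]mulrC; apply: ler_wpM2l => //.
  apply: le_trans Ie2; apply: ler_wpM2r; first by rewrite invr_ge0.
  by lra.
have h11 : (ka j1)%:R + 1 + eps <= eps / 4 * n%:R.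
  have -> : (ka j1)%:R + 1 + eps = eps / 4 * (((ka j1)%:R + 1 + eps) * 4 / eps).
    by field; rewrite gt_eqF.
  apply: ler_wpM2l; first by rewrite divr_ge0 // ltW.
  by apply: le_trans (ltW (truncnS_gt _)) _; rewrite ler_nat.
have h12 : (r%:R^-1 + eps / 4) * (n%:R + 1 + n%:R / I0%:R) = r%:R^-1 * n%:R +
   eps / 4 * n%:R + (r%:R^-1 + eps / 4) + (r%:R^-1 + eps / 4) * (n%:R / I0%:R) by ring.
have h13 : (r%:R^-1 + eps) * n%:R = r%:R^-1 * n%:R + 4 * (eps / 4 * n%:R) by field; rewrite gt_eqF // ltr0n ltnW.
have h14 : 0 <= eps / 4 * n%:R by rewrite mulr_ge0 // divr_ge0 // ltW.
move: h8 h2 h9 h10 h11; rewrite h12 h13; move: h14 rI1 e0; clear.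
move: (eps / 4 * n%:R) (r%:R^-1 * n%:R) ((r%:R^-1 + eps / 4) * (ka j.+1)%:R)
  ((r%:R^-1 + eps / 4) * (n%:R / I0%:R)) => E P X Y; lra.
Qed.

(** Since [scale js ^ (i + 1) <= scale je], the digits from before stage [i] make up only about
    [1 / (i + 1)] of those present at its end, so the excess gathered in the stage shows in the
    whole initial segment. *)
Lemma hits_stage (i d : nat) (c : R) : 0 < c ->
  (forall j, stage_of j = i -> (r%:R^-1 + c) * (ka j.+1 - ka j)%:R <=
     (hits r d (ka j) (ka j.+1) x)%:R) ->
  exists n, (i <= r ^ n)%N /\
    (r%:R^-1 + c) * (n%:R - 1 - n%:R / i.+1%:R) <= (hits r d 0 n x)%:R.
Proof.
move=> c0 H; have [js [je [jj sc E Hst]]] := stage_interval i.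
have rc : 0 <= (r%:R^-1 + c : R) by rewrite addr_ge0 ?invr_ge0 // ltW.
have claim k : (js + k <= je)%N ->
    (r%:R^-1 + c) * (ka (js + k) - ka js)%:R <= (hits r d (ka js) (ka (js + k)) x)%:R.
  elim: k => [|k IH] h; first by rewrite addn0 subnn mulr0.
  have h' : (js + k <= je)%N by lia.
  have {}IH := IH h'; rewrite addnS.
  have k1 : (ka js <= ka (js + k))%N by apply/ka_le/leq_addr.
  have k2 : (ka (js + k) <= ka (js + k).+1)%N by apply: ka_le.
  rewrite (hits_cat r d x k1 k2) natrD.
  have -> : (ka (js + k).+1 - ka js = (ka (js + k) - ka js) + (ka (js + k).+1 - ka (js + k)))%N by lia.
  rewrite natrD mulrDr; apply: lerD => //; apply: H; apply: Hst.
  by rewrite leq_addr /=; lia.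
exists (ka je); split.
  apply: leq_trans (kap_exp r2 (scale je)).
  apply: leq_trans (ltnW (scale_gt je)).
  by apply: leq_trans (stage_of_le je); rewrite /stage_of E /=.
have k1 : (ka js <= ka je)%N by apply/ka_le/ltnW.
have h1 := claim (je - js)%N; rewrite subnKC ?(ltnW jj) // in h1.
rewrite (hits_cat r d x (leq0n _) k1) natrD.
apply: le_trans (_ : (r%:R^-1 + c) * (ka je - ka js)%:R <= _); last first.
  by apply: le_trans (h1 (leqnn _)) _; rewrite lerDr.
apply: ler_wpM2l => //; rewrite natrB //.
have i0 : 0 < (i.+1%:R : R) by rewrite ltr0n.
have h2 : i.+1%:R * (ka js)%:R <= i.+1%:R + (ka je)%:R :> R.
  by rewrite -natrM -natrD ler_nat; exact: kap_pow_le (scale_gt0 js) sc.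
have h3 : (ka js)%:R <= 1 + (ka je)%:R / i.+1%:R :> R.
  by rewrite -(ler_pM2l i0) mulrDr mulr1 (mulrC _ (_ / _)) divfK ?gt_eqF.
by rewrite -addrA lerD2l -opprD lerN2.
Qed.

End Frequencies.
End Schedule.

(** * Simple normality *)

Section Normality.
Variable R : realType.
Implicit Types x : R.

Lemma digit_count_dig (s d n : nat) x :
  digit_count (fun j => dig s j x) d n = hits s d 0 n x.
Proof. by rewrite /digit_count /hits big_add1. Qed.

Lemma exp_inv_cvg0 (s : nat) : (1 < s)%N -> (s%:R : R) ^- n @[n --> \oo] --> 0.
Proof.
move=> s2; under eq_fun do rewrite -exprVn; apply: cvg_expr.
rewrite ger0_norm ?invr_ge0 // invf_lt1 ?ltr1n // ltr0n; exact: ltnW.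
Qed.

Lemma dig_expansion (s : nat) x : (1 < s)%N -> 0 <= x ->
  is_expansion s x (fun j => dig s j x).
Proof.
move=> s2 x0; have s0 : 0 < (s%:R : R) by rewrite ltr0n ltnW.
split; first by move=> j _; rewrite /dig ltn_pmod // ltnW.
have E n : (Num.floor x)%:~R + \sum_(1 <= j < n.+1) (dig s j x)%:R / s%:R ^+ j =
           (Num.truncn (s%:R ^+ n * x))%:R / s%:R ^+ n :> R.
  elim: n => [|n IH].
    rewrite big_geq // addr0 expr0 mul1r divr1 truncn_floor x0 pmulrn gez0_abs //.
    by rewrite floor_ge0.
  rewrite big_nat_recr //= addrA IH /dig.
  have D := truncn_expr_divn n 1 (ltnW s2) x0; rewrite expn1 addn1 in D.
  rewrite [in RHS](divn_eq (Num.truncn (s%:R ^+ n.+1 * x)) s) D natrD natrM.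
  rewrite [RHS]mulrDl; congr (_ + _).
  by rewrite exprSr -mulf_div divff ?mulr1 // gt_eqF.
under eq_fun do rewrite E.
have sn n : 0 < (s%:R ^+ n : R) by rewrite exprn_gt0.
have y0 n : 0 <= s%:R ^+ n * x by rewrite mulr_ge0 // ltW.
apply: (@squeeze_cvgr _ _ _ _ (fun n => x - s%:R ^- n) (fun=> x)).
- near=> n; have /andP[h1 h2] := truncn_itv (y0 n); apply/andP; split.
    rewrite ler_pdivlMr // mulrBl mulVf ?gt_eqF // (mulrC x) lerBlDr -(natrD R _ 1) addn1 ltW //.
  by rewrite ler_pdivrMr // [leRHS]mulrC.
- rewrite -[X in _ --> X]subr0; apply: cvgB; [exact: cvg_cst | exact: exp_inv_cvg0].
- exact: cvg_cst.
Unshelve. all: end_near. Qed.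

(** A later digit 0 makes [x] strictly smaller than [S n + s ^ -n], so the partial sum [S n] is the
    truncation of [x] to [n] digits. *)
Lemma expansion_dig (s : nat) x (a : nat -> nat) : (1 < s)%N -> 0 <= x ->
  is_expansion s x a -> (forall n, exists2 m, (n < m)%N & a m = 0%N) ->
  forall j, (0 < j)%N -> dig s j x = a j.
Proof.
move=> s2 x0 [as_ acvg] ainf; have s0 : 0 < (s%:R : R) by rewrite ltr0n ltnW.
have sn n : 0 < (s%:R ^+ n : R) by rewrite exprn_gt0.
pose S n : R := (Num.floor x)%:~R + \sum_(1 <= j < n.+1) (a j)%:R / s%:R ^+ j.
have SS n : S n.+1 = S n + (a n.+1)%:R / s%:R ^+ n.+1.
  by rewrite /S big_nat_recr //= addrA.
pose T n : R := S n + s%:R ^- n.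
have TS n : T n.+1 <= T n.
  rewrite /T SS -addrA lerD2l -[X in _ + X]div1r -mulrDl ler_pdivrMr //.
  rewrite exprS (mulrC (s%:R)) mulrA mulVf ?gt_eqF // mul1r -(natrD R _ 1) addn1 ler_nat.
  exact: as_.
have TS0 n : a n.+1 = 0%N -> T n.+1 < T n.
  move=> a0; rewrite /T SS a0 mul0r addr0 ltrD2l ltf_pV2 ?posrE //.
  by rewrite exprS ltr_pMl // ltr1n.
have SM n k : S n <= S (n + k)%N.
  elim: k => [|k IH]; rewrite ?addn0 // addnS SS; apply: le_trans IH _.
  by rewrite lerDl divr_ge0 // ltW.
have TM n k : T (n + k)%N <= T n.
  by elim: k => [|k IH]; rewrite ?addn0 // addnS; apply: le_trans (TS _) IH.
have Scvg : S n @[n --> \oo] --> x by [].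
have Sx n : S n <= x.
  rewrite leNgt; apply/negP => xS; move/cvgrPdist_lt: Scvg => /(_ (S n - x)) [|m _ Hm].
    by rewrite subr_gt0.
  have := Hm (n + m)%N (leq_addl _ _); have := SM n m; rewrite /= ltr_norml => h /andP[h' _].
  lra.
have xTle n : x <= T n.
  rewrite leNgt; apply/negP => xS; move/cvgrPdist_lt: Scvg => /(_ (x - T n)) [|m _ Hm].
    by rewrite subr_gt0.
  have := Hm (n + m)%N (leq_addl _ _); have := TM n m; rewrite /= ltr_norml /T => h /andP[_ h'].
  have : 0 < s%:R ^- (n + m) :> R by rewrite invr_gt0.
  rewrite /T in xS; lra.
have xT n : x < T n.
  have [[|m] nm am] := ainf n; first by rewrite ltn0 in nm.
  apply: le_lt_trans (xTle m.+1) _; apply: lt_le_trans (TS0 m am) _.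
  by rewrite -(subnKC (_ : n <= m)%N) // TM.
pose P : nat -> nat := fix P n := if n is n'.+1 then (s * P n' + a n)%N else Num.truncn x.
have PE n : (P n)%:R = s%:R ^+ n * S n.
  elim: n => [|n IH].
    rewrite /S big_geq // addr0 expr0 mul1r /= truncn_floor x0 pmulrn gez0_abs //.
    by rewrite floor_ge0.
  rewrite SS mulrDr mulrCA divff ?gt_eqF // mulr1 exprS -mulrA -IH /=.
  by rewrite natrD natrM.
have Ptr n : Num.truncn (s%:R ^+ n * x) = P n.
  apply: truncn_def; rewrite -(addn1 (P n)) natrD PE ler_pM2l // Sx /=.
  have -> : s%:R ^+ n * S n + 1 = s%:R ^+ n * T n by rewrite [RHS]mulrDr mulfV // gt_eqF.
  by rewrite ltr_pM2l.
case=> // j _; rewrite /dig Ptr /= mulnC modnMDl.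
by rewrite modn_small // as_.
Qed.

(** In an expansion with frequencies [1 / s] the digit 0 recurs for ever, so by [expansion_dig] it
    is the expansion given by [dig]. *)
Lemma simply_normal_dig (s : nat) x : (1 < s)%N -> 0 <= x ->
  simply_normal s x <-> forall d, (d < s)%N ->
    ((hits s d 0 n x)%:R / n%:R : R) @[n --> \oo] --> (s%:R^-1 : R).
Proof.
move=> s2 x0; split; last first.
  move=> H; exists (fun j => dig s j x); split; first exact: dig_expansion.
  by move=> d ds; under eq_fun do rewrite digit_count_dig; exact: H.
move=> [a [aexp afreq]].
have ainf n : exists2 m, (n < m)%N & a m = 0%N.
  apply: contrapT => no.
  have a0 m : (n < m)%N -> a m <> 0%N by move=> nm am; apply: no; exists m.
  have cnt m : (digit_count a 0 m <= n)%N.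
    rewrite /digit_count; have [mn|nm] := leqP m n.
      apply: leq_trans mn; rewrite -[X in (_ <= X)%N]subn0 -subSS -[X in (_ <= X)%N]muln1.
      by rewrite -sum_nat_const_nat; apply: leq_sum => j _; case: eqP.
    rewrite (big_cat_nat (n := n.+1)) //=; last by rewrite ltnS ltnW.
    rewrite [X in (_ + X)%N]big_nat_cond [X in (_ + X)%N]big1 ?addn0; last first.
      by move=> j /andP[/andP[nj _] _]; have /eqP/negbTE -> := a0 j nj.
    rewrite -[X in (_ <= X)%N]subn0 -subSS -[X in (_ <= X)%N]muln1.
    by rewrite -sum_nat_const_nat; apply: leq_sum => j _; case: eqP.
  have s0 : 0 < (s%:R : R)^-1 by rewrite invr_gt0 ltr0n ltnW.
  have /cvgrPdist_lt /(_ (s%:R^-1 / 2)) [] := afreq 0%N (ltnW s2).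
    by rewrite divr_gt0.
  move=> n0 _ Hn0; pose y : R := n%:R / (s%:R^-1 / 2).
  pose m := maxn n0 (Num.truncn y).+1.
  have ym : y < m%:R.
    by apply: lt_le_trans (truncnS_gt _) _; rewrite ler_nat leq_maxr.
  have m0 : 0 < (m%:R : R) by rewrite ltr0n leq_max orbT.
  have := Hn0 m (leq_maxl _ _); rewrite /= ltr_norml => /andP[_ h].
  have h2 : (digit_count a 0 m)%:R / m%:R <= s%:R^-1 / 2 :> R.
    rewrite ler_pdivrMr // mulrC -ler_pdivrMr ?divr_gt0 //.
    apply: le_trans (ltW ym); rewrite ler_pM2r ?invr_gt0 ?divr_gt0 // ler_nat.
    exact: cnt.
  lra.
have E := expansion_dig s2 x0 aexp ainf.
move=> d ds; have := afreq d ds.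
have -> // : (fun n => (digit_count a d n)%:R / n%:R : R) = (fun n => (hits s d 0 n x)%:R / n%:R).
apply/funext => n; rewrite -digit_count_dig; congr (_%:R / _).
by rewrite /digit_count big_nat_cond [RHS]big_nat_cond; apply: eq_bigr => j /andP[/andP[j1 _] _]; rewrite E.
Qed.

Lemma sum_hits (s n : nat) x : (0 < s)%N -> (\sum_(0 <= d < s) hits s d 0 n x)%N = n.
Proof.
move=> s0; rewrite /hits exchange_big /= -[RHS]subn0 -[RHS]muln1 -sum_nat_const_nat.
apply: eq_bigr => k _; have ks : (dig s k.+1 x < s)%N by rewrite ltn_pmod.
rewrite (bigD1_seq (dig s k.+1 x)) ?mem_index_iota ?iota_uniq //= eqxx big1 // => d.
by rewrite eq_sym => /negbTE ->.
Qed.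

(** The lower bound for one digit comes from the upper bounds for the others; tolerances [e / s] add
    up to at most [e]. *)
Lemma cvg_hits (s : nat) x : (1 < s)%N ->
  (forall eps : R, 0 < eps -> exists n0, forall n, (n0 <= n)%N ->
    forall d, (d < s)%N -> (hits s d 0 n x)%:R <= (s%:R^-1 + eps) * n%:R) ->
  forall d, (d < s)%N -> ((hits s d 0 n x)%:R / n%:R : R) @[n --> \oo] --> (s%:R^-1 : R).
Proof.
move=> s2 H d ds; have s0 : 0 < (s%:R : R) by rewrite ltr0n ltnW.
apply/cvgrPdist_le => e e0; have es : 0 < e / s%:R by rewrite divr_gt0.
have [n0 Hn0] := H _ es; near=> n.
have nn0 : (n0 <= n)%N by near: n; exact: nbhs_infty_ge.
have n1 : 0 < (n%:R : R) by rewrite ltr0n; near: n; exact: nbhs_infty_gt.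
have up c : (c < s)%N -> (hits s c 0 n x)%:R / n%:R <= s%:R^-1 + e / s%:R.
  by move=> cs; rewrite ler_pdivrMr //; exact: Hn0.
have ee : e / s%:R <= e by rewrite ler_pdivrMr //; apply: ler_peMr; [exact: ltW | rewrite ler1n ltnW].
rewrite ler_norml; apply/andP; split; last first.
  have S1 : \sum_(0 <= c < s) ((hits s c 0 n x)%:R / n%:R) = 1 :> R.
    by rewrite -mulr_suml -natr_sum sum_hits 1?ltnW // divff // gt_eqF.
  move: S1; rewrite (bigD1_seq d) ?mem_index_iota ?iota_uniq //= => S1.
  have S2 : \sum_(0 <= c < s | c != d) ((hits s c 0 n x)%:R / n%:R) <=
     \sum_(0 <= c < s | c != d) (s%:R^-1 + e / s%:R) :> R.
    rewrite big_nat_cond [X in _ <= X]big_nat_cond; apply: ler_sum => c /andP[/andP[_ cs] _].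
    exact: up.
  have S3 : \sum_(0 <= c < s) (s%:R^-1 + e / s%:R) = 1 + e :> R.
    by rewrite big_const_nat iter_addr addr0 subn0 -[LHS]mulr_natl; field; rewrite gt_eqF.
  move: S3; rewrite (bigD1_seq d) ?mem_index_iota ?iota_uniq //= => S3.
  have : 0 <= e / s%:R by rewrite ltW.
  lra.
have := up d ds; lra.
Unshelve. all: end_near. Qed.

Lemma biased_not_cvg (s d : nat) x (c : R) : (1 < s)%N -> 0 < c ->
  (forall N, exists i n, [/\ (N <= i)%N, (i <= s ^ n)%N &
    (s%:R^-1 + c) * (n%:R - 1 - n%:R / i.+1%:R) <= (hits s d 0 n x)%:R]) ->
  ~ (((hits s d 0 n x)%:R / n%:R : R) @[n --> \oo] --> (s%:R^-1 : R)).
Proof.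
move=> s2 c0 H /cvgrPdist_le /(_ (c / 2)) []; first by rewrite divr_gt0.
move=> n0 _ Hn0; have s0 : 0 < (s%:R : R) by rewrite ltr0n ltnW.
(* Once [n] and [i] exceed [y], the losses from [- 1] and from [n / (i + 1)] each cost at most
   [c / 4 * n], together half of the excess. *)
pose y : R := 4 * (1 + c) / c; have y0 : 0 < y by rewrite divr_gt0 // mulr_gt0 //; lra.
pose N := (Num.truncn y).+1; have Ny : y < N%:R by exact: truncnS_gt.
have [i [n [Ni isn hn]]] := H (maxn N (s ^ (maxn n0 N).+1)).
have nN : ((maxn n0 N).+1 <= n)%N.
  rewrite -(leq_exp2l _ _ s2); apply: leq_trans isn; apply: leq_trans Ni.
  exact: leq_maxr.
have nn0 : (n0 <= n)%N by apply: leq_trans (ltnW nN); exact: leq_maxl.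
have nN' : (N < n)%N by apply: leq_trans nN; rewrite ltnS leq_maxr.
have := Hn0 n nn0; rewrite /= ler_norml => /andP[h _].
have np : 0 < (n%:R : R) by rewrite ltr0n; apply: leq_ltn_trans nN'.
have h1 : (hits s d 0 n x)%:R <= (s%:R^-1 + c / 2) * n%:R.
  by rewrite -ler_pdivrMr //; lra.
have yn : y < n%:R by apply: lt_trans Ny _; rewrite ltr_nat.
have yi : y < i.+1%:R.
  by apply: lt_trans Ny _; rewrite ltr_nat ltnS; apply: leq_trans Ni; exact: leq_maxl.
have yE : c / 4 * y = 1 + c by rewrite /y; field; rewrite gt_eqF.
have sc : s%:R^-1 + c <= 1 + c by rewrite lerD2r invf_le1 // ler1n ltnW.
have h2 : (s%:R^-1 + c) * (n%:R / i.+1%:R) <= c / 4 * n%:R.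
  rewrite mulrA ler_pdivrMr ?ltr0n // mulrAC; apply: ler_wpM2r; first exact: ltW.
  apply: (le_trans sc); rewrite -yE; apply: ler_wpM2l; last exact: ltW.
  by rewrite divr_ge0 // ltW.
have h3 : s%:R^-1 + c < c / 4 * n%:R.
  apply: (le_lt_trans sc); rewrite -yE ltr_pM2l // divr_gt0 //.
have h4 (Z u v : R) : (u + c) * (v - 1 - Z) = u * v + 4 * (c / 4 * v) - (u + c) - (u + c) * Z.
  by field.
have h5 (u v : R) : (u + c / 2) * v = u * v + 2 * (c / 4 * v) by field.
move: hn h1 h2 h3; rewrite h4 h5; clear.
move: ((s%:R^-1 + c) * (n%:R / i.+1%:R)) (c / 4 * n%:R) (s%:R^-1 * n%:R) => X Y Z; lra.
Qed.

End Normality.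

(** * Hausdorff measure above dimension one *)

Section HausdorffUpperBound.
Variable R : realType.
Implicit Types (t c delta : R) (A U : set R).

(* Pairing consecutive terms gives, for the partial sums [S], [S (2n+1) <= 1 + 2^(1-t) S n]. *)
Lemma p_series_bounded t : 1 < t ->
  exists2 B : R, 0 < B & forall n, \sum_(0 <= i < n) (i.+1%:R `^ t)^-1 <= B.
Proof.
move=> t1; have t0 : 0 <= t by lra.
pose f i : R := (i.+1%:R `^ t)^-1; pose S n := \sum_(0 <= i < n) f i.
have f0 i : 0 <= f i by rewrite invr_ge0 powR_ge0.
pose r : R := 2 / 2 `^ t; have p2 : 0 < (2 : R) `^ t by apply: powR_gt0.
have r1 : r < 1.
  have E : (2 : R) `^ t = 2 * 2 `^ (t - 1).
    by rewrite -[X in _ = X * _]powRr1 // -powRD ?pnatr_eq0 ?implybT // addrC subrK.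
  rewrite /r ltr_pdivrMr // mul1r E ltr_pMr //.
  have p1 : (1 : R) `^ (t - 1) = 1 by rewrite powR1.
  rewrite -[X in X < _]p1.
  by apply: gt0_ltr_powR; rewrite ?nnegrE ?ltr1n // subr_gt0.
have fM i : (2 `^ t)^-1 * f i = ((2 * i.+1)%:R `^ t)^-1.
  by rewrite natrM powRM // invfM.
have main n : S (2 * n).+1 <= 1 + r * S n.
  elim: n => [|n IH]; first by rewrite /S big_nat1 big_geq // /f powR1 invr1 mulr0 addr0.
  have -> : (2 * n.+1).+1 = (2 * n).+3 by lia.
  rewrite /S !big_nat_recr //= -/(S _) mulrDr -/(S n) in IH *.
  have h1 : f (2 * n).+1 = (2 `^ t)^-1 * f n.
    by rewrite fM /f; congr ((_%:R `^ _)^-1); lia.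
  have h2 : f (2 * n).+2 <= (2 `^ t)^-1 * f n.
    rewrite -h1 /f lef_pV2 ?posrE ?powR_gt0 //.
    by apply: ge0_ler_powR; rewrite ?nnegrE // ler_nat.
  have h3 : r * f n = 2 * ((2 `^ t)^-1 * f n) by rewrite /r mulrA.
  rewrite h3 h1; move: IH h2; clear.
  move: (f (2 * n).+2) (_ * f n) (r * S n) (S (2 * n)%N + f (2 * n)%N) => a b u v; lra.
exists (1 - r)^-1; first by rewrite invr_gt0 subr_gt0.
move=> n; rewrite -[X in _ <= X]mul1r ler_pdivlMr ?subr_gt0 //.
rewrite mulrBr mulr1 lerBlDr mulrC; apply: le_trans (main n).
rewrite /S (@big_cat_nat _ _ _ n 0 (2 * n).+1) //=; last by lia.
by rewrite lerDl sumr_ge0.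
Qed.

Lemma hausdorff_weight_ge0 t U : (0 <= hausdorff_weight t U)%E.
Proof. by rewrite /hausdorff_weight; case: ifP => // _; exact: poweR_ge0. Qed.

Lemma hausdorff_weight_le t U (l : R) : 0 <= t -> (diameter U <= l%:E)%E ->
  (hausdorff_weight t U <= (l `^ t)%:E)%E.
Proof.
move=> t0 /diameter_fin [e /andP[e0 el] E]; rewrite /hausdorff_weight.
case: ifP => _; first by rewrite lee_fin powR_ge0.
rewrite E poweR_EFin lee_fin; apply: ge0_ler_powR; rewrite ?nnegrE //.
exact: le_trans el.
Qed.

Lemma diameter_le U (l : R) : 0 <= l -> (forall x y, U x -> U y -> x - y <= l) ->
  (diameter U <= l%:E)%E.
Proof.
move=> l0 H; apply: ge_ereal_sup => _ [->|[x Ux [y Uy <-]]]; first by rewrite lee_fin.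
by rewrite lee_fin ler_norml H // andbT lerNl opprB H.
Qed.

Lemma hausdorff_measure_ge0 t A : (0 <= hausdorff_measure t A)%E.
Proof.
apply: (@le_trans _ _ (hausdorff_premeasure t 1 A)); last first.
  by apply: ereal_sup_ubound; exists 1 => //=.
apply: le_ereal_inf_tmp => _ [U _ <-]; apply: nneseries_ge0 => i _ _.
exact: hausdorff_weight_ge0.
Qed.

Lemma hausdorff_measure_set0 t : hausdorff_measure t (set0 : set R) = 0%E.
Proof.
apply/eqP; rewrite eq_le hausdorff_measure_ge0 andbT.
apply: ge_ereal_sup => _ [delta /= d0 <-]; apply: ereal_inf_lbound.
exists (fun=> set0); first split => //.
  by move=> i; apply: diameter_le; first exact: ltW.
by rewrite eseries0 // => i _ _; rewrite /hausdorff_weight eqxx.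
Qed.

(** For each [k] two sets, one per sign, hold the points with
    [c * ln (k + 1) <= |x| < c * ln (k + 2)]. They cover the line, as the logarithm is unbounded;
    their diameters are at most [c / (k + 1)], and the powers [t] of these are summable. *)
Lemma hausdorff_measure0 t A : 1 < t -> hausdorff_measure t A = 0%E.
Proof.
move=> t1; have t0 : 0 < t by lra.
apply/eqP; rewrite eq_le hausdorff_measure_ge0 andbT.
apply: ge_ereal_sup => _ [delta /= d0 <-]; apply/lee_addgt0Pr => e e0; rewrite add0e.
have [B B0 HB] := p_series_bounded t1.
pose y := (e / B) `^ t^-1; have y0 : 0 < y by apply: powR_gt0; rewrite divr_gt0.
(* The 2 accounts for the pairing of indices: [i + 1 <= 2 * (i./2 + 1)]. *)
pose c := Num.min delta (y / 2).
have c0 : 0 < c by rewrite lt_min d0 divr_gt0.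
have cy : 2 * c <= y by rewrite mulrC -ler_pdivlMr // ge_min lexx orbT.
have cd : c <= delta by rewrite ge_min lexx.
pose U i : set R := [set x | Num.truncn (expR (`|x| / c)) = (i./2).+1 /\ (x < 0) = odd i].
have dist x z (k : nat) : Num.truncn (expR (x / c)) = k.+1 -> Num.truncn (expR (z / c)) = k.+1 ->
    x - z <= c / k.+1%:R.
  move=> Ex Ez; have /truncn_itv /andP[_ hx] : 0 <= expR (x / c) by exact: expR_ge0.
  have /truncn_itv /andP[hz _] : 0 <= expR (z / c) by exact: expR_ge0.
  rewrite leNgt; apply/negP => h.
  have h1 : 1 < (x - z) / c * k.+1%:R.
    by rewrite mulrAC ltr_pdivlMr // mul1r -ltr_pdivrMr.
  have u0 : 0 <= 1 + (x - z) / c.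
    by rewrite addr_ge0 // divr_ge0 ?(ltW c0) // ltW // (lt_trans _ h) // divr_gt0.
  have E : expR (x / c) = expR (z / c) * expR ((x - z) / c).
    by rewrite -expRD; congr expR; rewrite -mulrDl addrC subrK.
  have h2 : k.+1%:R * (1 + (x - z) / c) <= expR (x / c).
    by rewrite E; apply: ler_pM => //; [rewrite -Ez | exact: expR_ge1Dx].
  rewrite Ex -[X in _ < X%:R]addn1 natrD in hx; rewrite mulrDr mulr1 [X in _ + X]mulrC in h2.
  lra.
have dU i : (diameter (U i) <= (c / (i./2).+1%:R)%:E)%E.
  apply: diameter_le; first by rewrite divr_ge0 // ltW.
  move=> x z [Ex sx] [Ez sz]; move: sx sz; have [x0|x0] := ltrP x 0 => <- => [/idP z0 | /negbT].
    have := dist _ _ _ Ez Ex; by rewrite !ltr0_norm // opprK addrC.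
  by rewrite -leNgt => z0; have := dist _ _ _ Ex Ez; rewrite !ger0_norm.
apply: (@le_trans _ _ (\sum_(0 <= i <oo) hausdorff_weight t (U i))%E).
  apply: ereal_inf_lbound; exists U => //; split; last first.
    move=> i; apply: le_trans (dU i) _; rewrite lee_fin; apply: le_trans cd.
    by rewrite ler_pdivrMr ?ltr0n // ler_peMr ?(ltW c0) // ler1n.
  move=> x Ax; pose m := Num.truncn (expR (`|x| / c)).
  have m0 : (0 < m)%N.
    rewrite /m truncn_gt0; apply: le_trans (expR_ge1Dx _).
    by rewrite lerDl divr_ge0 // ltW.
  exists ((x < 0)%R + (m.-1).*2)%N => //; split.
    by rewrite half_bit_double prednK.
  by rewrite oddD odd_double addbF oddb.
have -> : e = B * (e / B) by rewrite mulrC divfK // gt_eqF.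
apply: lime_le.
  by apply: is_cvg_nneseries => i _ _; exact: hausdorff_weight_ge0.
apply: nearW => n; apply: (@le_trans _ _ (\sum_(0 <= i < n) ((e / B) * (i.+1%:R `^ t)^-1)%:E)%E).
  apply: lee_sum => i _; apply: le_trans (hausdorff_weight_le (ltW t0) (dU i)) _.
  have -> : e / B = y `^ t by rewrite /y -powRrM mulVf ?powRr1 ?gt_eqF // ltW // divr_gt0.
  rewrite lee_fin ler_pdivlMr ?powR_gt0 // -powRM ?divr_ge0 ?(ltW c0) //.
  apply: ge0_ler_powR; rewrite ?nnegrE ?mulr_ge0 ?divr_ge0 ?(ltW t0) ?(ltW c0) ?(ltW y0) //.
  apply: le_trans cy; rewrite mulrAC ler_pdivrMr // (mulrC 2) -mulrA ler_pM2l //.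
  rewrite -natrM ler_nat; have := odd_double_half i; case: (odd i); lia.
rewrite sumEFin lee_fin -mulr_sumr mulrC ler_pM2r ?divr_gt0 //.
Qed.

End HausdorffUpperBound.

(** * The construction *)

Lemma non_perfect_powers2 : non_perfect_powers 2.
Proof.
split=> // -[a [k [a1 k2 E]]]; case: a a1 E => [|[|a]] // _ E; first by rewrite exp1n in E.
have : (a.+2 ^ 2 <= a.+2 ^ k)%N by rewrite leq_exp2l.
rewrite -E; lia.
Qed.

(* The stage [2 ^ s * 3 ^ m * 5 ^ N] treats the pair [(s, m)]. *)
Lemma exists_tasks : exists task : nat -> nat * nat,
  (forall i, non_perfect_powers (task i).1 /\ (0 < (task i).2)%N) /\
  forall s m N, non_perfect_powers s -> (0 < m)%N -> exists2 i, (N <= i)%N & task i = (s, m).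
Proof.
exists (fun i => if `[< non_perfect_powers (logn 2 i) /\ (0 < logn 3 i)%N >]
  then (logn 2 i, logn 3 i) else (2%N, 1%N)); split.
  by move=> i; case: asboolP => // _; split => //; exact: non_perfect_powers2.
move=> s m N ns m0; exists (2 ^ s * 3 ^ m * 5 ^ N)%N.
  apply: leq_trans (ltnW (ltn_expl N (isT : (1 < 5)%N))) _.
  by rewrite leq_pmull // muln_gt0 !expn_gt0.
have E2 : logn 2 (2 ^ s * 3 ^ m * 5 ^ N) = s.
  by rewrite !lognM ?muln_gt0 ?expn_gt0 // !lognX !logn_prime //= !muln0 !addn0 muln1.
have E3 : logn 3 (2 ^ s * 3 ^ m * 5 ^ N) = m.
  by rewrite !lognM ?muln_gt0 ?expn_gt0 // !lognX !logn_prime //= !muln0 addn0 muln1.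
by rewrite E2 E3; case: asboolP => // -[].
Qed.

Section Construction.
Variables (R : realType) (M : nat -> set nat).

Definition normality_set : set R := [set x : R | forall s, non_perfect_powers s ->
   forall m : nat, (0 < m)%N -> (simply_normal (s ^ m)%N x <-> M s m)].

Section Path.
Variables (B : nat -> nat) (nxt : nat -> nat -> nat).
Hypothesis nxt2 : forall i q, (0 < q)%N -> (2 * q <= nxt i q)%N.
Hypothesis nxtB : forall i q, (0 < q)%N -> (nxt i q <= B i * q)%N.

Let st := stage_of B nxt.
Let q := scale B nxt.

(** For [m] in [M s], all late stages control [s ^ m]: it is no power of the base of a stage that
    serves another base, and in a stage for [s] its exponent is in [M s]. Otherwise the stages for
    [(s, m)] recur with the same digit and excess. *)
Lemma path_normality_set (task : nat -> nat * nat) (c : nat * nat -> R) (d : nat * nat -> nat) (x : R) :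
  (forall i, non_perfect_powers (task i).1 /\ (0 < (task i).2)%N) ->
  (forall s m N, non_perfect_powers s -> (0 < m)%N -> exists2 i, (N <= i)%N & task i = (s, m)) ->
  (forall p, non_perfect_powers p.1 -> (0 < p.2)%N -> 0 < c p /\ (d p < p.1 ^ p.2)%N) ->
  0 <= x ->
  (forall j, stage_good M (task (st j)).1 (task (st j)).2 (st j) (c (task (st j)))
    (d (task (st j))) (q j) (q j.+1) x) ->
  normality_set x.
Proof.
move=> task1 task2 cd x0 good s ns m m0.
have s2 : (1 < s)%N by case: ns.
have r2 : (1 < s ^ m)%N by rewrite -(expn0 s) ltn_exp2l.
split=> [|Msm].
  move/(simply_normal_dig r2 x0) => H; apply: contrapT => nM.
  have [c0 dl] := cd (s, m) ns m0.
  apply: (biased_not_cvg r2 c0 _ (H (d (s, m)) dl)) => N.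
  have [i Ni Ei] := task2 s m N ns m0.
  have [|n [h1 h2]] := @hits_stage B nxt nxt2 R _ x r2 i (d (s, m)) (c (s, m)) c0.
    by move=> j ji; have [_] := good j; rewrite -/st /st ji Ei; apply.
  by exists i, n.
apply/(simply_normal_dig r2 x0)/(cvg_hits r2)/(hits_upper nxt2 nxtB r2).
have [j0 Hj0] := @stage_of_unbounded B nxt nxt2 (s ^ m)%N.
exists j0 => j jj; have [H _] := good j; apply: H; first by rewrite r2 Hj0.
have [E|ne] := eqVneq s (task (st j)).1; first by right; exists m; rewrite -?E.
left=> k Ek; have [nt _] := task1 (st j).
by move/eqP: ne; apply; exact: non_perfect_power_inj ns nt m0 Ek.
Qed.

(* The ratio of consecutive scales is at most [B], and [B ^ i <= q j] in stage [i]: passing from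
   [q j] to [q j.+1] costs less than passing from [t] to [t']. *)
Lemma growth_bound (K : nat -> nat) (t t' : R) : 0 < t' < t -> (forall i, (0 < K i)%N) ->
  (forall i k, (0 < k)%N -> ((nxt i k)%:R / k%:R) `^ t <= (K i)%:R :> R) ->
  exists2 C : R, 0 < C & forall j, (q j.+1)%:R `^ t' <= C * (width (fun j => K (st j)) j)%:R.
Proof.
move=> /andP[t'0 tt'] K0 HK; have t0 : 0 < t by exact: lt_trans tt'.
have q0 j : (0 < q j)%N by exact: scale_gt0.
have qR j : 0 < ((q j)%:R : R) by rewrite ltr0n.
have wK j : (0 < width (fun j => K (st j)) j)%N by exact: width_gt0.
have wq j : (q j)%:R `^ t <= (width (fun j => K (st j)) j)%:R :> R.
  elim: j => [|j IH]; first by rewrite /width big_geq // /q scale0 powR1.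
  rewrite widthS natrM.
  have -> : (q j.+1)%:R = (q j)%:R * ((q j.+1)%:R / (q j)%:R) :> R by rewrite mulrC divfK ?gt_eqF.
  rewrite powRM ?divr_ge0 //; apply: ler_pM; rewrite ?powR_ge0 //.
  by rewrite /q scaleS; exact: HK.
(* For [i >= y] one has [(i + 1) * t' <= i * t], and [q j.+1 ^ i <= q j ^ (i + 1)] then gives the
   bound; the constant [C] pays for the finitely many earlier levels. *)
pose y : R := t' / (t - t'); pose i0 := (Num.truncn y).+1.
have yi : y < i0%:R by exact: truncnS_gt.
have [j0 Hj0] := @stage_of_unbounded B nxt nxt2 i0.
have late j : (j0 <= j)%N -> (q j.+1)%:R `^ t' <= (q j)%:R `^ t :> R.
  move=> jj; have ij : (i0 <= st j)%N by exact: Hj0.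
  have st0 : 0 < ((st j)%:R : R) by rewrite ltr0n; apply: leq_trans ij.
  have h1 : (q j.+1 ^ st j <= q j ^ (st j).+1)%N.
    apply: leq_trans (_ : (B (st j) * q j) ^ st j <= _)%N.
      by rewrite leq_exp2r ?scale_step //; apply: leq_trans ij.
    by rewrite expnMn expnS leq_mul2r; apply/orP; right; exact: step_small.
  have h2 : (q j.+1)%:R `^ (st j)%:R <= (q j)%:R `^ (st j).+1%:R :> R.
    by rewrite !powR_mulrn // -!natrX ler_nat.
  have -> : t' = (st j)%:R * (t' / (st j)%:R) by rewrite mulrC divfK ?gt_eqF.
  rewrite powRrM; apply: (@le_trans _ _ (((q j)%:R `^ (st j).+1%:R) `^ (t' / (st j)%:R))).
    by apply: ge0_ler_powR; rewrite ?nnegrE ?powR_ge0 ?divr_ge0 ?(ltW t'0).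
  rewrite -powRrM; apply: ler_powR; first by rewrite ler1n.
  rewrite mulrA ler_pdivrMr // -addn1 natrD mulrDl mul1r (mulrC t) -lerBrDl -mulrBr.
  rewrite -ler_pdivrMr ?subr_gt0 //; apply: le_trans (ltW yi) _.
  by rewrite ler_nat.
exists (1 + \sum_(0 <= j < j0) (q j.+1)%:R `^ t').
  by apply: ltr_pwDl => //; apply: sumr_ge0 => j _; exact: powR_ge0.
move=> j; rewrite mulrDl mul1r; have [jj|jj] := leqP j0 j.
  apply: le_trans (late j jj) _; apply: le_trans (wq j) _.
  by rewrite lerDl mulr_ge0 // sumr_ge0 // => i _; exact: powR_ge0.
apply: (@le_trans _ _ (\sum_(0 <= j < j0) (q j.+1)%:R `^ t')).
  rewrite (bigD1_seq j) ?mem_index_iota ?iota_uniq //= lerDl sumr_ge0 // => i _; exact: powR_ge0.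
apply: (@le_trans _ _ ((\sum_(0 <= j < j0) (q j.+1)%:R `^ t') * (width (fun j => K (st j)) j)%:R)).
  rewrite ler_peMr ?ler1n // sumr_ge0 // => i _; exact: powR_ge0.
by rewrite lerDr.
Qed.

End Path.

Hypothesis M_div : forall s, non_perfect_powers s ->
  forall m d : nat, M s m -> (d %| m)%N -> M s d.
Hypothesis M_inf : forall s, non_perfect_powers s ->
  infinite_set (M s) -> M s = [set m : nat | (0 < m)%N].

Lemma normality_set_hausdorff (s : R) : 0 <= s < 1 -> hausdorff_measure s normality_set <> 0%E.
Proof.
(* The branching is arranged for [t]; [t'] is what [growth_bound] leaves of it. *)
move=> /andP[s0 s1]; pose t' := (s + 1) / 2; pose t := (t' + 1) / 2.
have st' : s <= t' by rewrite /t'; lra.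
have t'01 : 0 < t' < t by rewrite /t /t'; lra.
have t01 : 0 < t < 1 by rewrite /t /t'; lra.
have [task [task1 task2]] := exists_tasks.
have /choice [cd Hcd] : forall p : nat * nat, exists cd : R * nat,
    non_perfect_powers p.1 -> (0 < p.2)%N -> [/\ 0 < cd.1, (cd.2 < p.1 ^ p.2)%N &
      forall i, exists B K nxt, stage_step t (stage_good M p.1 p.2 i cd.1 cd.2) B K nxt].
  move=> [a m] /=; have [[na m0]|no] := pselect (non_perfect_powers a /\ (0 < m)%N); last first.
    by exists (0, 0%N) => na m0; case: no.
  by have [c [d H]] := stage (M_div na) (M_inf na) na m0 t01; exists (c, d).
have /choice [BKn Hst] : forall i, exists b : nat * nat * (nat -> nat),
    stage_step t (stage_good M (task i).1 (task i).2 i (cd (task i)).1 (cd (task i)).2)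
      b.1.1 b.1.2 b.2.
  move=> i; have [na m0] := task1 i; have [_ _ /(_ i) [B [K [nxt H]]]] := Hcd _ na m0.
  by exists (B, K, nxt).
pose B i := (BKn i).1.1; pose K i := (BKn i).1.2; pose nxt i := (BKn i).2.
have nxt2 i k : (0 < k)%N -> (2 * k <= nxt i k)%N by move=> /(Hst i) [].
have nxtB i k : (0 < k)%N -> (nxt i k <= B i * k)%N by move=> /(Hst i) [].
have HK i k : (0 < k)%N -> ((nxt i k)%:R / k%:R) `^ t <= (K i)%:R :> R by move=> /(Hst i) [].
have K0 i : (0 < K i)%N.
  rewrite -(ltr0n R); apply: lt_le_trans (HK i 1%N isT); apply: powR_gt0.
  by rewrite divr1 ltr0n; apply: leq_trans (nxt2 i 1%N isT).
pose q := scale B nxt; pose st := stage_of B nxt.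
have /choice [child Hchild] : forall p : nat * nat, exists ch : seq nat,
    [/\ uniq ch, size ch = K (st p.1) & forall u', u' \in ch ->
      [/\ (p.2 * q p.1.+1 <= u' * q p.1)%N, (u'.+1 * q p.1 < p.2.+1 * q p.1.+1)%N &
      forall x : R, 0 <= x -> Num.truncn ((q p.1.+1)%:R * x) = u' ->
        stage_good M (task (st p.1)).1 (task (st p.1)).2 (st p.1) (cd (task (st p.1))).1
          (cd (task (st p.1))).2 (q p.1) (q p.1.+1) x]].
  move=> [j u] /=; rewrite /q scaleS.
  by have [_ _ _ /(_ u)] := Hst (st j) (q j) (scale_gt0 B nxt2 j).
have [C C0 HC] := @growth_bound B nxt nxt2 nxtB K t t' t'01 K0 HK.
apply: (@tree_hausdorff R q (fun j => K (st j)) (fun j u => child (j, u)) _ _ _ _ _ _ _ _ t' C) => //.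
- by move=> j; exact: scale2.
- by move=> j u; have [] := Hchild (j, u).
- by move=> j u; have [] := Hchild (j, u).
- by move=> j u u' h; have [_ _ /(_ u' h) []] := Hchild (j, u).
- move=> u x [_ Hu] x0 Hx.
  apply: (@path_normality_set B nxt nxt2 nxtB task (fun p => (cd p).1) (fun p => (cd p).2)) => //.
    by move=> p na m0; have [] := Hcd p na m0.
  by move=> j; have [_ _ /(_ _ (Hu j)) [_ _]] := Hchild (j, u j); apply.
- by case/andP: t'01.
- by rewrite s0.
Qed.

End Construction.

Theorem theorem1 (R : realType) (M : nat -> set nat)
  (M_pos : forall s, non_perfect_powers s -> forall m, M s m -> (0 < m)%N)
  (M_div : forall s, non_perfect_powers s ->
     forall m d : nat, M s m -> (d %| m)%N -> M s d)
  (M_inf : forall s, non_perfect_powers s ->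
     infinite_set (M s) -> M s = [set m : nat | (0 < m)%N]) :
  (exists x : R, forall s, non_perfect_powers s ->
     forall m : nat, (0 < m)%N -> (simply_normal (s ^ m)%N x <-> M s m)) /\
  hausdorff_dim [set x : R | forall s, non_perfect_powers s ->
     forall m : nat, (0 < m)%N -> (simply_normal (s ^ m)%N x <-> M s m)]
    = 1%:E.
Proof.
rewrite -/(@normality_set R M); have lower := normality_set_hausdorff (R := R) M_div M_inf.
split.
  (* Existence is the case of dimension 0, as the empty set has 0-dimensional measure 0. *)
  apply: contrapT => no; apply: (lower 0); first by rewrite lexx ltr01.
  have -> : @normality_set R M = set0; last exact: hausdorff_measure_set0.
  by rewrite -subset0 => x Hx; apply: no; exists x.
apply/eqP; rewrite eq_le; apply/andP; split.
  apply/lee_addgt0Pr => e e0; rewrite -EFinD; apply: ereal_inf_lbound.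
  exists (1 + e) => //; split; first by rewrite addr_ge0 // ltW.
  by apply: hausdorff_measure0; rewrite ltrDl.
apply: le_ereal_inf_tmp => _ [t [t0 tH] <-]; rewrite lee_fin leNgt; apply/negP => t1.
by apply: (lower t); rewrite ?t0.
Qed.
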